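(* Consider a two-dimensional photonic crystal, in either the TE or the TM mode, with band functions $\omega_n$, $n\in\mathbb{N}^+$. The band functions are piecewise analytic in the Brillouin zone $\mathcal{B}$. Specifically, for every $n\in\mathbb{N}^+$, let $X_n:=X_n^s\cup\{\mathbf 0\}\subset\mathcal{B}$ be the set consisting of the branch points (the set $X_n^s$ of branch points for the first $n$ bands) and the origin. Then $X_n$ has zero Lebesgue measure and $\omega_n$ is (real-)analytic in $\mathcal{B}\setminus X_n$.
   Context: **Crystal and lattice.** A 2D photonic crystal is given by a relative permittivity $\epsilon\in L^\infty(\mathbb{R}^2;\mathbb{R}^+)$, bounded away from $0$ (in the paper, piecewise constant with positive values), which is periodic: $\epsilon(\mathbf{x}+c_1\mathbf{a}_1+c_2\mathbf{a}_2)=\epsilon(\mathbf{x})$ for all $\mathbf{x}\in\mathbb{R}^2$ and $c_1,c_2\in\mathbb{Z}$, where $\mathbf{a}_1,\mathbf{a}_2\in\mathbb{R}^2$ are linearly independent primitive lattice vectors. The unit cell $\Omega$ is the cell spanned by $\mathbf{a}_1,\mathbf{a}_2$. The reciprocal lattice vectors $\mathbf{b}_1,\mathbf{b}_2$ are defined by $\mathbf{b}_i\cdot\mathbf{a}_j=2\pi\delta_{ij}$. The (first) Brillouin zone $\mathcal{B}\subset\mathbb{R}^2$ is the region of points closer to the origin than to any other point of the reciprocal lattice $\mathbb{Z}\mathbf{b}_1+\mathbb{Z}\mathbf{b}_2$. **Modes and eigenvalue problem.** In the TE mode put $\alpha=1/\epsilon$, $\beta=1$; in the TM mode put $\alpha=1$,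 $\beta=\epsilon$. For a wave vector $\mathbf{k}\in\mathbb{R}^2$ consider the operator $\mathcal{L}_{\mathbf{k}}=-\frac{1}{\beta}(\nabla+i\mathbf{k})\cdot\alpha(\nabla+i\mathbf{k})$ with periodic boundary conditions on $\Omega$. Its eigenvalue problem $\mathcal{L}_{\mathbf{k}}u=\lambda u$ is understood in variational form: find $\lambda\in\mathbb{R}$ and $0\neq u\in H^1_\pi(\Omega)$ such that $$\int_\Omega \alpha(\nabla+i\mathbf{k})u\cdot(\nabla-i\mathbf{k})\bar v\,d\mathbf{x}=\lambda\int_\Omega\beta u\bar v\,d\mathbf{x}\quad\text{for all }v\in H^1_\pi(\Omega),$$ where $H^1_\pi(\Omega)$ is the space of complex-valued $H^1(\Omega)$ functions with periodic boundary conditions on $\partial\Omega$. For each $\mathbf{k}$ the eigenvalues form a discrete non-negative sequence, enumerated non-decreasingly with multiplicity: $0\le\lambda_1(\mathbf{k})\le\lambda_2(\mathbf{k})\le\cdots\to\infty$; each $\lambda_n$ is continuous in $\mathbf{k}$. The $n$th band function is $\omega_n(\mathbf{k})=c\sqrt{\lambda_n(\mathbf{k})}$, where $c>0$ is the vacuum speed of light. **Branch points.** The Bloch variety is $$B(\mathcal{L}_{\mathbf{k}})=\{(\mathbf{k},\lambda)\in\mathbb{R}^3:\ \mathcal{L}_{\mathbf{k}}u=\lambda u\text{ admits a nonzero solution }u\}.$$ It is a known theorem (Kuchment) that there is a real-analytic function $D(\mathbf{k},\lambda)$ on $\mathbb{R}^3$ (the restriction of an entire function on $\mathbb{C}^3$)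 whose zero set is exactly $B(\mathcal{L}_{\mathbf{k}})$; fix such a $D$. Let $B^r$ be the set of $(\mathbf{k}_0,\lambda_0)\in B(\mathcal{L}_{\mathbf{k}})$ for which there is $m\in\mathbb{N}^+$ such that $\frac{\partial^{m-1}D}{\partial\lambda^{m-1}}=0$ at all points of $B(\mathcal{L}_{\mathbf{k}})$ in some neighborhood of $(\mathbf{k}_0,\lambda_0)$ and $\frac{\partial^m D}{\partial\lambda^m}(\mathbf{k}_0,\lambda_0)\ne0$. Let $B^s=B(\mathcal{L}_{\mathbf{k}})\setminus B^r$. For $n\in\mathbb{N}^+$ let $B_n=\bigcup_{l=1}^n\{(\mathbf{k},\lambda_l(\mathbf{k})):\mathbf{k}\in\mathcal{B}\}$ and $B_n^s=B_n\cap B^s$. The set of branch points for the first $n$ bands is $$X_n^s=\{\mathbf{k}\in\mathcal{B}:\ (\mathbf{k},\lambda)\in B_n^s\text{ for some }\lambda\}.$$ A function is analytic in $\mathcal{B}\setminus X_n$ if near every point of that set it is given by a convergent power series in $\mathbf{k}=(k_1,k_2)$. *)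

(* Defs.v *)
From HB Require Import structures.
From mathcomp Require Import all_boot all_order all_algebra.
From mathcomp Require Import complex.
From mathcomp Require Import all_classical all_reals all_analysis.

Set Implicit Arguments.
Unset Strict Implicit.
Unset Printing Implicit Defensive.

Import Order.TTheory GRing.Theory Num.Theory.
Import numFieldNormedType.Exports.

Local Open Scope classical_set_scope.
Local Open Scope complex_scope.
Local Open Scope ring_scope.

Definition lebesgue2 (R : realType)
    : {measure set (measurableTypeR R * measurableTypeR R) -> \bar R} :=
  (@lebesgue_measure R \x @lebesgue_measure R)%E.

Arguments lebesgue2 R : clear implicits.

Definition dot (R : realType) (x y : R * R) : R := x.1 * y.1 + x.2 * y.2.

(* The norm that the library puts on [R * R] is the sup norm. *)
Definition enorm (R : realType) (x : R * R) : R := Num.sqrt (dot x x).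

Definition lin_indep2 (R : realType) (a1 a2 : R * R) : Prop :=
  forall s t : R, s *: a1 + t *: a2 = 0 -> s = 0 /\ t = 0.

Definition dual_basis (R : realType) (a1 a2 b1 b2 : R * R) : Prop :=
  [/\ dot b1 a1 = 2 * pi, dot b1 a2 = 0, dot b2 a1 = 0 & dot b2 a2 = 2 * pi].

Definition lattice_periodic (R : realType) (T : Type) (a1 a2 : R * R) (f : R * R -> T) : Prop :=
  forall (x : R * R) (c1 c2 : int), f (x + a1 *~ c1 + a2 *~ c2) = f x.

Definition cell (R : realType) (a1 a2 : R * R) : set (R * R) :=
  [set x | exists s t : R, [/\ 0 <= s < 1, 0 <= t < 1 & x = s *: a1 + t *: a2]].

Definition brillouin (R : realType) (b1 b2 : R * R) : set (R * R) :=
  [set k | forall g : R * R, (exists m1 m2 : int, g = b1 *~ m1 + b2 *~ m2) ->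
    g != 0 -> enorm k < enorm (k - g)].

(* eps is a representative of an L^oo class: the bounds hold almost everywhere. *)

Definition permittivity (R : realType) (a1 a2 : R * R) (eps : R * R -> R) : Prop :=
  [/\ measurable_fun setT eps,
      exists lo hi : R, 0 < lo /\ {ae lebesgue2 R, forall x, lo <= eps x <= hi}
    & lattice_periodic a1 a2 eps].

Variant mode := TE | TM.

Definition alpha (R : realType) (md : mode) (eps : R * R -> R) (x : R * R) : R :=
  if md is TE then (eps x)^-1 else 1.

Definition beta (R : realType) (md : mode) (eps : R * R -> R) (x : R * R) : R :=
  if md is TE then 1 else eps x.

Definition cintegral (R : realType) (A : set (R * R)) (f : R * R -> R[i]) : R[i] :=
  (\int[lebesgue2 R]_(x in A) complex.Re (f x)) +i*
  (\int[lebesgue2 R]_(x in A) complex.Im (f x)).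

Definition L2loc (R : realType) (f : R * R -> R[i]) : Prop :=
  [/\ measurable_fun setT (fun x => complex.Re (f x)),
      measurable_fun setT (fun x => complex.Im (f x))
    & forall r : R, (lebesgue2 R).-integrable [set x | `|x| <= r]
        (fun x => (complex.Re (f x) ^+ 2 + complex.Im (f x) ^+ 2)%:E)].

(* Compactly supported functions all of whose iterated directional
   derivatives are differentiable, i.e. C_c^oo(R^2). *)
Definition test_fun (R : realType) (phi : R * R -> R) : Prop :=
  (forall (s : seq (R * R)) (x : R * R),
    differentiable (foldr (fun v f => 'D_v f) phi s) x) /\
  compact (closure [set x | phi x != 0]).

Definition weak_partial (R : realType) (e : R * R) (u g : R * R -> R[i]) : Prop :=
  forall phi : R * R -> R, test_fun phi ->
    cintegral setT (fun x => u x * ('D_e phi x)%:C) =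
    - cintegral setT (fun x => g x * (phi x)%:C).

Definition weak_gradient (R : realType) (u : R * R -> R[i])
    (g : (R * R -> R[i]) * (R * R -> R[i])) : Prop :=
  [/\ L2loc g.1, L2loc g.2, weak_partial (1, 0) u g.1 & weak_partial (0, 1) u g.2].

(* [H1per a1 a2 u gu]: u is an element, with weak gradient gu, of the space of
   H^1 functions on the cell with periodic boundary conditions, presented as
   lattice-periodic functions in H^1_loc(R^2).  Elements are representatives,
   not classes modulo a.e. equality. *)
Definition H1per (R : realType) (a1 a2 : R * R) (u : R * R -> R[i])
    (gu : (R * R -> R[i]) * (R * R -> R[i])) : Prop :=
  [/\ lattice_periodic a1 a2 u, L2loc u & weak_gradient u gu].

(* (grad + i k) u, one component *)
Definition cov (R : realType) (kj : R) (u gj : R * R -> R[i]) (x : R * R) : R[i] :=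
  gj x + 'i * kj%:C * u x.

(* Since k is real, (grad - i k) (conj v) = conj ((grad + i k) v). *)
Definition energy (R : realType) (a1 a2 : R * R) (al : R * R -> R) (k : R * R)
    (u : R * R -> R[i]) (gu : (R * R -> R[i]) * (R * R -> R[i]))
    (v : R * R -> R[i]) (gv : (R * R -> R[i]) * (R * R -> R[i])) : R[i] :=
  cintegral (cell a1 a2) (fun x => (al x)%:C *
    (cov k.1 u gu.1 x * (cov k.1 v gv.1 x)^* +
     cov k.2 u gu.2 x * (cov k.2 v gv.2 x)^*)).

(* u = 0 is allowed here. *)
Definition solution (R : realType) (a1 a2 : R * R) (md : mode) (eps : R * R -> R)
    (k : R * R) (l : R) (u : R * R -> R[i]) : Prop :=
  exists2 gu, H1per a1 a2 u gu &
    forall v gv, H1per a1 a2 v gv ->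
      energy a1 a2 (alpha md eps) k u gu v gv =
      l%:C * cintegral (cell a1 a2) (fun x => (beta md eps x)%:C * (u x * (v x)^*)).

Definition bloch_variety (R : realType) (a1 a2 : R * R) (md : mode)
    (eps : R * R -> R) : set ((R * R) * R) :=
  [set p | exists2 u, solution a1 a2 md eps p.1 p.2 u &
    ~ {ae lebesgue2 R, forall x, u x = 0}].

Definition ae_free (R : realType) (d : nat) (u : 'I_d -> R * R -> R[i]) : Prop :=
  forall c : 'I_d -> R[i],
    {ae lebesgue2 R, forall x, \sum_(i < d) c i * u i x = 0} ->
    forall i, c i = 0.

Definition eigenspace_dim_ge (R : realType) (a1 a2 : R * R) (md : mode)
    (eps : R * R -> R) (k : R * R) (l : R) (d : nat) : Prop :=
  exists2 u : 'I_d -> R * R -> R[i],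
    (forall i, solution a1 a2 md eps k l (u i)) & ae_free u.

(* lam 1 k, lam 2 k, ... enumerates the eigenvalues at k: every real l occurs
   as often as the dimension of its eigenspace.  The value lam 0 is unused. *)
Definition eigenvalue_enumeration (R : realType) (a1 a2 : R * R) (md : mode)
    (eps : R * R -> R) (lam : nat -> R * R -> R) : Prop :=
  forall k : R * R,
  [/\ 0 <= lam 1%N k,
      forall n, (0 < n)%N -> lam n k <= lam n.+1 k,
      lam n k @[n --> \oo] --> +oo
    & forall (l : R) (d : nat),
        eigenspace_dim_ge a1 a2 md eps k l d <->
        exists2 f : 'I_d -> nat, injective f &
          forall i, (0 < f i)%N /\ lam (f i) k = l].

Definition band (R : realType) (c : R) (lam : nat -> R * R -> R) (n : nat)
    (k : R * R) : R := c * Num.sqrt (lam n k).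

Definition analytic2_at (R : realType) (f : R * R -> R) (x : R * R) : Prop :=
  exists (a : nat -> nat -> R) (r : R), 0 < r /\
  forall h1 h2 : R, `|h1| < r -> `|h2| < r ->
    summable setT (fun p : nat * nat => (a p.1 p.2 * h1 ^+ p.1 * h2 ^+ p.2)%:E) /\
    (\sum_(i < N) \sum_(j < N) a i j * h1 ^+ i * h2 ^+ j) @[N --> \oo]
      --> f (x.1 + h1, x.2 + h2).

Definition analytic3_at (R : realType) (f : (R * R) * R -> R) (x : (R * R) * R) : Prop :=
  exists (a : nat -> nat -> nat -> R) (r : R), 0 < r /\
  forall h1 h2 h3 : R, `|h1| < r -> `|h2| < r -> `|h3| < r ->
    summable setT (fun p : nat * nat * nat =>
      (a p.1.1 p.1.2 p.2 * h1 ^+ p.1.1 * h2 ^+ p.1.2 * h3 ^+ p.2)%:E) /\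
    (\sum_(i < N) \sum_(j < N) \sum_(l < N)
       a i j l * h1 ^+ i * h2 ^+ j * h3 ^+ l) @[N --> \oo]
      --> f ((x.1.1 + h1, x.1.2 + h2), x.2 + h3).

Definition entire3 (R : realType) (F : (R[i] * R[i]) * R[i] -> R[i]) : Prop :=
  forall z : (R[i]^o * R[i]^o) * R[i]^o,
    differentiable (F : (R[i]^o * R[i]^o) * R[i]^o -> R[i]^o) z.

Definition dispersion_function (R : realType) (a1 a2 : R * R) (md : mode)
    (eps : R * R -> R) (D : (R * R) * R -> R) : Prop :=
  [/\ forall p, analytic3_at D p,
      exists2 F : (R[i] * R[i]) * R[i] -> R[i], entire3 F &
        forall p, F ((p.1.1%:C, p.1.2%:C), p.2%:C) = (D p)%:C
    & [set p | D p = 0] = bloch_variety a1 a2 md eps].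

Definition dlam (R : realType) (m : nat) (D : (R * R) * R -> R) (p : (R * R) * R) : R :=
  derive1n m (fun l => D (p.1, l)) p.2.

Definition regular_part (R : realType) (B : set ((R * R) * R))
    (D : (R * R) * R -> R) : set ((R * R) * R) :=
  [set p0 | B p0 /\ exists m : nat, [/\ (0 < m)%N,
    \forall p \near p0, B p -> dlam m.-1 D p = 0 & dlam m D p0 <> 0]].

Definition singular_part (R : realType) (B : set ((R * R) * R))
    (D : (R * R) * R -> R) : set ((R * R) * R) :=
  B `\` regular_part B D.

Definition bands_graph (R : realType) (b1 b2 : R * R) (lam : nat -> R * R -> R)
    (n : nat) : set ((R * R) * R) :=
  [set p | exists l : nat, [/\ (1 <= l <= n)%N, brillouin b1 b2 p.1 & p.2 = lam l p.1]].

Definition branch_points (R : realType) (b1 b2 : R * R) (B : set ((R * R) * R))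
    (D : (R * R) * R -> R) (lam : nat -> R * R -> R) (n : nat) : set (R * R) :=
  [set k | brillouin b1 b2 k /\
    exists l : R, (bands_graph b1 b2 lam n `&` singular_part B D) (k, l)].

(* Main.v *)
Require Import Defs.
From HB Require Import structures.
From mathcomp Require Import all_boot all_order all_algebra.
From mathcomp Require Import complex.
From mathcomp Require Import all_classical all_reals all_analysis.
From mathcomp Require Import measurable_realfun ring lra.

(** The proof separates three facts about the dispersion function [D] and the
    eigenvalues [lam n].

    Analyticity at regular points.  At a regular point of the variety, for
    some [m] the derivative of order [m - 1] of [D] in the spectral variable
    vanishes on the variety nearby, and the derivative of order [m] does not
    vanish at the point.  The implicit function theorem for analytic functions
    ([implicit_function]) describes the zeros of the former by one analytic
    graph, with which the continuous branch [lam n] has to agree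
    ([regular_analytic]).  The band function is the square root of [lam n] up
    to a factor, and the square root is analytic away from zero ([germ_sqrt]).

    Positivity.  A solution [u] for the eigenvalue zero has zero energy, so
    its gradient is [- i k u]; hence [e^(i k.x) u] is constant, and since [u]
    is periodic and nonzero, [k] is a reciprocal lattice vector
    ([zero_mode_reciprocal]).  The only such vector in the Brillouin zone is
    the origin, so the origin is the only place where the square root can fail.

    Smallness of the set of branch points.  Every point of [R^2 x R] has a
    finite order as a zero of [D] in the spectral variable, since otherwise a
    whole interval would consist of eigenvalues.  Near a singular point of
    order [M], the points of order at least [M] lie on an analytic graph over
    the [k] plane.  Were all derivatives of lower order to vanish along this
    graph, the variety would be the graph and the point would be regular; so
    one of them restricts to a nonzero analytic function of [k], whose zeros
    form a null set ([zeros_null], [singular_projection_null]).  Countably many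
    boxes and orders suffice ([singular_projections_null]).

    Analytic functions are handled through the weighted [l^1] norm of their
    coefficients.  This norm is submultiplicative, so a bound on it passes
    through products, compositions and sums of infinitely many series; the
    implicit function is obtained as such a sum.  Weak derivatives are tested
    only against finite sums of products [f(x_1) q(x_2)] of one-variable bump
    functions: that class is stable under all the operations needed (products
    with [cos (k.x)], translations, primitives of differences of translates)
    and is large enough to determine a locally integrable function. *)

Import Order.TTheory GRing.Theory Num.Theory.
Import numFieldNormedType.Exports.

Local Open Scope classical_set_scope.
Local Open Scope ring_scope.

Set Implicit Arguments.
Unset Strict Implicit.
Unset Printing Implicit Defensive.

(** * Sums of absolutely summable families *)

Section AbsoluteSums.
Context {R : realType}.
Implicit Types (T K : choiceType).

Definition l1norm T (x : T -> R) : \bar R :=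
  (\esum_(t in [set: T]) `|x t|%:E)%E.

(** Defined for an arbitrary index type through positive and negative parts,
    so that reindexing and the exchange of sums reduce to sums of nonnegative
    extended reals. *)
Definition l1sum T (x : T -> R) : R :=
  fine (l1norm (fun t => Num.max (x t) 0)) - fine (l1norm (fun t => Num.max (- x t) 0)).

Lemma l1norm_ge0 T (x : T -> R) : (0 <= l1norm x)%E.
Proof. by apply: esum_ge0 => t _; rewrite lee_fin. Qed.

Lemma le_l1norm T (x y : T -> R) : (forall t, `|x t| <= `|y t|) -> (l1norm x <= l1norm y)%E.
Proof. by move=> xy; apply: le_esum => t _; rewrite lee_fin. Qed.

Lemma eq_l1norm T (x y : T -> R) : (forall t, `|x t| = `|y t|) -> l1norm x = l1norm y.
Proof. by move=> xy; apply: eq_esum => t _; rewrite xy. Qed.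

Lemma l1norm_le T (x : T -> R) (M : \bar R) :
  (forall F : set T, finite_set F -> (\sum_(t \in F) `|x t|%:E <= M)%E) ->
  (l1norm x <= M)%E.
Proof. by move=> h; apply: ge_ereal_sup => _ [F [finF _] <-]; exact: h. Qed.

Lemma l1norm_fin T (x : T -> R) (M : R) : (l1norm x <= M%:E)%E -> l1norm x \is a fin_num.
Proof. by move=> h; rewrite ge0_fin_numE ?l1norm_ge0// (le_lt_trans h)// ltry. Qed.

Lemma l1normD T (p q : T -> R) : (forall t, 0 <= p t) -> (forall t, 0 <= q t) ->
  (l1norm (fun t => p t + q t)%R = l1norm p + l1norm q)%E.
Proof.
move=> p0 q0; rewrite /l1norm -esumD; last 2 first.
- by move=> t _; rewrite lee_fin.
- by move=> t _; rewrite lee_fin.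
by apply: eq_esum => t _; rewrite -EFinD !ger0_norm ?addr_ge0.
Qed.

Lemma l1normD_le T (x y : T -> R) :
  (l1norm (fun t => x t + y t)%R <= l1norm x + l1norm y)%E.
Proof.
rewrite (eq_l1norm (x := x) (y := fun t => `|x t|)); last by move=> t; rewrite normr_id.
rewrite (eq_l1norm (x := y) (y := fun t => `|y t|)); last by move=> t; rewrite normr_id.
rewrite -l1normD//; apply: le_l1norm => t.
by rewrite (le_trans (ler_normD _ _))// ler_norm.
Qed.

Lemma l1normZ_le T (c : R) (x : T -> R) (M : R) : (l1norm x <= M%:E)%E ->
  (l1norm (fun t => c * x t)%R <= (`|c| * M)%:E)%E.
Proof.
move=> xM; apply: l1norm_le => F finF.
have : (\sum_(t \in F) `|x t|%:E <= M%:E)%E.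
  by apply: le_trans xM; apply: ereal_sup_ubound; exists F.
rewrite !fsbig_finite//= !sumEFin !lee_fin => h.
under eq_bigr do rewrite normrM.
by rewrite -mulr_sumr ler_wpM2l.
Qed.

Lemma l1norm_reindex T K (e : T -> K) (x : K -> R) :
  bijective e -> l1norm (fun t => x (e t)) = l1norm x.
Proof.
move=> be; rewrite /l1norm (@reindex_esum R T K setT setT e)//.
by rewrite setTT_bijective.
Qed.

Lemma l1norm_prod T K (x : T -> K -> R) :
  l1norm (fun p : T * K => x p.1 p.2) = (\esum_(t in [set: T]) l1norm (x t))%E.
Proof.
rewrite /l1norm esum_esum; last by move=> i j _ _; rewrite lee_fin.
by congr esum; apply/seteqP; split.
Qed.

Lemma l1norm_single T (x : T -> R) t : (forall s, s != t -> x s = 0) ->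
  l1norm x = `|x t|%:E.
Proof.
move=> x0; rewrite /l1norm (esumID [set t])//=.
rewrite setTI setTI esum_set1 ?lee_fin// esum1 ?adde0//.
by move=> s /= /eqP st; rewrite x0// normr0.
Qed.

(** The decomposition into nonnegative families is irrelevant: [p + x^-] and
    [q + x^+] are the same family. Linearity and the iteration of sums follow
    by choosing convenient [p] and [q]. *)
Lemma l1sumE T (p q x : T -> R) : (forall t, 0 <= p t) -> (forall t, 0 <= q t) ->
  (forall t, x t = p t - q t) -> (l1norm p < +oo)%E -> (l1norm q < +oo)%E ->
  l1sum x = fine (l1norm p) - fine (l1norm q).
Proof.
move=> p0 q0 xpq Pf Qf; rewrite /l1sum.
set p' := fun t => Num.max (x t) 0; set q' := fun t => Num.max (- x t) 0.
have p'0 t : 0 <= p' t by rewrite le_max lexx orbT.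
have q'0 t : 0 <= q' t by rewrite le_max lexx orbT.
(* Both sides are sums of nonnegative families, for which additivity holds. *)
have xpq' t : p' t + q t = p t + q' t.
  rewrite /p' /q' xpq; have [h|h] := leP 0 (p t - q t).
    by rewrite (max_idPr _); [lra|lra].
  by rewrite (max_idPl _); [lra|lra].
have P'f : (l1norm p' < +oo)%E.
  apply: le_lt_trans Pf; apply: le_l1norm => t; rewrite !ger0_norm// /p' ge_max p0 andbT.
  by rewrite xpq lerBlDr lerDl.
have Q'f : (l1norm q' < +oo)%E.
  apply: le_lt_trans Qf; apply: le_l1norm => t; rewrite !ger0_norm// /q' ge_max q0 andbT.
  by rewrite xpq opprB lerBlDr lerDl.
have : l1norm (fun t => p' t + q t) = l1norm (fun t => p t + q' t).
  by apply: eq_l1norm => t; rewrite xpq'.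
rewrite !l1normD//.
have F (y : T -> R) : (l1norm y < +oo)%E -> l1norm y = (fine (l1norm y))%:E.
  by move=> h; rewrite fineK// ge0_fin_numE ?l1norm_ge0.
rewrite (F _ Pf) (F _ Qf) (F _ P'f) (F _ Q'f) -!EFinD => -[]; rewrite /=.
by move=> h; lra.
Qed.

Lemma pos_neg_partE (z : R) : Num.max z 0 - Num.max (- z) 0 = z.
Proof. by have [h|h] := leP 0 z; [rewrite (max_idPr _); lra|rewrite (max_idPl _); lra]. Qed.

Lemma l1norm_maxl T (x : T -> R) : (l1norm (fun t => Num.max (x t) 0)%R <= l1norm x)%E.
Proof.
apply: le_l1norm => t; rewrite ger0_norm ?le_max ?lexx ?orbT//.
by rewrite ge_max normr_ge0 ler_norm.
Qed.

Lemma l1norm_maxr T (x : T -> R) : (l1norm (fun t => Num.max (- x t) 0)%R <= l1norm x)%E.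
Proof.
rewrite (eq_l1norm (x := x) (y := fun t => - x t)); last by move=> t; rewrite normrN.
exact: l1norm_maxl.
Qed.

Lemma eq_l1sum T (x y : T -> R) : x =1 y -> l1sum x = l1sum y.
Proof. by move=> /funext ->. Qed.

Lemma l1sum_norm T (x : T -> R) (M : R) : (l1norm x <= M%:E)%E -> `|l1sum x| <= M.
Proof.
move=> xM; rewrite /l1sum.
have h1 := l1norm_maxl x; have h2 := l1norm_maxr x.
have := l1norm_ge0 (fun t => Num.max (x t) 0).
have := l1norm_ge0 (fun t => Num.max (- x t) 0).
have f1 := l1norm_fin (le_trans h1 xM); have f2 := l1norm_fin (le_trans h2 xM).
move: (le_trans h1 xM) (le_trans h2 xM).
rewrite -(fineK f1) -(fineK f2) !lee_fin => a b c d.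
by rewrite ler_norml; apply/andP; split; lra.
Qed.

Lemma l1sumZ T (c : R) (x : T -> R) : (l1norm x < +oo)%E ->
  l1sum (fun t => c * x t) = c * l1sum x.
Proof.
move=> xf.
wlog c0 : c / 0 <= c.
  move=> h; have [|/ltW c0] := leP 0 c; first exact: h.
  have := h (- c); rewrite oppr_ge0 => /(_ c0) e.
  rewrite -[RHS]opprK -mulNr -e /l1sum.
  rewrite opprB; congr (fine _ - fine _); apply: eq_l1norm => t; rewrite ?mulNr//.
  by rewrite opprK.
have Zf (y : T -> R) : (l1norm y <= l1norm x)%E ->
    (l1norm (fun t => c * y t)%R < +oo)%E /\ fine (l1norm (fun t => c * y t)) = c * fine (l1norm y).
  move=> yx; have yf : l1norm y \is a fin_num.
    by rewrite ge0_fin_numE ?l1norm_ge0// (le_lt_trans yx).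
  have h : (l1norm (fun t => c * y t)%R <= (c * fine (l1norm y))%:E)%E.
    by rewrite -{2}(ger0_norm c0); apply: l1normZ_le; rewrite fineK.
  have hf := l1norm_fin h; split; first by rewrite (le_lt_trans h)// ltry.
  apply/eqP; rewrite eq_le; apply/andP; split.
    by rewrite -lee_fin fineK.
  have [->|cn0] := eqVneq c 0; first by rewrite mul0r fine_ge0// l1norm_ge0.
  have cp : 0 < c by rewrite lt_def cn0.
  rewrite -ler_pdivlMl// -lee_fin fineK//.
  have -> : l1norm y = l1norm (fun t => c^-1 * (c * y t)).
    by apply: eq_l1norm => t; rewrite mulrA mulVf// mul1r.
  by rewrite -{2}(@ger0_norm _ c^-1) ?invr_ge0//; apply: l1normZ_le; rewrite fineK.
have [a1 a2] := Zf _ (l1norm_maxl x); have [b1 b2] := Zf _ (l1norm_maxr x).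
rewrite (@l1sumE _ (fun t => c * Num.max (x t) 0) (fun t => c * Num.max (- x t) 0))//.
- by rewrite a2 b2 -mulrBr.
- by move=> t; rewrite mulr_ge0// le_max lexx orbT.
- by move=> t; rewrite mulr_ge0// le_max lexx orbT.
- by move=> t; rewrite -mulrBr pos_neg_partE.
Qed.

Lemma l1sum_single T (x : T -> R) t : (forall s, s != t -> x s = 0) -> l1sum x = x t.
Proof.
move=> x0; rewrite /l1sum !(@l1norm_single _ _ t)/=.
- by rewrite !ger0_norm ?le_max ?lexx ?orbT// pos_neg_partE.
- by move=> s st; rewrite x0// oppr0 maxxx.
- by move=> s st; rewrite x0// maxxx.
Qed.

Lemma l1sum_reindex T K (e : T -> K) (x : K -> R) :
  bijective e -> l1sum (fun t => x (e t)) = l1sum x.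
Proof.
move=> be; rewrite /l1sum.
by rewrite (l1norm_reindex (fun k => Num.max (x k) 0) be)
  (l1norm_reindex (fun k => Num.max (- x k) 0) be).
Qed.

(** Positive and negative parts can be summed in any order. *)
Lemma l1sum_prod T K (x : T -> K -> R) :
  (l1norm (fun p : T * K => x p.1 p.2) < +oo)%E ->
  l1sum (fun p : T * K => x p.1 p.2) = l1sum (fun t => l1sum (x t)).
Proof.
move=> xf.
have key (y : T -> K -> R) : (forall t k, 0 <= y t k) ->
  (l1norm (fun p : T * K => y p.1 p.2) < +oo)%E ->
  (forall t, l1norm (y t) \is a fin_num) /\
  l1norm (fun p : T * K => y p.1 p.2) = l1norm (fun t => fine (l1norm (y t))).
  move=> y0 yf.
  have h t : l1norm (y t) \is a fin_num.
    rewrite ge0_fin_numE ?l1norm_ge0//; apply: le_lt_trans yf; rewrite l1norm_prod.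
    rewrite (esumID [set t])//=; last by move=> *; exact: l1norm_ge0.
    rewrite !setTI esum_set1 ?l1norm_ge0// leeDl//.
    by apply: esum_ge0 => *; exact: l1norm_ge0.
  split => //; rewrite l1norm_prod; apply: eq_esum => t _.
  by rewrite ger0_norm ?fineK ?fine_ge0 ?l1norm_ge0.
have m0 (z : R) : 0 <= Num.max z 0 by rewrite le_max lexx orbT.
have [f1 e1] := key (fun t k => Num.max (x t k) 0) (fun t k => m0 _)
  (le_lt_trans (l1norm_maxl _) xf).
have [f2 e2] := key (fun t k => Num.max (- x t k) 0) (fun t k => m0 _)
  (le_lt_trans (l1norm_maxr _) xf).
rewrite [LHS]/l1sum e1 e2; symmetry; apply: l1sumE => //.
- by move=> t; rewrite fine_ge0// l1norm_ge0.
- by move=> t; rewrite fine_ge0// l1norm_ge0.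
- by rewrite -e1 (le_lt_trans (l1norm_maxl _) xf).
- by rewrite -e2 (le_lt_trans (l1norm_maxr _) xf).
Qed.

Lemma l1sum_exchange T K (x : T -> K -> R) :
  (l1norm (fun p : T * K => x p.1 p.2) < +oo)%E ->
  l1sum (fun t => l1sum (x t)) = l1sum (fun k => l1sum (x^~ k)).
Proof.
move=> xf.
have bs : bijective (fun p : K * T => (p.2, p.1)).
  by exists (fun p => (p.2, p.1)) => -[].
rewrite -l1sum_prod// -(l1sum_reindex _ bs)/= (@l1sum_prod K T (fun k t => x t k))//.
by rewrite (l1norm_reindex (fun p => x p.1 p.2) bs).
Qed.

Lemma l1norm_exchange T K (x : T -> K -> R) :
  (\esum_(t in [set: T]) l1norm (x t) = \esum_(k in [set: K]) l1norm (x^~ k))%E.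
Proof.
rewrite -l1norm_prod -(l1norm_prod (fun k t => x t k)).
have bs : bijective (fun p : K * T => (p.2, p.1)).
  by exists (fun p => (p.2, p.1)) => -[].
by rewrite -(l1norm_reindex _ bs).
Qed.

Lemma l1sumD T (x y : T -> R) : (l1norm x < +oo)%E -> (l1norm y < +oo)%E ->
  l1sum (fun t => x t + y t) = l1sum x + l1sum y.
Proof.
move=> xf yf.
have m0 (z : R) : 0 <= Num.max z 0 by rewrite le_max lexx orbT.
have a1 := le_lt_trans (l1norm_maxl _) xf; have a2 := le_lt_trans (l1norm_maxr _) xf.
have b1 := le_lt_trans (l1norm_maxl _) yf; have b2 := le_lt_trans (l1norm_maxr _) yf.
rewrite (@l1sumE _ (fun t => Num.max (x t) 0 + Num.max (y t) 0)
  (fun t => Num.max (- x t) 0 + Num.max (- y t) 0)).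
- rewrite !l1normD// !fineD ?ge0_fin_numE ?l1norm_ge0//; rewrite /l1sum; lra.
- by move=> t; rewrite addr_ge0.
- by move=> t; rewrite addr_ge0.
- by move=> t; rewrite -{1}(pos_neg_partE (x t)) -{1}(pos_neg_partE (y t)); lra.
- by rewrite l1normD// lte_add_pinfty.
- by rewrite l1normD// lte_add_pinfty.
Qed.

End AbsoluteSums.

Section Exhaustions.
Context {R : realType}.

Lemma l1sum_normE (T : choiceType) (x : T -> R) : (`|l1sum x|%:E <= l1norm x)%E.
Proof.
have [xf|] := boolP (l1norm x \is a fin_num).
  by rewrite -(fineK xf) lee_fin; apply: l1sum_norm; rewrite fineK.
by rewrite ge0_fin_numE ?l1norm_ge0// -leNgt leye_eq => /eqP ->; rewrite leey.
Qed.

Lemma l1norm_inj (K T : choiceType) (e : K -> T) (x : T -> R) : injective e ->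
  (forall t, (forall k, t != e k) -> x t = 0) -> l1norm (fun k => x (e k)) = l1norm x.
Proof.
move=> inje x0; rewrite /l1norm -(@esum_image _ _ _ setT e (fun t => `|x t|%:E)); last first.
  by move=> a b _ _; exact: inje.
rewrite esum_mkcond; apply: eq_esum => t _.
case: ifPn => // /negP h; rewrite x0 ?normr0// => k.
by apply/eqP => tk; apply: h; rewrite inE; exists k.
Qed.

Lemma l1norm_inj_le (K T : choiceType) (e : K -> T) (x : T -> R) : injective e ->
  (l1norm (fun k => x (e k)) <= l1norm x)%E.
Proof.
move=> inje; rewrite /l1norm -(@esum_image _ _ _ setT e (fun t => `|x t|%:E)); last first.
  by move=> a b _ _; exact: inje.
rewrite esum_mkcond; apply: le_esum => t _.
by case: ifPn => // _; rewrite lee_fin.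
Qed.

Lemma l1sum_inj (K T : choiceType) (e : K -> T) (x : T -> R) : injective e ->
  (forall t, (forall k, t != e k) -> x t = 0) -> l1sum (fun k => x (e k)) = l1sum x.
Proof.
move=> inje x0; rewrite /l1sum.
rewrite -(@l1norm_inj _ _ e (fun t => Num.max (x t) 0))//; last first.
  by move=> t /x0 ->; rewrite maxxx.
rewrite -(@l1norm_inj _ _ e (fun t => Num.max (- x t) 0))//.
by move=> t /x0 ->; rewrite oppr0 maxxx.
Qed.

Lemma l1sumB (T : choiceType) (x y : T -> R) : (l1norm x < +oo)%E -> (l1norm y < +oo)%E ->
  l1sum x - l1sum y = l1sum (fun t => x t - y t).
Proof.
move=> xf yf; rewrite l1sumD//; last by rewrite (eq_l1norm (y := y))// => t; rewrite normrN.
congr (_ + _); rewrite -mulN1r -l1sumZ//; apply: eq_l1sum => t; by rewrite mulN1r.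
Qed.

Lemma l1norm_sum_ge (T : choiceType) (x : T -> R) (s : seq T) : uniq s ->
  ((\sum_(t <- s) `|x t|)%:E <= l1norm x)%E.
Proof.
move=> us; apply: ereal_sup_ubound; exists [set` s]; first by split.
rewrite fsbig_finite//= -sumEFin; apply: perm_big; apply: uniq_perm => //.
by move=> t; rewrite in_fset_set// mem_setE.
Qed.

(** The supremum that defines the norm is reached up to [e] on one finite set,
    and [F n] eventually contains this set. *)
Lemma l1norm_exhaust (T : choiceType) (p : T -> R) (F : nat -> seq T) :
  (l1norm p < +oo)%E -> (forall t, 0 <= p t) -> (forall n, uniq (F n)) ->
  (forall t, \forall n \near \oo, t \in F n) ->
  \sum_(t <- F n) p t @[n --> \oo] --> fine (l1norm p).
Proof.
move=> pf p0 uF inF; have pfn : l1norm p \is a fin_num by rewrite ge0_fin_numE ?l1norm_ge0.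
have absE (s : seq T) : \sum_(t <- s) `|p t| = \sum_(t <- s) p t.
  by apply: eq_bigr => t _; rewrite ger0_norm.
apply/cvgrPdist_lt => e e0.
have [A [finA _] hA] : exists2 A : set T, fsets setT A &
    (l1norm p - e%:E < \sum_(t \in A) `|p t|%:E)%E.
  have [_ [A AF <-] h] := @ub_ereal_sup_adherent _ _ _ e0 pfn.
  by exists A.
move: finA => /finite_seqP[s sA]; subst A.
have near_s : \forall n \near \oo, {subset s <= F n}.
  elim: s {hA} => [|t s ih]; first by near=> n.
  near=> n; move=> u; rewrite inE => /orP[/eqP ->|us].
    by near: n; exact: inF.
  by move: u us; near: n; exact: ih.
near=> n.
have le1 : \sum_(t <- F n) p t <= fine (l1norm p).
  by rewrite -lee_fin fineK// -absE l1norm_sum_ge.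
rewrite ger0_norm ?subr_ge0// ltrBlDr -ltrBlDl.
have sub : {subset undup s <= F n}.
  by move=> t; rewrite mem_undup; move: t; near: n.
apply: (@lt_le_trans _ _ (\sum_(t <- undup s) p t)).
  rewrite -lte_fin EFinB fineK// (lt_le_trans hA)// fsbig_finite//= sumEFin lee_fin absE.
  rewrite le_eqVlt; apply/orP; left; apply/eqP; apply: perm_big; apply: uniq_perm => //.
    exact: undup_uniq.
  by move=> t; rewrite in_fset_set// mem_undup mem_setE.
rewrite [leRHS](bigID (mem (undup s)))/= -[leLHS]addr0 lerD//; last exact: sumr_ge0.
rewrite -[leRHS]big_filter le_eqVlt; apply/orP; left; apply/eqP; apply: perm_big; apply: uniq_perm.
- exact: undup_uniq.
- exact: filter_uniq.
- move=> t; rewrite mem_filter; case: (boolP (t \in undup s)) => //= ts.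
  by rewrite sub.
Unshelve. all: by end_near.
Qed.

Lemma l1sum_exhaust (T : choiceType) (x : T -> R) (F : nat -> seq T) :
  (l1norm x < +oo)%E -> (forall n, uniq (F n)) ->
  (forall t, \forall n \near \oo, t \in F n) ->
  \sum_(t <- F n) x t @[n --> \oo] --> l1sum x.
Proof.
move=> xf uF inF.
have m0 (z : R) : 0 <= Num.max z 0 by rewrite le_max lexx orbT.
have c1 := l1norm_exhaust (le_lt_trans (l1norm_maxl _) xf) (fun t => m0 _) uF inF.
have c2 := l1norm_exhaust (le_lt_trans (l1norm_maxr _) xf) (fun t => m0 _) uF inF.
rewrite (_ : (fun n => _) = (fun n => \sum_(t <- F n) Num.max (x t) 0
                                  - \sum_(t <- F n) Num.max (- x t) 0)); first exact: cvgB.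
by apply/funext => n; rewrite -sumrB; apply: eq_bigr => t _; rewrite pos_neg_partE.
Qed.

End Exhaustions.

(** * The norm of a power series in finitely many variables *)

Section PowerSeries.
Context {R : realType}.
Implicit Types (I J : finType).

Definition inbox I (rho : I -> R) (h : I -> R) := forall i, `|h i| <= rho i.

Definition monom I (h : I -> R) (al : {ffun I -> nat}) : R := \prod_i h i ^+ al i.

Lemma monom_ge0 I (rho : I -> R) al : (forall i, 0 <= rho i) -> 0 <= monom rho al.
Proof. by move=> r0; apply: prodr_ge0 => i _; rewrite exprn_ge0. Qed.

Lemma monom_gt0 I (rho : I -> R) al : (forall i, 0 < rho i) -> 0 < monom rho al.
Proof. by move=> r0; apply: prodr_gt0 => i _; rewrite exprn_gt0. Qed.

Lemma monom_le I (rho h : I -> R) al : inbox rho h -> `|monom h al| <= monom rho al.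
Proof.
move=> hr; rewrite /monom normr_prod; apply: ler_prod => i _.
by rewrite normr_ge0 normrX lerXn2r// ?nnegrE// (le_trans _ (hr i)).
Qed.

Lemma monomD I (h : I -> R) (al be : {ffun I -> nat}) :
  monom h [ffun i => (al i + be i)%N] = monom h al * monom h be.
Proof. by rewrite /monom -big_split/=; apply: eq_bigr => i _; rewrite ffunE exprD. Qed.

(** A bound [M] on the norm with weights [rho] is kept, instead of mere
    convergence, because it is submultiplicative and adds up over infinite
    sums. *)
Definition powser I (rho : I -> R) (M : R) (a : {ffun I -> nat} -> R) (f : (I -> R) -> R) :=
  (l1norm (fun al => a al * monom rho al)%R <= M%:E)%E /\
  forall h, inbox rho h -> f h = l1sum (fun al => a al * monom h al).

Definition analytic_le I (rho : I -> R) (M : R) (f : (I -> R) -> R) := exists a, powser rho M a f.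

Lemma powser_l1norm I (rho : I -> R) M a f h : powser rho M a f -> inbox rho h ->
  (l1norm (fun al => a al * monom h al)%R <= M%:E)%E.
Proof.
move=> [aM _] hr; apply: le_trans aM; apply: le_l1norm => al.
by rewrite !normrM ler_wpM2l// (le_trans (monom_le _ hr)) ?ler_norm.
Qed.

Lemma an_norm I (rho : I -> R) M f h : analytic_le rho M f -> inbox rho h -> `|f h| <= M.
Proof.
move=> [a fa] hr; have [_ ->//] := fa.
by apply: l1sum_norm; exact: powser_l1norm fa hr.
Qed.

Lemma an_ge0 I (rho : I -> R) M f : analytic_le rho M f -> 0 <= M.
Proof. by move=> [a [aM _]]; rewrite -lee_fin (le_trans (l1norm_ge0 _) aM). Qed.

Lemma an_ext I (rho : I -> R) M f g : (forall h, inbox rho h -> f h = g h) ->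
  analytic_le rho M f -> analytic_le rho M g.
Proof. by move=> fg [a [aM fa]]; exists a; split=> // h hr; rewrite -fg// fa. Qed.

Lemma an_weaken I (rho : I -> R) M M' f : M <= M' -> analytic_le rho M f -> analytic_le rho M' f.
Proof.
by move=> MM [a [aM fa]]; exists a; split=> //; rewrite (le_trans aM)// lee_fin.
Qed.

Lemma powser_box I (rho rho' : I -> R) M a f : inbox rho rho' -> powser rho M a f ->
  powser rho' M a f.
Proof.
move=> rr fa; split; first exact: powser_l1norm fa rr.
move=> h hr; have [_ ->//] := fa; move=> i.
by rewrite (le_trans (hr i))// (le_trans _ (rr i))// ler_norm.
Qed.

Lemma an_box I (rho rho' : I -> R) M f : inbox rho rho' -> analytic_le rho M f -> analytic_le rho' M f.
Proof. by move=> rr [a fa]; exists a; exact: powser_box fa. Qed.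

Lemma an_monom I (rho : I ->
  R) (c : R) al : analytic_le rho `|c * monom rho al| (fun h => c * monom h al).
Proof.
exists (fun be => if be == al then c else 0); split.
  rewrite (@l1norm_single _ _ _ al) ?eqxx// => be /negbTE ->; by rewrite mul0r.
move=> h _; rewrite (@l1sum_single _ _ _ al) ?eqxx// => be /negbTE ->; by rewrite mul0r.
Qed.

(** A series of power series can be rearranged into one power series because
    the norms are summable. Products and compositions are obtained from this
    case. *)
Lemma an_sum I (rho : I -> R) (K : choiceType) (M : K -> R) (M' : R)
    (f : K -> (I -> R) -> R) g : (forall i, 0 < rho i) ->
  (forall k, analytic_le rho (M k) (f k)) -> (l1norm M <= M'%:E)%E ->
  (forall h, inbox rho h -> g h = l1sum (fun k => f k h)) -> analytic_le rho M' g.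
Proof.
move=> r0 /choice[a fa] MM gf.
have Mk0 k : 0 <= M k by apply: an_ge0; exists (a k); exact: fa.
have tot h : inbox rho h ->
    (\esum_(k in [set: K]) l1norm (fun al => a k al * monom h al)%R <= M'%:E)%E.
  move=> hr; apply: le_trans MM; apply: le_esum => k _.
  by rewrite ger0_norm//; exact: powser_l1norm (fa k) hr.
have rb : inbox rho rho by move=> i; rewrite ger0_norm// ltW.
have sk h al : inbox rho h -> (l1norm (fun k => a k al * monom h al)%R <= M'%:E)%E.
  move=> hr; apply: le_trans (tot _ hr); rewrite l1norm_exchange.
  rewrite (esumID [set al])//=; last by move=> *; exact: l1norm_ge0.
  rewrite !setTI esum_set1 ?l1norm_ge0// leeDl//.
  by apply: esum_ge0 => *; exact: l1norm_ge0.
(* The weights are positive, so each column of coefficients is summable. *)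
have sk1 al : (l1norm (fun k => a k al) < +oo)%E.
  have -> : l1norm (fun k => a k al) = l1norm (fun k => (monom rho al)^-1 * (a k al * monom rho al)).
    by apply: eq_l1norm => k; rewrite mulrCA mulVf ?mulr1// gt_eqF// monom_gt0.
  by apply: le_lt_trans (l1normZ_le _ (sk _ al rb)) _; rewrite ltry.
have rk h al : l1sum (fun k => a k al) * monom h al = l1sum (fun k => a k al * monom h al).
  by rewrite mulrC -l1sumZ//; apply: eq_l1sum => k; rewrite mulrC.
exists (fun al => l1sum (fun k => a k al)); split.
  apply: le_trans (tot _ rb); rewrite l1norm_exchange; apply: le_esum => al _.
  by rewrite rk; exact: l1sum_normE.
move=> h hr; rewrite gf//.
under eq_l1sum do rewrite (fa _).2//.
rewrite l1sum_exchange; first by apply: eq_l1sum => al; rewrite rk.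
rewrite (l1norm_prod (fun k al => a k al * monom h al)).
by apply: le_lt_trans (tot _ hr) _; rewrite ltry.
Qed.

(** Expand [f]: the product is the sum over its monomials of multiples of [g],
    each of which is again such a sum. *)
Lemma an_mul I (rho : I -> R) M N f g : (forall i, 0 < rho i) ->
  analytic_le rho M f -> analytic_le rho N g -> analytic_le rho (M * N) (fun h => f h * g h).
Proof.
move=> r0 fM gN; have N0 := an_ge0 gN.
move: fM gN => [a fa] [b gb].
have h1 al : analytic_le rho (`|a al * monom rho al| * N) (fun h => a al * monom h al * g h).
  apply: (@an_sum _ _ _ (fun be => `|a al * b be * monom rho [ffun i => (al i + be i)%N]|) _
    (fun be h => a al * b be * monom h [ffun i => (al i + be i)%N])) => //.
  - by move=> be; exact: an_monom.
  - rewrite (eq_l1norm (y := fun be => (a al * monom rho al) * (b be * monom rho be))).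
      by apply: l1normZ_le; case: gb.
    by move=> be; rewrite normr_id monomD mulrACA.
  - move=> h hr; have [_ ->//] := gb; rewrite -l1sumZ.
      by apply: eq_l1sum => be; rewrite monomD mulrACA.
    by apply: le_lt_trans (powser_l1norm gb hr) _; rewrite ltry.
apply: (an_sum r0 h1).
  rewrite mulrC -{2}(ger0_norm N0).
  under [X in l1norm X]eq_fun do rewrite mulrC.
  apply: l1normZ_le; rewrite (eq_l1norm (y := fun al => a al * monom rho al)).
    by case: fa.
  by move=> al; rewrite normr_id.
move=> h hr; have [_ ->//] := fa; rewrite mulrC -l1sumZ.
  by apply: eq_l1sum => al; rewrite mulrC.
by apply: le_lt_trans (powser_l1norm fa hr) _; rewrite ltry.
Qed.

Lemma an_add I (rho : I -> R) M N f g : (forall i, 0 <= rho i) ->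
  analytic_le rho M f -> analytic_le rho N g -> analytic_le rho (M + N) (fun h => f h + g h).
Proof.
move=> r0 [a fa] [b gb]; exists (fun al => a al + b al); split.
  under [X in l1norm X]eq_fun do rewrite mulrDl.
  by rewrite (le_trans (l1normD_le _ _))// EFinD leeD//; [case: fa|case: gb].
move=> h hr; have [_ ->//] := fa; have [_ ->//] := gb; rewrite -l1sumD.
- by apply: eq_l1sum => al; rewrite mulrDl.
- by apply: le_lt_trans (powser_l1norm fa hr) _; rewrite ltry.
- by apply: le_lt_trans (powser_l1norm gb hr) _; rewrite ltry.
Qed.

Lemma an_cst I (rho : I -> R) c : analytic_le rho `|c| (fun=> c).
Proof.
have m1 (h : I -> R) : monom h [ffun=> 0%N] = 1.
  by rewrite /monom big1// => i _; rewrite ffunE expr0.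
have := an_monom rho c [ffun=> 0%N]; rewrite m1 mulr1.
by apply: an_ext => h _; rewrite m1 mulr1.
Qed.

Lemma an_coord I (rho : I -> R) i : (forall i, 0 <= rho i) -> analytic_le rho (rho i) (fun h => h i).
Proof.
have m1 (h : I -> R) : monom h [ffun j => nat_of_bool (j == i)] = h i.
  rewrite /monom (bigD1 i)//= ffunE eqxx expr1 big1 ?mulr1// => j /negbTE ji.
  by rewrite ffunE ji expr0.
move=> r0; have := an_monom rho 1 [ffun j => nat_of_bool (j == i)].
rewrite m1 mul1r ger0_norm//.
by apply: an_ext => h _; rewrite m1 mul1r.
Qed.

Lemma an_scale I (rho : I -> R) M f c : (forall i, 0 < rho i) ->
  analytic_le rho M f -> analytic_le rho (`|c| * M) (fun h => c * f h).
Proof. by move=> r0; apply: an_mul => //; exact: an_cst. Qed.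

Lemma an_exp I (rho : I -> R) M f n : (forall i, 0 < rho i) ->
  analytic_le rho M f -> analytic_le rho (M ^+ n) (fun h => f h ^+ n).
Proof.
move=> r0 fM; elim: n => [|n ih].
  by have := an_cst rho 1; rewrite normr1 expr0.
rewrite exprS; apply: an_ext (an_mul r0 fM ih) => h _; by rewrite exprS.
Qed.

Lemma an_prod I (rho : I -> R) (J : Type) (s : seq J) (M : J -> R) f :
  (forall i, 0 < rho i) -> (forall j, analytic_le rho (M j) (f j)) ->
  analytic_le rho (\prod_(j <- s) M j) (fun h => \prod_(j <- s) f j h).
Proof.
move=> r0 fM; elim: s => [|j s ih].
  have := an_cst rho 1; rewrite normr1 big_nil; apply: an_ext => h _; by rewrite big_nil.
rewrite big_cons; apply: an_ext (an_mul r0 (fM j) ih) => h _; by rewrite big_cons.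
Qed.

Lemma an_bigsum I (rho : I -> R) (J : Type) (s : seq J) (M : J -> R) f :
  (forall i, 0 < rho i) -> (forall j, analytic_le rho (M j) (f j)) ->
  analytic_le rho (\sum_(j <- s) M j) (fun h => \sum_(j <- s) f j h).
Proof.
move=> r0 fM; elim: s => [|j s ih].
  have := an_cst rho 0; rewrite normr0 big_nil; apply: an_ext => h _; by rewrite big_nil.
rewrite big_cons; apply: an_ext (an_add (fun i => ltW (r0 i)) (fM j) ih) => h _.
by rewrite big_cons.
Qed.

(** Expand [f] and substitute: the norm of [phi j] is at most the weight [sig
    j], so by submultiplicativity the norm of each substituted monomial is at
    most its weight in the norm of [f]. *)
Lemma an_comp I J (rho : I -> R) (sig : J -> R) M f (phi : J -> (I -> R) -> R) :
  (forall i, 0 < rho i) -> (forall j, 0 <= sig j) ->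
  analytic_le sig M f -> (forall j, analytic_le rho (sig j) (phi j)) ->
  analytic_le rho M (fun h => f (fun j => phi j h)).
Proof.
move=> r0 s0 [a [aM fa]] phis.
apply: (@an_sum _ _ _ (fun be => `|a be| * monom sig be) _
  (fun be h => a be * \prod_j phi j h ^+ be j)) => //.
- move=> be; apply: an_scale => //; apply: an_prod => // j.
  exact: an_exp.
- rewrite (eq_l1norm (y := fun be => a be * monom sig be))// => be.
  by rewrite !normrM normr_id.
- move=> h hr; rewrite fa// => j; exact: an_norm (phis j) hr.
Qed.

Lemma powser_at0 I (rho : I -> R) M a f : (forall i, 0 <= rho i) -> powser rho M a f ->
  f (fun=> 0) = a [ffun=> 0%N].
Proof.
move=> r0 fa; rewrite fa.2 => [|i]; last by rewrite normr0.
rewrite (@l1sum_single _ _ _ [ffun=> 0%N]).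
  by rewrite /monom big1 ?mulr1// => i _; rewrite ffunE expr0.
move=> al aln0; have [i i0] : exists i, al i != 0%N.
  apply/existsP; apply: contraNT aln0; rewrite negb_exists => /forallP h.
  by apply/eqP/ffunP => i; rewrite ffunE; move: (h i); rewrite negbK => /eqP.
by rewrite /monom (bigD1 i)//= expr0n (negbTE i0) mul0r mulr0.
Qed.

(** Without a constant term every monomial has positive degree, so shrinking
    the box by the factor [d] gains [d] in the norm. *)
Lemma an_small I (rho : I -> R) M f d : (forall i, 0 <= rho i) -> 0 <= d <= 1 ->
  analytic_le rho M f -> f (fun=> 0) = 0 -> analytic_le (fun i => d * rho i) (d * M) f.
Proof.
move=> r0 /andP[d0 d1] [a fa] f0.
have dr : inbox rho (fun i => d * rho i).
  by move=> i; rewrite ger0_norm ?mulr_ge0// ler_piMl.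
have a0 : a [ffun=> 0%N] = 0 by rewrite -(powser_at0 _ fa).
exists a; split; last by have [] := powser_box dr fa.
apply: le_trans (_ : (l1norm (fun al => d * (a al * monom rho al)))%R <= _)%E; last first.
  by rewrite -{2}(ger0_norm d0); apply: l1normZ_le; case: fa.
apply: le_l1norm => al.
have [->|aln0] := eqVneq al [ffun=> 0%N]; first by rewrite a0 !mul0r mulr0.
rewrite mulrCA !normrM ler_wpM2l//.
have -> : monom (fun i => d * rho i) al = d ^+ (\sum_i al i) * monom rho al.
  by rewrite /monom expr_sum -big_split/=; apply: eq_bigr => i _; rewrite exprMn.
rewrite normrM ler_wpM2r// normrX !ger0_norm// -[leRHS]expr1.
apply: ler_wiXn2l => //; rewrite lt0n; apply: contra aln0.
rewrite sum_nat_eq0 => /forallP h; apply/eqP/ffunP => i; rewrite ffunE.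
by apply/eqP; have := h i.
Qed.

End PowerSeries.

(** * Hadamard's quotient and partial derivatives *)

Section Derivatives.
Context {R : realType}.
Implicit Types (I J : finType).

(** Together with [adjoin] below this lets a coordinate vary while the others
    are kept; the index [None] of [adjoin] is the extra variable. *)
Definition set_coord I (h : I -> R) i t : I -> R := fun j => if j == i then t else h j.
Definition adjoin I (h : I -> R) (t : R) : option I -> R :=
  fun o => if o is Some j then h j else t.
Definition partial I (i : I) (f : (I -> R) -> R) (h : I -> R) : R :=
  derive1 (fun t => f (set_coord h i t)) (h i).
Definition incr_exp I (i : I) (be : {ffun I -> nat}) : {ffun I -> nat} :=
  [ffun l => (be l + (l == i))%N].

Lemma set_coordE I (h : I -> R) i : set_coord h i (h i) = h.
Proof. by apply/funext => j; rewrite /set_coord; case: eqP => [->|]. Qed.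

Lemma incr_exp_inj I (i : I) : injective (incr_exp i).
Proof.
move=> a b /ffunP h; apply/ffunP => l; have := h l; rewrite !ffunE => /eqP.
by rewrite eqn_add2r => /eqP.
Qed.

Definition mask I (i : I) (al : {ffun I -> nat}) : {ffun I -> nat} :=
  [ffun l => if l == i then 0%N else al l].

Lemma monom_mask I (h : I -> R) i al : monom h al = h i ^+ al i * monom h (mask i al).
Proof.
rewrite /monom (bigD1 i)//= [in RHS](bigD1 i)//= ffunE eqxx expr0 mul1r; congr (_ * _).
by apply: eq_bigr => j /negbTE ji; rewrite ffunE ji.
Qed.

Lemma monom_mask_upd I (h : I -> R) i t al : monom (set_coord h i t) (mask i al) = monom h (mask i al).
Proof.
apply: eq_bigr => j _; rewrite ffunE /set_coord; case: eqP => // _; by rewrite !expr0.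
Qed.

Lemma monom_incr I (h : I -> R) i al : monom h (incr_exp i al) = h i * monom h al.
Proof.
rewrite /monom (bigD1 i)//= [in RHS](bigD1 i)//= ffunE eqxx addn1 exprS -mulrA.
by congr (_ * (_ * _)); apply: eq_bigr => j /negbTE ji; rewrite ffunE ji addn0.
Qed.

(** Halving the radius pays for the factor [n] that the derivative of [x ^ n]
    brings. *)
Lemma half_power_le (n : nat) (r : R) : 0 < r -> n%:R * (r / 2) ^+ n.-1 <= (2 / r) * r ^+ n.
Proof.
move=> r0; case: n => [|n]; first by rewrite mul0r expr0 mulr1 divr_ge0// ltW.
have -> : 2 / r * r ^+ n.+1 = r ^+ n * 2 by rewrite exprS mulrA divfK ?gt_eqF// mulrC.
rewrite exprMn /= mulrCA ler_wpM2l ?exprn_ge0 ?(ltW r0)//.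
rewrite exprVn ler_pdivrMr ?exprn_gt0// -exprS -natrX ler_nat.
by rewrite ltnW// ltn_expl.
Qed.

(** Divide each monomial by [t - h i]: the quotient [(t^n - u^n) / (t - u)] is
    a sum of [n] products, and the factor [n] is absorbed by halving the
    radii. The quotient depends on both values of the coordinate [i], hence
    has the extra variable [None]. *)
Lemma hadamard_series I (rho : I -> R) M a f i : (forall i, 0 < rho i) -> powser rho M a f ->
  exists2 Q, analytic_le (fun o : option I => (if o is Some l then rho l else rho i) / 2)
                (2 / rho i * M) Q &
    (forall h t, inbox (fun l => rho l / 2) h -> `|t| <= rho i / 2 ->
       f (set_coord h i t) - f h = (t - h i) * Q (adjoin h t)) /\
    (forall h, inbox (fun l => rho l / 2) h ->
       Q (adjoin h (h i)) = l1sum (fun al : {ffun I ->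
         nat} => (al i)%:R * a al * (h i ^+ (al i).-1 * monom h (mask i al)))).
Proof.
move=> r0 fa.
pose geo (t u : R) n : R := \sum_(j < n) t ^+ (n.-1 - j) * u ^+ j.
have geoE t n : geo t t n = n%:R * t ^+ n.-1.
  rewrite /geo (eq_bigr (fun=> t ^+ n.-1)).
    by rewrite sumr_const card_ord mulr_natl.
  move=> j _; rewrite -exprD subnK//.
  by rewrite -ltnS prednK ?ltn_ord// (leq_ltn_trans _ (ltn_ord j)).
pose term (al : {ffun I -> nat}) (g : option I -> R) := a al * geo (g None) (g (Some i)) (al i) *
   \prod_l g (Some l) ^+ mask i al l.
have r20 (o : option I) : 0 < (if o is Some l then rho l else rho i) / 2.
  by case: o => [l|]; rewrite divr_gt0.
pose bd (al : {ffun I -> nat}) := `|a al| * geo (rho i / 2) (rho i / 2) (al i) *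
   \prod_l (rho l / 2) ^+ mask i al l.
have bdM : (l1norm bd <= (2 / rho i * M)%:E)%E.
  apply: le_trans (_ : l1norm (fun al => 2 / rho i * (a al * monom rho al))%R <= _)%E.
    apply: le_l1norm => al; rewrite /bd geoE (monom_mask rho i) -/(monom (fun l => rho l / 2) _).
    have h1 := half_power_le (al i) (r0 i).
    have h2 : 0 <= (al i)%:R * (rho i / 2) ^+ (al i).-1.
      by rewrite mulr_ge0// exprn_ge0// divr_ge0// ltW.
    have h3 : `|monom (fun l => rho l / 2) (mask i al)| <= monom rho (mask i al).
      apply: monom_le => l; rewrite ger0_norm ?divr_ge0 ?(ltW (r0 _))//.
      by have := r0 l; lra.
    rewrite (_ : 2 / rho i * _ = a al * (2 / rho i * rho i ^+ al i * monom rho (mask i al)));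
      last by ring.
    rewrite -mulrA !normrM normr_id ler_wpM2l// -!normrM [leLHS]normrM (le_trans _ (ler_norm _))//.
    by apply: ler_pM => //; rewrite ger0_norm.
  have k0 : 0 <= 2 / rho i by rewrite divr_ge0// ltW.
  by rewrite -{2}(ger0_norm k0); apply: l1normZ_le; case: fa.
exists (fun g => l1sum (term^~ g)).
  apply: (@an_sum _ _ _ _ bd _ term) => //.
  move=> al; rewrite /bd /term; apply: an_mul => //.
    apply: an_scale => //; apply: an_bigsum => // j; apply: an_mul => //.
      by apply: an_exp => //; apply: (@an_coord _ _ _ None) => o; exact: ltW.
    by apply: an_exp => //; apply: (@an_coord _ _ _ (Some i)) => o; exact: ltW.
  apply: an_prod => // l; apply: an_exp => //.
  by apply: (@an_coord _ _ _ (Some l)) => o; exact: ltW.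
have inb h : inbox (fun l => rho l / 2) h -> inbox rho h.
  by move=> hr l; rewrite (le_trans (hr l))//; have := r0 l; lra.
split=> [h t hr tr|h hr]; last first.
  by apply: eq_l1sum => al; rewrite /term /= geoE -!mulrA mulrCA -/(monom _ _).
have ur : inbox (fun l => rho l / 2) (set_coord h i t).
  by move=> l; rewrite /set_coord; case: eqP => [->|].
have fin h' : inbox rho h' -> (l1norm (fun al => a al * monom h' al)%R < +oo)%E.
  by move=> h'r; apply: le_lt_trans (powser_l1norm fa h'r) _; rewrite ltry.
have [_ fE] := fa.
rewrite !fE; [|exact: inb|exact: inb].
have tfin : (l1norm (term^~ (adjoin h t)) < +oo)%E.
  apply: (@le_lt_trans _ _ (l1norm bd)); last by apply: le_lt_trans bdM _; rewrite ltry.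
  apply: le_l1norm => al; rewrite /term /bd !normrM normr_id.
  have half0 : 0 <= rho i / 2 by rewrite divr_ge0// ltW.
  apply: ler_pM => //.
    rewrite ler_wpM2l//= (le_trans (ler_norm_sum _ _ _))// ger0_norm; last first.
      by apply: sumr_ge0 => j _; rewrite mulr_ge0// exprn_ge0.
    apply: ler_sum => j _; rewrite normrM !normrX; apply: ler_pM => //.
      by rewrite lerXn2r ?nnegrE.
    by rewrite lerXn2r ?nnegrE// hr.
  rewrite [leRHS]ger0_norm; last by apply: prodr_ge0 => l _; rewrite exprn_ge0// divr_ge0// ltW.
  rewrite normr_prod; apply: ler_prod => l _; rewrite normr_ge0 normrX/=.
  by rewrite lerXn2r ?nnegrE// ?hr// divr_ge0// ltW.
rewrite -l1sumZ// l1sumB; [|by apply: fin; exact: inb|by apply: fin; exact: inb].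
apply: eq_l1sum => al; rewrite (monom_mask h i) (monom_mask (set_coord h i t) i) monom_mask_upd.
rewrite /set_coord eqxx /term /=.
have := subrXX t (h i) (al i); rewrite -/(geo _ _ _) -/(monom h (mask i al)) => e.
transitivity (a al * (t ^+ al i - h i ^+ al i) * monom h (mask i al)); first by ring.
by rewrite e; ring.
Qed.

Lemma an_lip I (rho : I -> R) M f i : (forall i, 0 < rho i) -> analytic_le rho M f ->
  exists2 C, 0 <= C & forall h t, inbox (fun l => rho l / 2) h -> `|t| <= rho i / 2 ->
    `|f (set_coord h i t) - f h| <= C * `|t - h i|.
Proof.
move=> r0 [a fa]; have [Q QN [Qf _]] := hadamard_series i r0 fa.
exists (2 / rho i * M); first exact: an_ge0 QN.
move=> h t hr tr; rewrite Qf// normrM mulrC ler_wpM2r//.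
by apply: an_norm QN _ => -[l|] /=.
Qed.

(** Differentiability in the form that Hadamard's quotient supplies: a
    continuous factor [q], here even Lipschitz. *)
Lemma deriv_quot (F q : R -> R) (t0 d C : R) : 0 < d ->
  (forall t, `|t - t0| < d -> F t - F t0 = (t - t0) * q t) ->
  (forall t, `|t - t0| < d -> `|q t - q t0| <= C * `|t - t0|) ->
  is_derive t0 1 F (q t0).
Proof.
move=> d0 Fq qC.
have C0 : 0 <= C.
  have := qC (t0 + d / 2); rewrite addrAC subrr add0r ger0_norm; last by lra.
  have h : d / 2 < d by lra.
  move=> /(_ h) h2; have := le_trans (normr_ge0 _) h2.
  by rewrite pmulr_lge0//; lra.
have cv : (fun h => h^-1 *: ((F \o shift t0) (h *: (1 : R)) - F t0)) @ 0^' --> q t0.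
  apply/cvgrPdist_lt => e e0; near=> h.
  have hn0 : h != 0 by near: h; exact: nbhs_dnbhs_neq.
  have hd : `|h| < d by near: h; apply: dnbhs0_lt.
  have he : `|h| < e / (C + 1) by near: h; apply: dnbhs0_lt; rewrite divr_gt0//; lra.
  have hE : h + t0 - t0 = h by rewrite addrK.
  rewrite /= scaler1 Fq ?hE// /GRing.scale/= mulKf// distrC (le_lt_trans (qC _ _)) ?hE//.
  rewrite (@le_lt_trans _ _ ((C + 1) * `|h|))//; first by rewrite ler_wpM2r//; lra.
  by rewrite mulrC -ltr_pdivlMr//; lra.
have dF : derivable F t0 1 by apply/cvg_ex; exists (q t0).
apply: DeriveDef => //; exact/cvg_lim.
Unshelve. all: by end_near.
Qed.

(** The derivative is the value of the quotient at [t = h i]. Radii are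
    divided by 8 so that the coordinate can move by as much again inside the
    box on which [Q] is Lipschitz. *)
Lemma hadamard I (rho : I -> R) M a f i : (forall i, 0 < rho i) -> powser rho M a f ->
  exists2 Q, analytic_le (fun o : option I => (if o is Some l then rho l else rho i) / 2)
                (2 / rho i * M) Q &
    [/\ forall h t, inbox (fun l => rho l / 2) h -> `|t| <= rho i / 2 ->
          f (set_coord h i t) - f h = (t - h i) * Q (adjoin h t),
        forall h, inbox (fun l => rho l / 8) h ->
          is_derive (h i) 1 (fun t => f (set_coord h i t)) (Q (adjoin h (h i))),
        forall h, inbox (fun l => rho l / 8) h -> partial i f h = Q (adjoin h (h i)) &
        forall h, inbox (fun l => rho l / 2) h -> Q (adjoin h (h i)) =
          l1sum (fun al : {ffun I -> nat} =>
                  (al i)%:R * a al * (h i ^+ (al i).-1 * monom h (mask i al)))].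
Proof.
move=> r0 fa; have [Q QN [Qf QE]] := hadamard_series i r0 fa.
have r20 (o : option I) : 0 < (if o is Some l then rho l else rho i) / 2.
  by case: o => [l|]; rewrite divr_gt0.
have [C C0 QC] := an_lip None r20 QN.
have key h : inbox (fun l => rho l / 8) h ->
    is_derive (h i) 1 (fun t => f (set_coord h i t)) (Q (adjoin h (h i))).
  move=> hr; apply: (@deriv_quot _ (fun t => Q (adjoin h t)) _ (rho i / 8) C).
  - by rewrite divr_gt0.
  - move=> t tr; rewrite set_coordE; apply: Qf.
      by move=> l; rewrite (le_trans (hr l))//; have := r0 l; lra.
    rewrite -(subrK (h i) t) (le_trans (ler_normD _ _))//.
    by have := hr i; have := r0 i; lra.
  - move=> t tr; have -> : adjoin h t = set_coord (adjoin h (h i)) None t.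
      by apply/funext => -[l|].
    apply: QC => [[l|]|] /=.
    + by rewrite (le_trans (hr l))//; have := r0 l; lra.
    + by rewrite (le_trans (hr i))//; have := r0 i; lra.
    rewrite -(subrK (h i) t) (le_trans (ler_normD _ _))//.
    by have := hr i; have := r0 i; lra.
exists Q => //; split=> // h hr.
by have := key _ hr => -[d e]; rewrite /partial derive1E; exact: e.
Qed.

(** The diagonal values of Hadamard's quotient form a power series once more,
    with the coefficients of termwise differentiation. *)
Lemma an_deriv I (rho : I -> R) M a f i : (forall i, 0 < rho i) -> powser rho M a f ->
  (forall h, inbox (fun l => rho l / 8) h ->
    is_derive (h i) 1 (fun t => f (set_coord h i t)) (partial i f h)) /\
  exists M', powser (fun l => rho l / 8) M' (fun be => (be i).+1%:R * a (incr_exp i be)) (partial i f).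
Proof.
move=> r0 fa; have [Q QN [Qf key pdE QE]] := hadamard i r0 fa.
split; first by move=> h hr; rewrite pdE//; exact: key.
(* Exponents outside the image of the increment have no [i]-th power; their
   terms vanish after derivation. *)
have z al : (forall k, al != incr_exp i k) -> al i = 0%N.
  move=> h; apply/eqP; rewrite -leqn0 leqNgt; apply/negP => ai.
  have := h [ffun l => (al l - (l == i))%N]; rewrite (_ : incr_exp i _ = al) ?eqxx//.
  apply/ffunP => l; rewrite !ffunE; case: eqP => [->|_]; first by rewrite subnK.
  by rewrite subn0 addn0.
have m0 (h : I -> R) (be : {ffun I ->
  nat}) : (h i) ^+ be i * monom h (mask i (incr_exp i be)) = monom h be.
  rewrite (monom_mask h i be); congr (_ * monom h _).
  by apply/ffunP => l; rewrite !ffunE; case: eqP => // _; rewrite addn0.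
exists (2 / rho i * M); split; last first.
  move=> h hr; rewrite pdE// QE; last first.
    by move=> l; rewrite (le_trans (hr l))//; have := r0 l; lra.
  rewrite -(@l1sum_inj _ _ _ (incr_exp i)); last 2 first.
  - exact: incr_exp_inj.
  - by move=> al /z ->; rewrite !mul0r.
  by apply: eq_l1sum => be; rewrite [incr_exp i be i]ffunE eqxx addn1/= m0.
apply: le_trans (_ : l1norm (fun al => 2 / rho i * (a al * monom rho al))%R <= _)%E; last first.
  have k0 : 0 <= 2 / rho i by rewrite divr_ge0// ltW.
  by rewrite -{2}(ger0_norm k0); apply: l1normZ_le; case: fa.
apply: le_trans (l1norm_inj_le _ (@incr_exp_inj _ i)).
apply: le_l1norm => be.
have d0 l : 0 <= rho l / 8 by rewrite divr_ge0// ltW.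
rewrite (_ : (be i).+1%:R * _ * _ =
  a (incr_exp i be) * ((be i).+1%:R * monom (fun l => rho l / 8) be)); last by ring.
rewrite [X in _ <= `|X|](_ : _ = a (incr_exp i be) * (2 * monom rho be)); last first.
  by rewrite monom_incr; field; rewrite gt_eqF.
rewrite !(normrM (a _)) ler_wpM2l// ger0_norm; last by rewrite mulr_ge0// monom_ge0.
rewrite ger0_norm; last by rewrite mulr_ge0// monom_ge0// => l; rewrite ltW.
rewrite (monom_mask rho i) (monom_mask (fun l => rho l / 8) i) mulrA [leRHS]mulrA.
apply: ler_pM.
- by rewrite mulr_ge0// exprn_ge0.
- by apply: monom_ge0 => l; rewrite divr_ge0// ltW.
- have := half_power_le (be i).+1 (r0 i); rewrite /= exprS mulrA divfK ?gt_eqF//.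
  apply: le_trans; rewrite ler_wpM2l// lerXn2r ?nnegrE//; last by have := r0 i; lra.
  by rewrite divr_ge0// ltW.
- rewrite -[leLHS]ger0_norm; last by apply: monom_ge0 => l; rewrite divr_ge0// ltW.
  by apply: monom_le => l; rewrite ger0_norm ?divr_ge0 ?(ltW (r0 _))//; have := r0 l; lra.
Qed.

End Derivatives.

(** * Germs of analytic functions at the origin *)

Section Germs.
Context {R : realType}.
Implicit Types (I J : finType).

Definition germ_series I (a : {ffun I -> nat} -> R) (f : (I -> R) -> R) :=
  exists r M, 0 < r /\ powser (fun=> r) M a f.

Definition analytic_germ I (f : (I -> R) -> R) := exists a, germ_series a f.

Lemma analytic_germP I (f : (I -> R) -> R) :
  analytic_germ f <-> exists r M, 0 < r /\ analytic_le (fun=> r) M f.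
Proof.
by split=> [[a [r [M [r0 fa]]]]|[r [M [r0 [a fa]]]]]; [exists r, M; split=> //;
  exists a|exists a, r, M].
Qed.

Lemma an_germ I r M (f : (I -> R) -> R) : 0 < r -> analytic_le (fun=> r) M f -> analytic_germ f.
Proof. by move=> r0 fM; apply/analytic_germP; exists r, M. Qed.

Lemma germ_series_ext I a (f g : (I -> R) -> R) r : 0 < r ->
  (forall h, inbox (fun=> r) h -> f h = g h) -> germ_series a f -> germ_series a g.
Proof.
move=> r0 fg [r' [M [r'0 fa]]]; exists (Num.min r r'), M; split.
  by rewrite lt_min r0.
have m0 : 0 <= Num.min r r' by rewrite le_min !ltW.
have [aM fE] : powser (fun=> Num.min r r') M a f.
  by apply: powser_box fa => i; rewrite ger0_norm// ge_min lexx orbT.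
split=> // h hr; rewrite -fg ?fE// => i; rewrite (le_trans (hr i))//.
by rewrite ge_min lexx.
Qed.

Lemma germ_ext I (f g : (I -> R) -> R) r : 0 < r ->
  (forall h, inbox (fun=> r) h -> f h = g h) -> analytic_germ f -> analytic_germ g.
Proof. by move=> r0 fg [a fa]; exists a; exact: germ_series_ext fg fa. Qed.

Lemma germ_series_partial I a (f : (I -> R) -> R) i : germ_series a f ->
  germ_series (fun be => (be i).+1%:R * a (incr_exp i be)) (partial i f).
Proof.
move=> [r [M [r0 fa]]]; have [_ [M' fM']] := an_deriv i (fun=> r0) fa.
by exists (r / 8), M'; rewrite divr_gt0.
Qed.

Lemma germ_partial I (f : (I -> R) -> R) i : analytic_germ f -> analytic_germ (partial i f).
Proof. by move=> [a fa]; eexists; exact: germ_series_partial fa. Qed.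

Lemma germ_derivable I (f : (I -> R) -> R) i : analytic_germ f -> exists2 r, 0 < r &
  forall h, inbox (fun=> r) h -> is_derive (h i) 1 (fun t => f (set_coord h i t)) (partial i f h).
Proof.
move=> [a [r [M [r0 fa]]]]; have [d _] := an_deriv i (fun=> r0) fa.
by exists (r / 8); rewrite ?divr_gt0.
Qed.

Lemma germ_series_at0 I a (f : (I -> R) -> R) : germ_series a f -> f (fun=> 0) = a [ffun=> 0%N].
Proof. by move=> [r [M [r0 fa]]]; apply: powser_at0 fa => _; exact: ltW. Qed.

Lemma iter_partial0 I a (f : (I -> R) -> R) i m : germ_series a f ->
  iter m (partial i) f (fun=> 0) = m`!%:R * a [ffun l => if l == i then m else 0%N].
Proof.
elim: m a f => [|m ih] a f fa /=.
  rewrite fact0 mul1r (germ_series_at0 fa); congr a; apply/ffunP => l.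
  by rewrite !ffunE; case: eqP.
rewrite -[partial i _]/(iter m.+1 (partial i) f) iterSr (ih _ _ (germ_series_partial i fa)) ffunE eqxx.
rewrite mulrA -natrM mulnC -factS; congr (_ * a _); apply/ffunP => l.
by rewrite !ffunE; case: eqP => // _; rewrite addn1.
Qed.

Lemma germ_iter_partial I (f : (I -> R) -> R) i m : analytic_germ f ->
  analytic_germ (iter m (partial i) f).
Proof. by move=> fA; elim: m => //= m ih; exact: germ_partial. Qed.

Lemma germ_series_eq0 I a (f : (I -> R) -> R) : germ_series a f -> (forall al, a al = 0) ->
  exists2 r, 0 < r & forall h, inbox (fun=> r) h -> f h = 0.
Proof.
move=> [r [M [r0 [_ fE]]]] a0; exists r => // h hr; rewrite fE//.
rewrite (@l1sum_single _ _ _ [ffun=> 0%N]) ?a0 ?mul0r// => al _; by rewrite a0 mul0r.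
Qed.

(** The restriction to an axis is the sum of its Taylor series, whose
    coefficients are the iterated derivatives. *)
Lemma germ_flat I (f : (I -> R) -> R) i : analytic_germ f ->
  (forall m, iter m (partial i) f (fun=> 0) = 0) ->
  exists2 r, 0 < r & forall t, `|t| <= r -> f (set_coord (fun=> 0) i t) = 0.
Proof.
move=> [a fa] h; have [r [M [r0 [aM fE]]]] := fa.
have a0 m : a [ffun l => if l == i then m else 0%N] = 0.
  have := h m; rewrite (iter_partial0 _ _ fa) => /eqP; rewrite mulf_eq0 pnatr_eq0.
  by rewrite gtn_eqF ?fact_gt0 /= => [/eqP|].
exists r => // t tr; rewrite fE; last first.
  by move=> l; rewrite /set_coord; case: eqP => // _; rewrite normr0 ltW.
rewrite (@l1sum_single _ _ _ [ffun=> 0%N]).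
  rewrite (_ : [ffun=> 0%N] = [ffun l => if l == i then 0%N else 0%N]) ?a0 ?mul0r//.
  by apply/ffunP => l; rewrite !ffunE; case: eqP.
move=> al _; have [->|] := eqVneq al [ffun l => if l == i then al i else 0%N].
  by rewrite a0 mul0r.
move=> aln; have [l /andP[li l0]] : exists l, (l != i) && (al l != 0%N).
  apply/existsP; apply: contraNT aln; rewrite negb_exists => /forallP h'.
  apply/eqP/ffunP => l; rewrite ffunE; case: eqP => [->//|/eqP li].
  by have := h' l; rewrite li/= negbK => /eqP.
by rewrite /monom (bigD1 l)//= /set_coord (negbTE li) expr0n (negbTE l0) mul0r mulr0.
Qed.

Lemma germ_cst I (c : R) : analytic_germ (fun _ : I -> R => c).
Proof. by apply: (@an_germ _ 1 `|c|) => //; exact: an_cst. Qed.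

Lemma germ_coord I (i : I) : analytic_germ (fun h : I -> R => h i).
Proof. by apply: (@an_germ _ 1 1) => //; apply: an_coord => _. Qed.

Lemma germ_common I (f g : (I -> R) -> R) : analytic_germ f -> analytic_germ g ->
  exists r M, [/\ 0 < r, analytic_le (fun=> r) M f & analytic_le (fun=> r) M g].
Proof.
move=> /analytic_germP[r [M [r0 fM]]] /analytic_germP[s [N [s0 gN]]].
have m0 : 0 <= Num.min r s by rewrite le_min !ltW.
exists (Num.min r s), (Num.max M N); split; first by rewrite lt_min r0.
  apply: (an_weaken (M := M)); first by rewrite le_max lexx.
  by apply: an_box fM => i; rewrite ger0_norm// ge_min lexx.
apply: (an_weaken (M := N)); first by rewrite le_max lexx orbT.
by apply: an_box gN => i; rewrite ger0_norm// ge_min lexx orbT.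
Qed.

Lemma germ_add I (f g : (I -> R) -> R) : analytic_germ f -> analytic_germ g ->
  analytic_germ (fun h => f h + g h).
Proof.
move=> fA gA; have [r [M [r0 fM gM]]] := germ_common fA gA.
by apply: (an_germ r0); apply: an_add fM gM => _; exact: ltW.
Qed.

Lemma germ_mul I (f g : (I -> R) -> R) : analytic_germ f -> analytic_germ g ->
  analytic_germ (fun h => f h * g h).
Proof.
move=> fA gA; have [r [M [r0 fM gM]]] := germ_common fA gA.
by apply: (an_germ r0); apply: an_mul fM gM => _.
Qed.

(** Makes the norm, not just the values, as small as desired; compositions and
    contractions require bounds on the norm. *)
Lemma germ_shrink I (f : (I -> R) -> R) e : analytic_germ f -> f (fun=> 0) = 0 -> 0 < e ->
  exists2 r, 0 < r & analytic_le (fun=> r) e f.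
Proof.
move=> /analytic_germP[r [M [r0 fM]]] f0 e0; have M0 := an_ge0 fM.
pose d := Num.min 1 (e / (M + 1)).
have M1 : 0 < M + 1 by lra.
have d0 : 0 < d by rewrite lt_min ltr01 divr_gt0.
have d1 : d <= 1 by rewrite ge_min lexx.
exists (d * r); first by rewrite mulr_gt0.
apply: (an_weaken (M := d * M)); last first.
  by apply: (an_small (rho := fun=> r)) => // [_|]; rewrite ltW// d0.
apply: (@le_trans _ _ (d * (M + 1))); first by rewrite ler_wpM2l ?(ltW d0)//; lra.
by rewrite -ler_pdivlMr// ge_min lexx orbT.
Qed.

Lemma germ_cont0 I (f : (I -> R) -> R) e : analytic_germ f -> 0 < e ->
  exists2 r, 0 < r & forall h, inbox (fun=> r) h -> `|f h - f (fun=> 0)| <= e.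
Proof.
move=> fA e0; have gA := germ_add fA (germ_cst _ (- f (fun=> 0))).
have [|r r0 gr] := germ_shrink gA _ e0; first by rewrite subrr.
by exists r => // h hr; have := an_norm gr hr.
Qed.

(** As the inner functions vanish at the origin, on a small box their norms
    lie below the radius of the outer function. *)
Lemma germ_comp I J (f : (J -> R) -> R) (phi : J -> (I -> R) -> R) :
  analytic_germ f -> (forall j, analytic_germ (phi j)) -> (forall j, phi j (fun=> 0) = 0) ->
  analytic_germ (fun h => f (fun j => phi j h)).
Proof.
move=> /analytic_germP[s [M [s0 fM]]] phiA phi0.
have /choice[r rP] : forall j, exists r, 0 < r /\ analytic_le (fun=> r) s (phi j).
  by move=> j; have [r r0 h] := germ_shrink (phiA j) (phi0 j) s0; exists r.
pose m := \big[Num.min/1]_j r j.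
have m0 : 0 < m by apply: lt_bigmin => // j _; have [] := rP j.
apply: (an_germ m0); apply: (an_comp _ _ fM) => // j; first exact: ltW.
have [_ h] := rP j; apply: an_box h => i; rewrite ger0_norm ?(ltW m0)//.
exact: bigmin_le_cond.
Qed.

End Germs.

(** * Implicit functions and square roots *)

Section ImplicitFunction.
Context {R : realType}.
Implicit Types (I J : finType).

Lemma sum_geom_half (s : R) n : \sum_(0 <= i < n) (s / 2 ^+ i.+1) = s - s / 2 ^+ n.
Proof.
elim: n => [|n ih]; first by rewrite big_geq// expr0 divr1 subrr.
by rewrite big_nat_recr//= ih exprS; field; rewrite expf_neq0.
Qed.

Lemma l1norm_geom (s : R) : 0 < s -> (l1norm (fun n : nat => s / 2 ^+ n.+1)%R <= s%:E)%E.
Proof.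
move=> s0; have t0 n : 0 <= s / 2 ^+ n.+1 by rewrite divr_ge0 ?exprn_ge0// ltW.
rewrite /l1norm -nneseries_esumT; last by move=> n; rewrite lee_fin.
apply: lime_le; first by apply: is_cvg_nneseries => n _ _; rewrite lee_fin.
near=> n; rewrite sumEFin lee_fin.
rewrite (eq_bigr (fun i => s / 2 ^+ i.+1)); last by move=> i _; rewrite ger0_norm.
by rewrite sum_geom_half lerBlDr lerDl divr_ge0 ?exprn_ge0// ltW.
Unshelve. all: by end_near.
Qed.

Lemma iota_exhaust (t : nat) : \forall n \near \oo, t \in iota 0 n.
Proof. by exists t.+1 => // n /= tn; rewrite mem_iota. Qed.

(** [T] is a self-map of the interval of radius [s] with parameters [h], and
    [P] is its Hadamard quotient in the last variable, of norm at most one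
    half. The differences of consecutive iterates are analytic with
    geometrically decreasing norms, so their sum, the fixed point, is analytic
    in the parameters. *)
Section Contraction.
Variables (I : finType) (T : (option I -> R) -> R) (P : (option (option I) -> R) -> R).
Variables (r s : R).
Hypothesis r0 : 0 < r.
Hypothesis rs : r <= s.
Hypothesis T0 : analytic_le (fun=> r) (s / 2) (fun h => T (adjoin h 0)).
Hypothesis PA : analytic_le (fun=> s) (1 / 2) P.
Hypothesis TP : forall h t t', inbox (fun=> r) h -> `|t| <= s -> `|t'| <= s ->
  T (adjoin h t) - T (adjoin h t') = (t - t') * P (adjoin (adjoin h t') t).

Let s0 : 0 < s := lt_le_trans r0 rs.

Let phi n (h : I -> R) : R := iter n (fun t => T (adjoin h t)) 0.
Let d n h := phi n.+1 h - phi n h.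

Let phiS n h : phi n.+1 h = phi n h + d n h.
Proof. by rewrite /d addrC subrK. Qed.

Let pow_bd n : s * (1 - (2 ^+ n)^-1) <= s.
Proof. by rewrite ler_piMr ?(ltW s0)// lerBlDr lerDl invr_ge0 exprn_ge0. Qed.

Let steps n : analytic_le (fun=> r) (s / 2 ^+ n.+1) (d n) /\
  analytic_le (fun=> r) (s * (1 - (2 ^+ n)^-1)) (phi n).
Proof.
elim: n => [|n [dn phin]].
  split.
    by rewrite expr1; apply: an_ext T0 => h _; rewrite /d /phi/= subr0.
  by rewrite expr0 invr1 subrr mulr0 -(@normr0 R R); exact: an_cst.
have phiSn : analytic_le (fun=> r) (s * (1 - (2 ^+ n.+1)^-1)) (phi n.+1).
  rewrite (_ : s * _ = s * (1 - (2 ^+ n)^-1) + s / 2 ^+ n.+1); last first.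
    by rewrite exprS; field; rewrite expf_neq0.
  apply: an_ext (an_add (fun=> ltW r0) phin dn) => h _; by rewrite phiS.
split=> //.
(* The quotient [P] is evaluated at the parameters and at two consecutive
   iterates. *)
pose psi (o : option (option I)) (h : I -> R) : R :=
  match o with Some (Some l) => h l | Some None => phi n h | None => phi n.+1 h end.
have psiA o : analytic_le (fun=> r) s (psi o).
  case: o => [[l|]|] /=.
  - by apply: an_weaken rs _; apply: an_coord => _; exact: ltW.
  - by apply: an_weaken (pow_bd _) phin.
  - by apply: an_weaken (pow_bd _) phiSn.
have PP := an_comp (fun=> r0) (fun=> ltW s0) PA psiA.
rewrite (_ : s / _ = s / 2 ^+ n.+1 * (1 / 2)); last first.
  by rewrite [in LHS]exprS; field; rewrite expf_neq0.
apply: an_ext (an_mul (fun=> r0) dn PP) => h hr.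
have b1 : `|phi n h| <= s by apply: le_trans (an_norm phin hr) (pow_bd _).
have b2 : `|phi n.+1 h| <= s by apply: le_trans (an_norm phiSn hr) (pow_bd _).
rewrite [RHS]/d {1}/phi [X in _ = X - _]iterS -/(phi n.+1 h).
rewrite [X in _ = _ - X]/phi iterS -/(phi n h) TP//.
Qed.

Lemma contraction_fixpoint : exists2 f : (I -> R) -> R, analytic_le (fun=> r) s f &
  forall h t, inbox (fun=> r) h -> `|t| <= s -> (T (adjoin h t) = t <-> t = f h).
Proof.
pose f h := l1sum (fun n => d n h).
have fA : analytic_le (fun=> r) s f.
  apply: (@an_sum _ _ _ _ (fun n => s / 2 ^+ n.+1) _ d) => //.
    by move=> n; have [] := steps n.
  exact: l1norm_geom.
exists f => //.
have phib n h : inbox (fun=> r) h -> `|phi n h| <= s.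
  by move=> hr; have [_ ph] := steps n; apply: le_trans (an_norm ph hr) (pow_bd _).
have cvf h : inbox (fun=> r) h -> phi n h @[n --> \oo] --> f h.
  move=> hr.
  have dfin : (l1norm (d^~ h) < +oo)%E.
    apply: le_lt_trans (_ : (s%:E < +oo)%E); last by rewrite ltry.
    apply: le_trans (l1norm_geom s0); apply: le_l1norm => n.
    rewrite [leRHS]ger0_norm; last by rewrite divr_ge0 ?exprn_ge0// ltW.
    by have [h1 _] := steps n; exact: an_norm h1 hr.
  have := l1sum_exhaust dfin (fun n => iota_uniq 0 n) iota_exhaust.
  rewrite (_ : (fun n => _) = (fun n => phi n h))//; apply/funext => n.
  rewrite -[in iota 0 n](subn0 n) -/(index_iota 0 n).
  elim: n => [|n ih]; first by rewrite big_geq.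
  by rewrite phiS big_nat_recr//= ih.
have contr h t t' : inbox (fun=> r) h -> `|t| <= s -> `|t'| <= s ->
    `|T (adjoin h t) - T (adjoin h t')| <= 1 / 2 * `|t - t'|.
  move=> hr ts t's; rewrite TP// normrM mulrC ler_wpM2r//.
  apply: an_norm PA _ => -[[l|]|] //=; exact: le_trans (hr l) rs.
have ffix h : inbox (fun=> r) h -> T (adjoin h (f h)) = f h.
  move=> hr; apply/eqP; rewrite -subr_eq0 -normr_le0; apply/ler_addgt0Pl => e e0.
  rewrite addr0.
  have e4 : 0 < e / 4 by rewrite divr_gt0.
  have [n [h1 h2]] : exists n, `|f h - phi n h| < e / 4 /\ `|f h - phi n.+1 h| < e / 4.
    have /cvgrPdist_lt/(_ _ e4)[N _ hN] := cvf h hr.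
    by exists N; split; apply: hN => //=.
  have := contr h (f h) (phi n h) hr (an_norm fA hr) (phib n h hr).
  rewrite -[T (adjoin h (phi n h))]/(phi n.+1 h) => h3.
  have := ler_distD (phi n.+1 h) (T (adjoin h (f h))) (f h).
  rewrite (distrC (phi n.+1 h) (f h)); lra.
move=> h t hr ts; split=> [tT|->]; last exact: ffix.
have := contr h t (f h) hr ts (an_norm fA hr); rewrite tT ffix// => h1.
have : `|t - f h| <= 0 by have := normr_ge0 (t - f h); lra.
by rewrite normr_le0 subr_eq0 => /eqP.
Qed.

End Contraction.

(** The map [t - G / c], with [c] the derivative of [G] at the origin, is a
    contraction near the origin because its Hadamard quotient is analytic and
    vanishes there. Its fixed points are the zeros of [G]. *)
Lemma implicit_function I (G : (option I -> R) -> R) :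
  analytic_germ G -> G (fun=> 0) = 0 -> partial None G (fun=> 0) != 0 ->
  exists r s f, [/\ 0 < r, 0 < s, analytic_le (fun=> r) s f &
   forall h t, inbox (fun=> r) h -> `|t| <= s -> (G (adjoin h t) = 0 <-> t = f h)].
Proof.
move=> [a [r1 [M [r10 Ga]]]] G0 dG.
set c := partial None G (fun=> 0) in dG.
have [Q QN [GQ _ QE _]] := hadamard None (fun=> r10) Ga.
have QA : analytic_germ Q.
  apply: (@an_germ _ _ (r1 / 2) (2 / r1 * M)); first by rewrite divr_gt0.
  by apply: an_box QN; case=> [u|]; rewrite ger0_norm// divr_ge0// ltW.
pose T (g : option I -> R) := g None - c^-1 * G g.
pose P (u : option (option I) -> R) := 1 + - c^-1 * Q u.
have PA : analytic_germ P by apply: germ_add; [exact: germ_cst|apply: germ_mul; [exact: germ_cst|]].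
have ext0 J : adjoin (fun _ : J => 0 : R) 0 = (fun=> 0) by apply/funext => -[].
have P0 : P (fun=> 0) = 0.
  have := QE (fun=> 0); rewrite ext0 -/c => h; rewrite /P -h ?mulNr ?mulVf ?subrr// => o.
  by rewrite normr0 divr_ge0// ltW.
have [s1 s10 Ps1] : exists2 s1, 0 < s1 & analytic_le (fun=> s1) (1 / 2) P.
  by apply: germ_shrink => //; rewrite divr_gt0.
pose s := Num.min s1 (r1 / 2).
have s0 : 0 < s by rewrite lt_min s10 divr_gt0.
have Ps : analytic_le (fun=> s) (1 / 2) P.
  by apply: an_box Ps1 => o; rewrite ger0_norm ?(ltW s0)// ge_min lexx.
have sr1 : s <= r1 / 2 by rewrite ge_min lexx orbT.
have TA : analytic_germ (fun h : I -> R => T (adjoin h 0)).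
  apply: (@germ_ext _ _ (fun h => - c^-1 * G (adjoin h 0)) _ 1) => //.
    by move=> h _; rewrite /T /= add0r mulNr.
  apply: germ_mul; first exact: germ_cst.
  apply: (@germ_ext _ _ (fun h => G (fun o => (if o is Some l then h l else 0))) _ 1) => //.
  apply: (@germ_comp _ I (option I) G (fun o h => if o is Some l then h l else 0)).
  - by exists a, r1, M.
  - by case=> [l|]; [exact: germ_coord|exact: germ_cst].
  - by case.
have T00 : T (adjoin (fun=> 0) 0) = 0 by rewrite ext0 /T G0 mulr0 subr0.
have [r2 r20 Tr2] := germ_shrink TA T00 (divr_gt0 s0 (ltr0n R 2)).
pose r := Num.min r2 s.
have r0 : 0 < r by rewrite lt_min r20.
have rs : r <= s by rewrite ge_min lexx orbT.
have Tr : analytic_le (fun=> r) (s / 2) (fun h => T (adjoin h 0)).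
  by apply: an_box Tr2 => o; rewrite ger0_norm ?(ltW r0)// ge_min lexx.
have TP h t t' : inbox (fun=> r) h -> `|t| <= s -> `|t'| <= s ->
    T (adjoin h t) - T (adjoin h t') = (t - t') * P (adjoin (adjoin h t') t).
  move=> hr ts t's; have := GQ (adjoin h t') t.
  have -> : set_coord (adjoin h t') None t = adjoin h t by apply/funext => -[].
  move=> GE; rewrite /T /P /= mulrDr mulr1 mulrCA -GE; first by ring.
    by case=> [l|] /=; [rewrite (le_trans (hr l))// (le_trans rs)|rewrite (le_trans t's)].
  exact: le_trans ts sr1.
have [f fA ff] := contraction_fixpoint r0 rs Tr Ps TP.
exists r, s, f; split=> // h t hr ts; rewrite -ff// /T /=.
split=> [->|]; first by rewrite mulr0 subr0.
move=> /eqP; rewrite -subr_eq0 addrAC subrr add0r oppr_eq0 mulf_eq0 invr_eq0 (negbTE dG).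
by move=> /eqP.
Qed.

(** Solve [(w + t)^2 = f h] near [t = 0], where [w] is the root at the origin. *)
Lemma germ_sqrt I (f : (I -> R) -> R) : analytic_germ f -> 0 < f (fun=> 0) ->
  analytic_germ (fun h => Num.sqrt (f h)).
Proof.
move=> fA f0; set w := Num.sqrt (f (fun=> 0)).
have w0 : 0 < w by rewrite sqrtr_gt0.
have w2 : w ^+ 2 = f (fun=> 0) by rewrite sqr_sqrtr// ltW.
(* [None] carries the correction [t] to the root [w]. *)
pose G (g : option I -> R) := (w + g None) * (w + g None) - f (fun l => g (Some l)).
have wA : analytic_germ (fun g : option I -> R => w + g None).
  by apply: germ_add; [exact: germ_cst|exact: germ_coord].
have GA : analytic_germ G.
  apply: (@germ_ext _ _ (fun g => (w + g None) * (w + g None) + -1 * f (fun l => g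
    (Some l))) _ 1) => //.
    by move=> g _; rewrite mulN1r.
  apply: germ_add; first exact: germ_mul.
  apply: germ_mul; first exact: germ_cst.
  apply: (@germ_comp _ (option I) I f (fun l g => g (Some l))) => //.
  by move=> l; exact: germ_coord.
have G0 : G (fun=> 0) = 0 by rewrite /G addr0 -expr2 w2 subrr.
have dG : partial None G (fun=> 0) = 2 * w.
  rewrite /partial derive1E (_ : (fun t => _) = (fun t => (w + t) * (w + t) - f (fun=> 0))); last first.
    by apply/funext => t.
  have h : is_derive (0 : R) (1 : R) (fun t : R => (w + t) * (w + t) - f (fun=> 0)) (2 * w).
    apply: is_derive_eq; rewrite /GRing.scale/=; ring.
  by have [_ ->] := h.
have [|r [s [phi [r0 s0 phiA H]]]] := implicit_function GA G0.
  by rewrite dG mulf_neq0// gt_eqF.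
have [d d0 hd] := germ_cont0 fA (mulr_gt0 w0 s0).
pose r' := Num.min r d.
have r'0 : 0 < r' by rewrite lt_min r0.
apply: (@germ_ext _ _ (fun h => w + phi h) _ r') => //; last first.
  by apply: germ_add; [exact: germ_cst|exact: an_germ r0 phiA].
move=> h hr.
have hr1 : inbox (fun=> r) h by move=> i; rewrite (le_trans (hr i))// ge_min lexx.
have hr2 : inbox (fun=> d) h by move=> i; rewrite (le_trans (hr i))// ge_min lexx orbT.
have fh := hd _ hr2.
have [h0|h0] := leP 0 (f h); last first.
  have ws : phi h ^+ 2 >= 0 by exact: sqr_ge0.
  (* A negative value is excluded, since [f h] is a square by the implicit
     equation. *)
  exfalso.
  have := an_norm phiA hr1 => ps.
  have := (H h (phi h) hr1 ps).2 erefl; rewrite /G /= => e.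
  have : 0 <= f h.
    have -> : f h = (w + phi h) ^+ 2 by rewrite expr2; move/subr0_eq: e.
    exact: sqr_ge0.
  by rewrite leNgt h0.
have q0 := sqrtr_ge0 (f h); have q2 : Num.sqrt (f h) ^+ 2 = f h by rewrite sqr_sqrtr.
set q := Num.sqrt (f h) in q0 q2 *.
(* From [|q^2 - w^2| <= w s] and [q + w >= w]. *)
have qs : `|q - w| <= s.
  rewrite -(ler_pM2l w0); apply: le_trans fh.
  rewrite -w2 -q2 subr_sqr normrM mulrC ler_wpM2l// ger0_norm; first by rewrite lerDr.
  by rewrite addr_ge0// ltW.
have <- : q - w = phi h.
  by apply: (H h (q - w) hr1 qs).1; rewrite /G /= (addrC w) subrK -expr2 q2 subrr.
by rewrite addrC subrK.
Qed.

End ImplicitFunction.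

(** * Analytic functions of two and of three variables *)

Section Coordinates.
Context {R : realType}.

Definition vec2 (h1 h2 : R) : bool -> R := fun b => if b then h2 else h1.

Lemma monom_bool (h : bool -> R) (al : {ffun bool -> nat}) :
  monom h al = h false ^+ al false * h true ^+ al true.
Proof.
rewrite /monom (bigD1 false)//= (bigD1 true)//= big1 ?mulr1//.
by case.
Qed.

Lemma monom_option_bool (h : option bool -> R) (al : {ffun option bool -> nat}) :
  monom h al = h (Some false) ^+ al (Some false) * h (Some true) ^+ al (Some true)
             * h None ^+ al None.
Proof.
rewrite /monom (bigD1 (Some false))//= (bigD1 (Some true))//= (bigD1 None)//= big1 ?mulr1 ?mulrA//.
by case=> [[]|].
Qed.

Lemma ffun_bool_bij : bijective (fun al : {ffun bool -> nat} => (al false, al true)).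
Proof.
exists (fun p : nat * nat => [ffun b : bool => if b then p.2 else p.1] : {ffun bool -> nat}).
  by move=> al; apply/ffunP => -[]; rewrite ffunE.
by move=> [i j]; rewrite /= !ffunE.
Qed.

Lemma ffun_option_bool_bij : bijective (fun al : {ffun option bool -> nat} =>
  (al (Some false), al (Some true), al None)).
Proof.
exists (fun p : nat * nat * nat => [ffun u : option bool =>
  if u is Some b then (if b then p.1.2 else p.1.1) else p.2] : {ffun option bool -> nat}).
  by move=> al; apply/ffunP => -[[]|]; rewrite ffunE.
by move=> [[i j] l]; rewrite /= !ffunE.
Qed.

Let index_square N : seq (nat * nat) := [seq (val p.1, val p.2) | p <- enum {: 'I_N * 'I_N}].
Let index_cube N : seq (nat * nat * nat) :=
  [seq (val p.1.1, val p.1.2, val p.2) | p <- enum {: 'I_N * 'I_N * 'I_N}].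

(** The partial sums over squares in [analytic2_at] are one exhaustion of the
    index set. *)
Lemma l1sum_square (x : nat * nat -> R) : (l1norm x < +oo)%E ->
  \sum_(i < N) \sum_(j < N) x (val i, val j) @[N --> \oo] --> l1sum x.
Proof.
move=> xf.
rewrite (_ : (fun N : nat => _) = (fun N => \sum_(p <- index_square N) x p)); last first.
  apply/funext => N; rewrite pair_bigA/= /index_square big_map big_enum/=.
  by apply: eq_bigl.
apply: l1sum_exhaust => // [N|[i j]].
  rewrite map_inj_uniq ?enum_uniq// => -[a b] [c d] [ac bd].
  by congr (_, _); apply: val_inj.
exists (maxn i j).+1 => // N /= ijN.
have iN : (i < N)%N by rewrite (leq_ltn_trans (leq_maxl i j)).
have jN : (j < N)%N by rewrite (leq_ltn_trans (leq_maxr i j)).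
by apply/mapP; exists (Ordinal iN, Ordinal jN) => //; rewrite mem_enum.
Qed.

Lemma l1sum_cube (x : nat * nat * nat -> R) : (l1norm x < +oo)%E ->
  \sum_(i < N) \sum_(j < N) \sum_(l < N) x (val i, val j, val l) @[N --> \oo] --> l1sum x.
Proof.
move=> xf.
rewrite (_ : (fun N : nat => _) = (fun N => \sum_(p <- index_cube N) x p)); last first.
  apply/funext => N; rewrite pair_bigA/= pair_bigA/= /index_cube big_map big_enum/=.
  by apply: eq_bigl.
apply: l1sum_exhaust => // [N|[[i j] l]].
  rewrite map_inj_uniq ?enum_uniq// => -[[a b] e] [[c d] f] [ac bd ef].
  by congr (_, _, _); apply: val_inj.
exists (maxn (maxn i j) l).+1 => // N /= ijN.
have iN : (i < N)%N by rewrite (leq_ltn_trans _ ijN)// !leq_max leqnn.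
have jN : (j < N)%N by rewrite (leq_ltn_trans _ ijN)// !leq_max leqnn orbT.
have lN : (l < N)%N by rewrite (leq_ltn_trans _ ijN)// !leq_max leqnn orbT.
by apply/mapP; exists (Ordinal iN, Ordinal jN, Ordinal lN) => //; rewrite mem_enum.
Qed.

(** [Some false] and [Some true] index the two components of the wave vector
    and [None] the spectral variable, the one to be solved for. *)
Definition recenter3 (D : (R * R) * R -> R) (p : (R * R) * R) (g : option bool -> R) : R :=
  D ((p.1.1 + g (Some false), p.1.2 + g (Some true)), p.2 + g None).

(** Absolute convergence at the corner [(r/2, r/2, r/2)] is a bound on the
    norm with these weights. *)
Lemma analytic3_germ D p : analytic3_at D p -> analytic_germ (recenter3 D p).
Proof.
move=> [a [r [r0 ha]]].
pose x (g : option bool -> R) (q : nat * nat * nat) :=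
  a q.1.1 q.1.2 q.2 * g (Some false) ^+ q.1.1 * g (Some true) ^+ q.1.2 * g None ^+ q.2.
pose e (al : {ffun option bool -> nat}) := (al (Some false), al (Some true), al None).
have xe g al : x g (e al) = a (e al).1.1 (e al).1.2 (e al).2 * monom g al.
  by rewrite monom_option_bool /x /= !mulrA.
have r20 : 0 < r / 2 by rewrite divr_gt0.
have xfin g : (forall i, `|g i| < r) -> (l1norm (x g) < +oo)%E.
  by move=> gr; have [] := ha _ _ _ (gr (Some false)) (gr (Some true)) (gr None).
(* Half the radius, because the hypothesis concerns strict inequalities only. *)
have fin2 : (l1norm (x (fun=> (r / 2)%R)) < +oo)%E.
  by apply: xfin => _; rewrite ger0_norm ?(ltW r20)//; lra.
exists (fun al => a (e al).1.1 (e al).1.2 (e al).2), (r / 2), (fine (l1norm (x (fun=> r / 2)))).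
split=> //; split.
  rewrite fineK; last by rewrite ge0_fin_numE ?l1norm_ge0.
  by rewrite -(l1norm_reindex _ ffun_option_bool_bij); apply: le_l1norm => al; rewrite -xe.
move=> g gr; have gr' i : `|g i| < r by apply: le_lt_trans (gr i) _; lra.
have [_ lim1] := ha _ _ _ (gr' (Some false)) (gr' (Some true)) (gr' None).
have lim2 := l1sum_cube (xfin _ gr').
rewrite /recenter3 -(cvg_unique _ lim2 lim1)// -(l1sum_reindex _ ffun_option_bool_bij).
by apply: eq_l1sum => al; rewrite -xe.
Qed.

Lemma powser_square (rho : bool -> R) M (a : {ffun bool -> nat} -> R) f h1 h2 :
  powser rho M a f -> inbox rho (vec2 h1 h2) ->
  let y (q : nat * nat) :=
    a [ffun c : bool => if c then q.2 else q.1] * h1 ^+ q.1 * h2 ^+ q.2 in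
  (l1norm y < +oo)%E /\
  \sum_(i < N) \sum_(j < N) y (val i, val j) @[N --> \oo] --> f (vec2 h1 h2).
Proof.
move=> fa hb y.
have yE (al : {ffun bool -> nat}) : y (al false, al true) = a al * monom (vec2 h1 h2) al.
  rewrite /y monom_bool /= mulrA; congr (a _ * _ * _).
  by apply/ffunP => -[]; rewrite ffunE.
have yfin : (l1norm y < +oo)%E.
  rewrite -(l1norm_reindex _ ffun_bool_bij).
  apply: le_lt_trans (ltry M); apply: le_trans (powser_l1norm fa hb).
  by apply: le_l1norm => al; rewrite yE.
split=> //; have [_ ->//] := fa.
rewrite (eq_l1sum (y := fun al : {ffun bool -> nat} => y (al false, al true))); last by move=> al;
  rewrite yE.
by rewrite (l1sum_reindex _ ffun_bool_bij); exact: l1sum_square.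
Qed.

Lemma germ_analytic2 (F : R * R -> R) (x : R * R) (f : (bool -> R) -> R) r :
  0 < r -> (forall h, inbox (fun=> r) h -> F (x.1 + h false, x.2 + h true) = f h) ->
  analytic_germ f -> analytic2_at F x.
Proof.
move=> r0 Ff fA; have := germ_series_ext r0 (fun h hr => esym (Ff h hr)).
case: fA => a fa /(_ _ fa)[s [M [s0 Fa]]].
exists (fun i j => a [ffun c : bool => if c then j else i]), s; split=> // h1 h2 h1s h2s.
by apply: (powser_square Fa); case=> /=; exact: ltW.
Qed.

End Coordinates.

(** * Solving for the spectral variable *)

Section Germs3.
Context {R : realType}.

Lemma near_at2 (Q : R * R -> Prop) (k : R * R) : (\forall x \near k, Q x) ->
  exists2 r, 0 < r & forall h : bool -> R, inbox (fun=> r) h ->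
    Q (k.1 + h false, k.2 + h true).
Proof.
move=> /nbhs_ballP[e /= e0 he]; exists (e / 2); first by rewrite divr_gt0.
have key (x y : R) : `|y| <= e / 2 -> ball x e (x + y).
  by move=> ye; rewrite -ball_normE /ball_/= opprD addNKr normrN; lra.
by move=> h hr; apply: he; split; exact: key.
Qed.

Lemma near_recenter3 (Q : (R * R) * R -> Prop) (p : (R * R) * R) : (\forall x \near p, Q x) ->
  exists2 r, 0 < r & forall g : option bool -> R, inbox (fun=> r) g ->
    Q ((p.1.1 + g (Some false), p.1.2 + g (Some true)), p.2 + g None).
Proof.
move=> /nbhs_ballP[e /= e0 he]; exists (e / 2); first by rewrite divr_gt0.
have key (x y : R) : `|y| <= e / 2 -> ball x e (x + y).
  by move=> ye; rewrite -ball_normE /ball_/= opprD addNKr normrN; lra.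
by move=> h hr; apply: he; split; [split|]; exact: key.
Qed.

Lemma recenter3_near (Q : (R * R) * R -> Prop) (p : (R * R) * R) r : 0 < r ->
  (forall g : option bool -> R, inbox (fun=> r) g ->
    Q ((p.1.1 + g (Some false), p.1.2 + g (Some true)), p.2 + g None)) ->
  \forall x \near p, Q x.
Proof.
move=> r0 h; apply/nbhs_ballP; exists r => //= -[[x y] z] [[/= bx by_] bz].
have := h (fun u => if u is Some b then (if b then y - p.1.2 else x - p.1.1) else z - p.2).
rewrite /= ![_ + (_ - _)]addrC !subrK; apply=> u; move: bx by_ bz.
rewrite -!ball_normE /ball_/= => bx by_ bz.
by case: u => [[]|]; rewrite distrC ltW.
Qed.

Lemma derive1_shift (F : R -> R) (c t : R) :
  derive1 (fun s => F (c + s)) t = derive1 F (c + t).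
Proof.
by rewrite /derive1; under eq_fun do rewrite addrCA.
Qed.

(** Links the iterated derivatives in the definition of the regular part to
    partial derivatives of germs. *)
Lemma partial_recenter3_dlam m (D : (R * R) * R -> R) p :
  partial None (recenter3 (dlam m D) p) = recenter3 (dlam m.+1 D) p.
Proof.
apply/funext => g; rewrite /partial /recenter3 /dlam derive1nS /=.
by rewrite -[RHS]derive1_shift /set_coord /=.
Qed.

Lemma recenter3_dlam m (D : (R * R) * R -> R) p :
  recenter3 (dlam m D) p = iter m (partial None) (recenter3 D p).
Proof. by elim: m => // m ih; rewrite iterS -ih partial_recenter3_dlam. Qed.

Lemma germ_dlam m (D : (R * R) * R -> R) p : analytic3_at D p -> analytic_germ (recenter3 (dlam m D) p).
Proof. by move=> Dp; rewrite recenter3_dlam; apply: germ_iter_partial; exact: analytic3_germ. Qed.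

Lemma recenter3_0 (D : (R * R) * R -> R) p : recenter3 D p (fun=> 0) = D p.
Proof. by case: p => [[x y] z]; rewrite /recenter3 /= !addr0. Qed.

(** The implicit function theorem describes the zeros of the derivative of
    order [m - 1] near the point by one analytic graph. By continuity the
    branch [f] stays near the point, where it lies on the variety, hence on
    that graph. *)
Lemma regular_analytic (B : set ((R * R) * R)) (D : (R * R) * R -> R) (f : R * R -> R)
    (k : R * R) :
  analytic3_at D (k, f k) -> {for k, continuous f} -> (forall x, B (x, f x)) ->
  regular_part B D (k, f k) -> analytic_germ (fun h : bool -> R => f (k.1 + h false, k.2 + h true)).
Proof.
move=> Dan fc Bf [_ [m [m0 Bm dm]]]; set p0 := (k, f k) in Dan Bm dm.
pose G := recenter3 (dlam m.-1 D) p0.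
have GA : analytic_germ G by exact: germ_dlam.
have [r1 r10 Br1] := near_recenter3 Bm.
have G0 : G (fun=> 0) = 0.
  rewrite /G recenter3_0; have := Br1 (fun=> 0); rewrite /= !addr0 -!surjective_pairing; apply.
    by move=> i; rewrite normr0 ltW.
  exact: Bf.
have dG : partial None G (fun=> 0) != 0.
  by rewrite /G partial_recenter3_dlam prednK// recenter3_0; apply/eqP.
have [r [s [phi [r0 s0 phiA H]]]] := implicit_function GA G0 dG.
(* The branch has to stay both in the range of uniqueness and where the
   derivative vanishes on the variety. *)
pose e := Num.min s r1.
have e0 : 0 < e by rewrite lt_min s0.
have [r2 r20 fr2] : exists2 r, 0 < r & forall h : bool -> R, inbox (fun=> r) h ->
    `|f k - f (k.1 + h false, k.2 + h true)| < e.
  by apply: (@near_at2 (fun x => `|f k - f x| < e)); move/cvgrPdist_lt: fc; exact.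
pose r' := Num.min r (Num.min r1 r2).
have r'0 : 0 < r' by rewrite !lt_min r0 r10.
apply: (@germ_ext _ _ (fun h => f k + phi h) _ r') => //; last first.
  by apply: germ_add; [exact: germ_cst|exact: an_germ r0 phiA].
move=> h hr.
have hr0 : inbox (fun=> r) h by move=> i; rewrite (le_trans (hr i))// ge_min lexx.
have hr1 : inbox (fun=> r1) h.
  by move=> i; rewrite (le_trans (hr i))// !ge_min lexx orbT.
have hr2 : inbox (fun=> r2) h.
  by move=> i; rewrite (le_trans (hr i))// !ge_min lexx !orbT.
have := fr2 h hr2; rewrite distrC lt_min => /andP[fs fr1].
set k' := (_, _) in fs fr1 *.
have <- : f k' - f k = phi h; last by rewrite addrC subrK.
apply: (H h _ hr0 (ltW fs)).1.
have := Br1 (adjoin h (f k' - f k)); rewrite /G /recenter3 /adjoin /= (addrC (f k)) subrK; apply.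
  by case=> [b|]; [exact: hr1|exact: ltW].
exact: Bf.
Qed.

Lemma rolle_between (F F' : R -> R) (s a t : R) :
  (forall u, `|u| < s -> is_derive (u : R) (1 : R) F (F' u)) -> `|a| < s -> `|t| < s ->
  a != t -> F a = F t -> exists c, [/\ `|c| < s, c != a, c != t & F' c = 0].
Proof.
move=> dF; wlog at_ : a t / a < t.
  move=> h as_ ts; case: (ltgtP a t) => // [lt_at|lt_ta] _ Fat.
    by apply: h => //; rewrite lt_eqF.
  by have [|c [? ? ? ?]] := h t a lt_ta ts as_ _ (esym Fat); [rewrite lt_eqF|exists c].
move=> as_ ts _ Fat.
have inI x : a <= x <= t -> `|x| < s.
  move: as_ ts; rewrite !ltr_norml => /andP[? ?] /andP[? ?] /andP[? ?].
  by apply/andP; split; lra.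
have dI x : x \in `]a, t[ -> derivable F x 1.
  by rewrite in_itv/= => /andP[? ?]; have [] := dF x (inI x _); rewrite ?ltW.
have cI : {within `[a, t], continuous F}.
  apply: continuous_in_subspaceT => x; rewrite inE/= in_itv/= => xI.
  have [d _] := dF x (inI x xI).
  by apply: differentiable_continuous; apply/derivable1_diffP.
have [c] := Rolle at_ dI cI Fat; rewrite in_itv/= => /andP[ac ct] [_ Fc].
have cs : `|c| < s by apply: inI; rewrite !ltW.
have [_ F'c] := dF c cs.
by exists c; split; [|rewrite gt_eqF|rewrite lt_eqF|rewrite -F'c].
Qed.

(** Another zero of [F 0] would, by Rolle's theorem, produce zeros other than
    [a] of all the successive derivatives, up to the one without zeros. *)
Lemma iterated_rolle (s a : R) (M : nat) (F : nat -> R -> R) :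
  (forall j t, (j <= M)%N -> `|t| < s -> is_derive (t : R) (1 : R) (F j) (F j.+1 t)) ->
  (forall t, `|t| < s -> F M.+1 t != 0) -> `|a| < s ->
  (forall j, (j <= M)%N -> F j a = 0) ->
  forall t, `|t| < s -> F 0%N t = 0 -> t = a.
Proof.
move=> + + as_; elim: M F => [|M ih] F dF FM Fa t ts Ft;
  apply/eqP/negP => /negP ta;
  have [|c [cs _ ca Fc]] := @rolle_between _ _ s t a (fun u => dF 0%N u (leq0n _)) ts as_ ta.
- by rewrite Ft Fa.
- by have := FM c cs; rewrite Fc eqxx.
- by rewrite Ft Fa.
- have := ih (fun j => F j.+1) (fun j t jM => dF j.+1 t jM) FM (fun j jM => Fa j.+1 jM) c cs Fc.
  by move=> e; rewrite e eqxx in ca.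
Qed.

End Germs3.

(** * Zero sets of analytic functions are null *)

Section NullZeroSets.
Context {R : realType}.
Local Notation mu := (@lebesgue_measure R).

Lemma lebesgue2_xsection0 (A : set (measurableTypeR R * measurableTypeR R)) :
  (forall x, mu (xsection A x) = 0%E) -> lebesgue2 R A = 0%E.
Proof.
move=> h; rewrite /lebesgue2 /= /product_measure1.
by apply: integral0_eq => x _; rewrite /= h.
Qed.

(** The product measure is defined by integrating measures of sections in one
    order; for measurable sets the other order gives the same measure by
    uniqueness. *)
Lemma lebesgue2_ysection0 (A : set (measurableTypeR R * measurableTypeR R)) :
  measurable A -> (forall y, mu (ysection A y) = 0%E) -> lebesgue2 R A = 0%E.
Proof.
move=> mA h; rewrite /lebesgue2.
transitivity ((mu \x^ mu)%E A).
  apply: product_measure_unique => // B C mB mC.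
  exact: product_measure2E.
by rewrite /= /product_measure2; apply: integral0_eq => y _; rewrite /= h.
Qed.

(** Give each point a rational interval that isolates it. *)
Lemma isolated_countable (A : set R) :
  (forall x, A x -> exists2 e, 0 < e & forall y, A y -> `|y - x| < e -> y = x) ->
  countable A.
Proof.
move=> isoA.
(* The pair [(0, 0)] is a dummy value outside [A]. *)
have ch x : exists q : rat * rat, A x -> [/\ ratr q.1 < x, x < ratr q.2 &
    forall y, A y -> ratr q.1 < y < ratr q.2 -> y = x].
  have [Ax|nAx] := pselect (A x); last by exists (0, 0).
  have [e e0 he] := isoA x Ax.
  have /rat_in_itvoo[p] : x - e < x by rewrite ltrBlDr ltrDl.
  have /rat_in_itvoo[q] : x < x + e by rewrite ltrDl.
  rewrite !in_itv/= => /andP[q1 q2] /andP[p1 p2].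
  exists (p, q) => _; split=> // y Ay /andP[y1 y2]; apply: he => //.
  rewrite ltr_norml; apply/andP; split; move: y1 y2 => /=; lra.
have [q hq] := choice ch.
apply/countable_injP; exists (fun x => pickle (q x)) => x y.
rewrite !inE => Ax Ay /(pcan_inj pickleK) qxy.
have [x1 x2 _] := hq x Ax; have [_ _ h] := hq y Ay.
by apply: h => //; rewrite -qxy x1 x2.
Qed.

Lemma simple_zero_isolated (F : R -> R) (x d : R) : is_derive x (1 : R) F d -> F x = 0 ->
  d != 0 -> exists2 e : R, 0 < e & forall y, F y = 0 -> `|y - x| < e -> y = x.
Proof.
move=> [dF Fd] Fx d0.
have cv : (fun h => h^-1 *: ((F \o shift x) (h *: (1 : R)) - F x)) @ 0^' --> d.
  by rewrite -Fd; exact: dF.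
have dn0 : 0 < `|d| by rewrite normr_gt0.
have /cvgrPdist_lt/(_ _ dn0)[e /= e0 he] := cv.
exists e => // y Fy yx; apply/eqP/negP => /negP xy.
have := he (y - x); rewrite /= sub0r normrN subr_eq0 => /(_ yx xy).
by rewrite scaler1 subrK Fy Fx subrr scaler0 subr0 ltxx.
Qed.

Definition box2 (k0 : R * R) (r : R) : set (measurableTypeR R * measurableTypeR R) :=
  [set` `]k0.1 - r, k0.1 + r[] `*` [set` `]k0.2 - r, k0.2 + r[].

Lemma box2P k0 r k : box2 k0 r k <-> `|k.1 - k0.1| < r /\ `|k.2 - k0.2| < r.
Proof.
by rewrite /box2 /= !in_itv/= !ltr_distl; split.
Qed.

Lemma measurable_box2 k0 r : measurable (box2 k0 r).
Proof. by apply: measurableX; exact: measurable_itv. Qed.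

Definition recenter (f : (bool -> R) -> R) (k0 : R * R) (k : R * R) : R :=
  f (vec2 (k.1 - k0.1) (k.2 - k0.2)).

(** A pointwise limit of polynomials. *)
Lemma an_measurable (f : (bool -> R) -> R) k0 r M : 0 < r -> analytic_le (fun=> r) M f ->
  measurable_fun (box2 k0 r) (recenter f k0 : measurableTypeR R * measurableTypeR R -> R).
Proof.
move=> r0 [a fa].
pose y (k : R * R) (q : nat * nat) := a [ffun c : bool => if c then q.2 else q.1]
  * (k.1 - k0.1) ^+ q.1 * (k.2 - k0.2) ^+ q.2.
apply: (@measurable_fun_cvg _ _ _ _
  (fun N (k : measurableTypeR R * measurableTypeR R) => \sum_(i < N) \sum_(j < N) y k (val i, val j))).
  move=> N; apply: measurable_funTS.
  apply: measurable_sum => i; apply: measurable_sum => j.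
  apply: measurable_funM; [apply: measurable_funM => //|]; apply: measurable_funX.
    by apply: measurable_funB => //; exact: measurable_fst.
  by apply: measurable_funB => //; exact: measurable_snd.
move=> k /box2P[k1 k2].
by have [|_] := powser_square fa (h1 := k.1 - k0.1) (h2 := k.2 - k0.2); first by case=> /=; exact: ltW.
Qed.

End NullZeroSets.

(** * Projections of singular points *)

Section SingularProjection.
Context {R : realType}.
Local Notation mu := (@lebesgue_measure R).

Lemma box2_le k0 (r s : R) : r <= s -> box2 k0 r `<=` box2 k0 s.
Proof. by move=> rs k /box2P[a b]; apply/box2P; split; exact: lt_le_trans rs. Qed.

(** Where the [i]-th partial derivative does not vanish, the zeros on each
    line in the direction [i] are isolated, hence countable, and the sections
    of the set are null. *)
Lemma transversal_zeros_null (f : (bool -> R) -> R) (i : bool) (k0 : R * R) : analytic_germ f ->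
  exists2 r, 0 < r & (lebesgue2 R).-negligible
    (box2 k0 r `&` [set k | recenter f k0 k = 0 /\ recenter (partial i f) k0 k <> 0]).
Proof.
move=> fA; have [r1 [M [r10 fM gM]]] := germ_common fA (germ_partial i fA).
have [r2 r20 df] := germ_derivable i fA.
pose r := Num.min r1 r2; have r0 : 0 < r by rewrite lt_min r10.
have rr1 : r <= r1 by rewrite ge_min lexx.
have rr2 : r <= r2 by rewrite ge_min lexx orbT.
exists r => //; set A := _ `&` _.
have mf : measurable_fun (box2 k0 r) (recenter f k0 : measurableTypeR R * measurableTypeR R -> R).
  by apply: (@an_measurable _ _ _ _ M) => //; apply: an_box fM => j; rewrite ger0_norm// ltW.
have mg : measurable_fun (box2 k0 r) (recenter
  (partial i f) k0 : measurableTypeR R * measurableTypeR R -> R).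
  by apply: (@an_measurable _ _ _ _ M) => //; apply: an_box gM => j; rewrite ger0_norm// ltW.
have mA : measurable A.
  rewrite (_ : A = (box2 k0 r `&` recenter f k0 @^-1` [set 0]) `&`
                   (box2 k0 r `&` recenter (partial i f) k0 @^-1` (~` [set 0]))).
    apply: measurableI; [apply: mf => //|apply: mg].
    - exact: measurable_box2.
    - exact: measurable_box2.
    - by apply: measurableC; exact: measurable_set1.
  by apply/seteqP; split => [k [? [? ?]]|k [[? ?] [? ?]]].
apply/negligibleP => //.
have key k : A k -> is_derive (vec2 (k.1 - k0.1) (k.2 - k0.2) i) (1 : R)
    (fun t => f (set_coord (vec2 (k.1 - k0.1) (k.2 - k0.2)) i t)) (recenter (partial i f) k0 k).
  move=> [/box2P[k1 k2] _]; apply: df => -[] /=.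
    exact: le_trans (ltW k2) rr2.
  exact: le_trans (ltW k1) rr2.
have countable_line (E : set R) (v : R -> R * R) (e : R) :
    (forall t, vec2 ((v t).1 - k0.1) ((v t).2 - k0.2) i = t - e) ->
    (forall s t, set_coord (vec2 ((v s).1 - k0.1) ((v s).2 - k0.2)) i (t - e) =
       vec2 ((v t).1 - k0.1) ((v t).2 - k0.2)) ->
    (forall t, E t -> A (v t)) -> mu E = 0%E.
  move=> vi vu EA; apply: countable_lebesgue_measure0; apply: isolated_countable => s /EA As.
  have [_ [f0 /eqP d0]] := As; have := key _ As; rewrite vi => dk.
  have [|d d_gt0 hd] := simple_zero_isolated dk _ d0; first by rewrite vu.
  exists d => // t /EA[_ [ft _]] ts; apply: (@addIr _ (- e)); apply: hd; first by rewrite vu.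
  by rewrite opprB addrA subrK.
case: i {mg fA gM df} @A mA key countable_line => A mA key line.
- apply: lebesgue2_xsection0 => x; apply: (line _ (pair x) k0.2) => [//|s t|t].
    by apply/funext => -[].
  by rewrite /xsection /= inE.
apply: lebesgue2_ysection0 => // y; apply: (line _ (pair^~ y) k0.1) => [//|s t|t].
  by apply/funext => -[].
by rewrite /ysection /= inE.
Qed.

(** Induction on the order of the nonzero coefficient. At a zero of [f],
    either some partial derivative chosen to have a nonzero coefficient of
    lower order vanishes too, or the zero is transversal in that direction. *)
Lemma zeros_null (f : (bool -> R) -> R) a (al : {ffun bool -> nat}) (k0 : R * R) :
  germ_series a f -> a al != 0 ->
  exists2 r, 0 < r & (lebesgue2 R).-negligible (box2 k0 r `&` [set k | recenter f k0 k = 0]).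
Proof.
have [n] := ubnP (\sum_i al i)%N.
elim: n f a al => // n ih f a al /ltnSE-aln fa a0.
have fA : analytic_germ f by exists a.
have [alz|[i ai]] : al = [ffun=> 0%N] \/ exists i, (0 < al i)%N.
  have [/eqP|] := eqVneq (\sum_i al i)%N 0%N.
    rewrite sum_nat_eq0 => /forallP h; left; apply/ffunP => i; rewrite ffunE.
    by apply/eqP; have := h i.
  rewrite sum_nat_eq0 => /forallPn[i hi]; right; exists i; by rewrite lt0n.
- have f0 : f (fun=> 0) != 0 by rewrite (germ_series_at0 fa) -alz.
  have fp : 0 < `|f (fun=> 0)| / 2 by rewrite divr_gt0// normr_gt0.
  have [r r0 hr] := germ_cont0 fA fp.
  exists r => //; rewrite (_ : _ `&` _ = set0); first exact: negligible_set0.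
  apply/seteqP; split=> // k [/box2P[k1 k2]] /= fk.
  have := hr (vec2 (k.1 - k0.1) (k.2 - k0.2)); rewrite -/(recenter f k0 k) fk sub0r normrN.
  have h : inbox (fun=> r) (vec2 (k.1 - k0.1) (k.2 - k0.2)) by case=> /=; exact: ltW.
  by move=> /(_ h); move: f0; rewrite -normr_gt0; lra.
- pose be : {ffun bool -> nat} := [ffun l => (al l - (l == i))%N].
  have beE : incr_exp i be = al.
    apply/ffunP => l; rewrite !ffunE; case: eqP => [->|_]; first by rewrite subnK.
    by rewrite subn0 addn0.
  have [||r1 r10 n1] := ih _ _ be _ (germ_series_partial i fa).
  + apply: leq_trans aln; rewrite -beE (bigD1 i)//= [X in (_ < X)%N](bigD1 i)//=.
    rewrite [incr_exp i be i]ffunE eqxx addn1 addSn ltnS leq_add2l; apply: leq_sum => l _.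
    by rewrite [X in (_ <= X)%N]ffunE leq_addr.
  + by rewrite beE mulf_neq0// pnatr_eq0.
  have [r2 r20 n2] := transversal_zeros_null i k0 fA.
  exists (Num.min r1 r2); first by rewrite lt_min r10.
  apply: negligibleS (negligibleU n1 n2) => k [kb fk] /=.
  have b1 : box2 k0 r1 k by apply: box2_le kb; rewrite ge_min lexx.
  have b2 : box2 k0 r2 k by apply: box2_le kb; rewrite ge_min lexx orbT.
  by have [pk|pk] := pselect (recenter (partial i f) k0 k = 0); [left|right].
Qed.

Lemma bigmin_ord_le n (r : nat -> R) j : (j < n)%N -> \big[Num.min/1]_(i < n) r i <= r j.
Proof. by move=> jn; apply: (@bigmin_le_cond _ _ _ 1 (Ordinal jn) xpredT (fun i : 'I_n => r i)). Qed.

(** [M] is the order of the zero [p0] in the spectral variable. The equation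
    [dlam M.-1 D = 0] defines an analytic graph near [p0] that contains all
    nearby points of order at least [M]. If some [dlam j D] with [j < M] does
    not vanish identically along the graph, the projection lies in the null
    set of its zeros. Otherwise, by [iterated_rolle], on each vertical line
    the graph is the only zero of [D], so [p0] is a regular point with
    exponent [M]. *)
Lemma singular_projection_null (D : (R * R) * R -> R) (p0 : (R * R) * R) M :
  let B := [set p | D p = 0] in
  analytic3_at D p0 -> B p0 -> ~ regular_part B D p0 ->
  (forall j, (j < M)%N -> dlam j D p0 = 0) -> dlam M D p0 <> 0 ->
  exists2 r, 0 < r & (lebesgue2 R).-negligible
    [set k | exists l, [/\ box2 p0.1 r k, `|l - p0.2| < r &
                          forall j, (j < M)%N -> dlam j D (k, l) = 0]].
Proof.
move=> B Dan Bp0 nreg dj dM.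
have E j : analytic_germ (recenter3 (dlam j D) p0) by exact: germ_dlam.
have [M' MM'] : exists M', M = M'.+1.
  case: M dj dM => [|M' _ _]; last by exists M'.
  by rewrite /dlam derive1n0 -surjective_pairing => _; rewrite Bp0.
subst M.
have G0 : recenter3 (dlam M' D) p0 (fun=> 0) = 0 by rewrite recenter3_0 dj.
have dG : partial None (recenter3 (dlam M' D) p0) (fun=> 0) != 0.
  by rewrite partial_recenter3_dlam recenter3_0; apply/eqP.
have [r [s [phi [r0 s0 phiA H]]]] := implicit_function (E M') G0 dG.
have ext0 : adjoin (fun _ : bool => 0 : R) 0 = (fun=> 0) by apply/funext => -[].
have phi0 : phi (fun=> 0) = 0.
  apply/esym/(H (fun=> 0) 0) => [i||]; rewrite ?normr0 ?ltW//.
have phiG : analytic_germ phi by exact: an_germ phiA.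
pose Hj j (h : bool -> R) := recenter3 (dlam j D) p0 (adjoin h (phi h)).
have HA j : analytic_germ (Hj j).
  apply: (@germ_ext _ _ (fun h => recenter3 (dlam j D) p0
    (fun u : option bool => if u is Some b then h b else phi h)) _ 1) => //.
  apply: (@germ_comp _ bool (option bool) (recenter3 (dlam j D) p0)
    (fun u h => if u is Some b then h b else phi h)) => //.
    by case=> [b|]; [exact: germ_coord|].
  by case.
(* Either the projection lies in the zeros of a nonzero power series, or all
   these series vanish and the point turns out to be regular. *)
have [[j [a [al [jM fa aal]]]]|allz] := pselect (exists j a al,
    [/\ (j <= M')%N, germ_series a (Hj j) & a al != 0]).
  have [r1 r10 n1] := zeros_null p0.1 fa aal.
  pose r' := Num.min (Num.min r s) r1.
  have r'r : r' <= r by rewrite !ge_min lexx.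
  have r's : r' <= s by rewrite !ge_min lexx !orbT.
  exists r'; first by rewrite !lt_min r0 s0.
  apply: negligibleS n1 => k [l [kb lb dk]]; split.
    by apply: box2_le kb; rewrite ge_min lexx orbT.
  have [k1 k2] := (box2P _ _ _).1 kb.
  have hb : inbox (fun=> r) (vec2 (k.1 - p0.1.1) (k.2 - p0.1.2)).
    by case=> /=; [exact: le_trans (ltW k2) r'r|exact: le_trans (ltW k1) r'r].
  have e j' : recenter3 (dlam j' D) p0 (adjoin (vec2 (k.1 - p0.1.1) (k.2 - p0.1.2)) (l - p0.2))
      = dlam j' D (k, l).
    by rewrite /recenter3 /= ![_ + (_ - _)]addrC !subrK -surjective_pairing.
  have lphi : l - p0.2 = phi (vec2 (k.1 - p0.1.1) (k.2 - p0.1.2)).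
    by apply: (H _ _ hb (le_trans (ltW lb) r's)).1; rewrite e dk.
  by rewrite /= /recenter /Hj -lphi e dk.
exfalso; apply: nreg; split=> //; exists M'.+1; split=> //.
have Hz j : (j <= M')%N -> exists2 r, 0 < r & forall h, inbox (fun=> r) h -> Hj j h = 0.
  move=> jM; have [a fa] := HA j; apply: (germ_series_eq0 fa) => al.
  by apply/eqP/negP => /negP aal; apply: allz; exists j, a, al.
have [r1 r10 Hz1] : exists2 r, 0 < r & forall j h, (j <= M')%N -> inbox (fun=> r) h -> Hj j h = 0.
  have {}Hz j : exists r, 0 < r /\ ((j <= M')%N -> forall h, inbox (fun=> r) h -> Hj j h = 0).
    have [jM|] := leqP j M'; last by exists 1.
    by have [r' r'0 h] := Hz j jM; exists r'.
  have [rj rjP] := choice Hz.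
  exists (\big[Num.min/1]_(j < M'.+1) rj j).
    by apply: lt_bigmin => // j _; have [] := rjP j.
  move=> j h jM hr; have [_ h'] := rjP j; apply: h' => // i.
  apply: le_trans (hr i) _; exact: bigmin_ord_le.
have [r2 r20 dF] : exists2 r, 0 < r & forall j g, (j <= M')%N -> inbox (fun=> r) g ->
    is_derive (g None) (1 : R) (fun t => recenter3 (dlam j D) p0 (set_coord g None t)) (recenter3
      (dlam j.+1 D) p0 g).
  have Hd j : exists r, 0 < r /\ forall g, inbox (fun=> r) g ->
    is_derive (g None) (1 : R) (fun t => recenter3 (dlam j D) p0 (set_coord g None t)) (recenter3
      (dlam j.+1 D) p0 g).
    have [r' r'0 h] := germ_derivable None (E j); exists r'; split; first exact: r'0.
    by move=> g gr; rewrite -partial_recenter3_dlam; exact: h.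
  have [rj rjP] := choice Hd.
  exists (\big[Num.min/1]_(j < M'.+1) rj j).
    by apply: lt_bigmin => // j _; have [] := rjP j.
  move=> j g jM hr; have [_ h'] := rjP j; apply: h' => // i.
  apply: le_trans (hr i) _; exact: bigmin_ord_le.
have [r3 r30 EM] : exists2 r, 0 < r & forall g, inbox (fun=> r) g ->
    recenter3 (dlam M'.+1 D) p0 g != 0.
  have ep : 0 < `|dlam M'.+1 D p0| / 2 by rewrite divr_gt0// normr_gt0; exact/eqP.
  have [r3 r30 h] := germ_cont0 (E M'.+1) ep; exists r3 => // g gr.
  have := h g gr; rewrite recenter3_0; apply: contraTneq => ->.
  by rewrite sub0r normrN -ltNge; lra.
pose s' := Num.min s (Num.min r2 r3).
have s'0 : 0 < s' by rewrite !lt_min s0 r20.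
have [r4 r40 phib] := germ_cont0 phiG (divr_gt0 s'0 (ltr0n R 2)).
pose q := Num.min (Num.min r (s' / 2)) (Num.min r1 r4).
have q0 : 0 < q by rewrite !lt_min r0 r10 r40 divr_gt0.
apply: (recenter3_near q0) => g gq Bg.
have gh : adjoin (fun b => g (Some b)) (g None) = g by apply/funext => -[].
set h := (fun b => g (Some b)) in gh.
have hq (x : R) : q <= x -> inbox (fun=> x) h.
  by move=> qx b; exact: le_trans (gq (Some b)) qx.
have hr : inbox (fun=> r) h by apply: hq; rewrite !ge_min lexx.
have hr1 : inbox (fun=> r1) h by apply: hq; rewrite !ge_min lexx !orbT.
have hr4 : inbox (fun=> r4) h by apply: hq; rewrite !ge_min lexx !orbT.
have qs' : q <= s' / 2 by rewrite !ge_min lexx !orbT.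
have gs' : `|g None| < s' by have := gq None; lra.
have phs' : `|phi h| < s' by have := phib h hr4; rewrite phi0 subr0; lra.
have inb t u : `|t| < s' -> s' <= u -> inbox (fun=> u) (adjoin h t).
  move=> ts s'u [b|] /=; last by rewrite (le_trans (ltW ts)).
  by rewrite (le_trans (hq q (lexx q) b))//; lra.
have s'r2 : s' <= r2 by rewrite !ge_min lexx !orbT.
have s'r3 : s' <= r3 by rewrite !ge_min lexx !orbT.
have gphi : g None = phi h.
  apply: (@iterated_rolle _ s' (phi h) M' (fun j t => recenter3 (dlam j D) p0 (adjoin h t))).
  - move=> j t jM ts; have := dF j (adjoin h t) jM (inb _ _ ts s'r2).
    by rewrite (_ : (fun t0 => _) = (fun t0 => recenter3 (dlam j D) p0 (adjoin h t0)))//;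
      apply/funext => u; congr recenter3; apply/funext => -[].
  - by move=> t ts; apply: EM; exact: inb s'r3.
  - exact: phs'.
  - by move=> j jM; exact: Hz1 hr1.
  - exact: gs'.
  - by rewrite gh; exact: Bg.
by rewrite -[LHS]/(recenter3 (dlam M' D) p0 g) -gh gphi; exact: Hz1 hr1.
Qed.

End SingularProjection.

(** * The set of branch points *)

Section BranchPoints.
Context {R : realType}.

Lemma ae_imp (P Q : R * R -> Prop) : (forall x, P x -> Q x) ->
  {ae lebesgue2 R, forall x, P x} -> {ae lebesgue2 R, forall x, Q x}.
Proof. by move=> PQ; apply: negligibleS => x /= nQ Px; apply: nQ; exact: PQ. Qed.

Section Enumeration.
Variables (a1 a2 : R * R) (md : mode) (eps : R * R -> R) (lam : nat -> R * R -> R).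
Hypothesis lam_enum : eigenvalue_enumeration a1 a2 md eps lam.

Lemma eigenvalue_in_bloch n k : (0 < n)%N -> bloch_variety a1 a2 md eps (k, lam n k).
Proof.
move=> n0; have [_ _ _ /(_ (lam n k) 1%N)[_ h]] := lam_enum k.
have [|u us uf] := h.
  by exists (fun=> n) => // i j _; rewrite !ord1.
exists (u ord0) => [|u0]; first exact: us.
have : (1 : R[i]) = 0.
  apply: (uf (fun=> 1) _ ord0); apply: ae_imp u0 => x ux.
  by rewrite big_ord1 mul1r.
by move/eqP; rewrite oner_eq0.
Qed.

Lemma bloch_eigenvalue p : bloch_variety a1 a2 md eps p -> exists2 n, (0 < n)%N & lam n p.1 = p.2.
Proof.
move=> [u us un0]; have [_ _ _ /(_ p.2 1%N)[h _]] := lam_enum p.1.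
have [|f _ fP] := h; last by have [? ?] := fP ord0; exists (f ord0).
exists (fun=> u) => // c c0 i; rewrite ord1; apply/eqP/negP => /negP cn0; apply: un0.
apply: ae_imp c0 => x; rewrite big_ord1 => /eqP; rewrite mulf_eq0 (negbTE cn0)/=.
by move/eqP.
Qed.

(** Otherwise [D] would vanish on an interval in the spectral direction, all
    of whose points would be eigenvalues for one wave vector; but these are
    countably many. *)
Lemma dispersion_finite_order (D : (R * R) * R -> R) p : dispersion_function a1 a2 md eps D ->
  exists m, dlam m D p != 0.
Proof.
move=> [Dan _ DB]; apply: contrapT => nex.
have flat m : iter m (partial None) (recenter3 D p) (fun=> 0) = 0.
  rewrite -recenter3_dlam recenter3_0; apply/eqP/negP => /negP h; by apply: nex; exists m.
have [r r0 hr] := germ_flat (analytic3_germ (Dan p)) flat.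
have sub : [set` `]p.2, p.2 + r[] `<=` range (fun n => lam n p.1).
  move=> x /=; rewrite in_itv/= => /andP[x1 x2].
  have : [set q | D q = 0] (p.1, x).
    have := hr (x - p.2); rewrite /recenter3 /set_coord /= !addr0 (addrC p.2) subrK -surjective_pairing.
    by apply; rewrite ger0_norm; lra.
  by rewrite DB => /bloch_eigenvalue[n _ /= <-]; exists n.
have : countable [set` `]p.2, p.2 + r[].
  apply: sub_countable (subset_card_le sub) _; apply: sub_countable (card_image_le _ _) _.
  exact: countableP.
move=> /countable_lebesgue_measure0; rewrite lebesgue_measure_itv/= lte_fin ltrDl r0.
by rewrite -EFinD addrAC subrr add0r => /eqP; rewrite eqe gt_eqF.
Qed.

End Enumeration.

Let idx : countType := (nat * (rat * rat) * (rat * rat) * (rat * rat))%type.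

Let in_rat_itv (q : rat * rat) (x : R) := ratr q.1 < x < ratr q.2.

(** The points above [k] are only required to be zeros of order at least [M],
    without reference to singularity; this is what the local result controls. *)
Let order_stratum (D : (R * R) * R -> R) (i : idx) : set (R * R) :=
  [set k | exists l, [/\ in_rat_itv i.1.1.2 k.1, in_rat_itv i.1.2 k.2, in_rat_itv i.2 l &
     forall j, (j < i.1.1.1)%N -> dlam j D (k, l) = 0]].

Let rat_box (x r : R) : 0 < r -> exists q : rat * rat, in_rat_itv q x /\
  forall y, in_rat_itv q y -> `|y - x| < r.
Proof.
move=> r0.
have /rat_in_itvoo[p] : x - r < x by rewrite ltrBlDr ltrDl.
have /rat_in_itvoo[q] : x < x + r by rewrite ltrDl.
rewrite !in_itv/= => /andP[q1 q2] /andP[p1 p2].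
exists (p, q); rewrite /in_rat_itv /= p2 q1; split=> // y /andP[y1 y2].
by rewrite ltr_norml; apply/andP; split; lra.
Qed.

(** Sort the singular points by their order [M], and cover those of each order
    by countably many rational boxes so small that the local result applies. *)
Lemma singular_projections_null (D : (R * R) * R -> R) :
  (forall p, analytic3_at D p) -> (forall p, exists m, dlam m D p != 0) ->
  (lebesgue2 R).-negligible
    [set k | exists l, singular_part [set p | D p = 0] D (k, l)].
Proof.
move=> Dan ford.
pose F n : set (R * R) := if unpickle n is Some i then
  if `[< (lebesgue2 R).-negligible (order_stratum D i) >] then order_stratum D i else set0 else set0.
have nF : (lebesgue2 R).-negligible (\bigcup_n F n).
  apply: negligible_bigcup => n; rewrite /F; case: unpickle => [i|]; last exact: negligible_set0.
  by case: ifPn => [/asboolP|_]//; exact: negligible_set0.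
apply: negligibleS nF => k [l [Bkl nreg]].
have dP : exists m, dlam m D (k, l) != 0 by exact: ford.
case: (ex_minnP dP) => M dM Mmin.
have dj j : (j < M)%N -> dlam j D (k, l) = 0.
  move=> jM; apply/eqP/negP => /negP /Mmin; by rewrite leqNgt jM.
have [|r r0 nr] := singular_projection_null (Dan (k, l)) Bkl nreg dj; first exact/eqP.
have [q1 [q1k q1r]] := rat_box k.1 r0; have [q2 [q2k q2r]] := rat_box k.2 r0.
have [q3 [q3l q3r]] := rat_box l r0.
pose i : idx := (M, q1, q2, q3).
exists (pickle i) => //; rewrite /F pickleK; case: asboolP => [_|[]].
  by exists l.
apply: negligibleS nr => k' [l' [/= h1 h2 h3 h4]]; exists l'; split=> //; last exact: q3r.
by apply/box2P; split; [exact: q1r|exact: q2r].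
Qed.

Lemma brillouin0 (b1 b2 : R * R) : brillouin b1 b2 (0, 0).
Proof.
move=> g _ g0; rewrite /enorm /dot /= mul0r addr0 sqrtr0 sqrtr_gt0 !sub0r !mulrNN.
rewrite lt_def addr_ge0 -?expr2 ?sqr_ge0// andbT; apply: contra g0.
rewrite paddr_eq0 ?sqr_ge0// !sqrf_eq0; case: g => x y /= /andP[/eqP -> /eqP ->].
exact/eqP.
Qed.

End BranchPoints.

(** * Translations of the plane *)

Section Translation.
Context {R : realType}.
Local Notation mu := (@lebesgue_measure R).
Local Notation T2 := (measurableTypeR R * measurableTypeR R)%type.

Definition shift1 (c : R) (x : measurableTypeR R) : measurableTypeR R := x + c.

Lemma measurable_shift1 c : measurable_fun setT (shift1 c).
Proof. exact: measurable_funD. Qed.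

HB.instance Definition _ c := isMeasurableFun.Build _ _ _ _ (shift1 c) (measurable_shift1 c).

Definition shift2 (h : R * R) (x : T2) : T2 := (x.1 + h.1, x.2 + h.2).

Lemma measurable_shift2 (h : R * R) : measurable_fun setT (shift2 h).
Proof.
apply: measurable_fun_pair => //=.
  by apply: measurable_funD => //; exact: measurable_fst.
by apply: measurable_funD => //; exact: measurable_snd.
Qed.

HB.instance Definition _ h := isMeasurableFun.Build _ _ _ _ (shift2 h) (measurable_shift2 h).

Lemma lebesgue_measure_shift (c : R) (A : set (measurableTypeR R)) : measurable A ->
  pushforward mu (shift1 c) A = mu A.
Proof.
move=> mA.
apply/esym.
apply: (lebesgue_measure_unique (mu := pushforward mu (shift1 c))) => //= _ [[a b]] _ <-.
rewrite /pushforward.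
rewrite (_ : _ @^-1` _ = [set` `]a - c, b - c]]); last first.
  by apply/seteqP; split => x /=; rewrite !in_itv/= ltrBlDr lerBrDr.
rewrite !lebesgue_measure_itv/= !lte_fin ltrD2r; case: ifPn => // _.
by rewrite -!EFinD; congr EFin; lra.
Qed.

Lemma lebesgue2_shift (h : R * R) (A : set T2) : measurable A ->
  lebesgue2 R (shift2 h @^-1` A) = lebesgue2 R A.
Proof.
move=> mA; apply/esym.
apply: (product_measure_unique (m' := pushforward (lebesgue2 R) (shift2 h))) => // B C mB mC.
rewrite /= /pushforward (_ : _ @^-1` _ = (shift1 h.1 @^-1` B) `*` (shift1 h.2 @^-1` C)); last by [].
rewrite /lebesgue2 /=.
have mD c (E : set (measurableTypeR R)) : measurable E ->
    measurable (shift1 c @^-1` E).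
  by move=> mE; rewrite -[X in measurable X]setTI; exact: measurable_shift1.
rewrite product_measure1E//; [|exact: mD|exact: mD].
by rewrite -[in RHS](lebesgue_measure_shift h.1 mB) -[in RHS](lebesgue_measure_shift h.2 mC).
Qed.

Lemma negligible_shift (h : R * R) (N : set (R * R)) : (lebesgue2 R).-negligible N ->
  (lebesgue2 R).-negligible [set x | N (x.1 + h.1, x.2 + h.2)].
Proof.
move=> [A [mA A0 NA]]; exists (shift2 h @^-1` A); split.
- by rewrite -[X in measurable X]setTI; exact: measurable_shift2.
- by rewrite -A0; exact: lebesgue2_shift.
- by move=> x /= /NA.
Qed.

Lemma Rintegral_shift (h : R * R) (f : R * R -> R) :
  (lebesgue2 R).-integrable setT (EFin \o f) ->
  \int[lebesgue2 R]_x f (x.1 + h.1, x.2 + h.2) = \int[lebesgue2 R]_x f x.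
Proof.
move=> intf; rewrite /Rintegral; congr fine.
pose g : T2 -> \bar R := fun x => (f (x.1 + h.1, x.2 + h.2))%:E.
have mf : measurable_fun setT (EFin \o f : T2 -> \bar R) := measurable_int _ intf.
have mg : measurable_fun setT g.
  exact: (measurableT_comp mf (measurable_shift2 h)).
pose psi (x : T2) : T2 := (x.1 + - h.1, x.2 + - h.2).
have mpsi : measurable_fun setT psi by exact: (measurable_shift2 (- h.1, - h.2)).
have gpsi : g \o psi = EFin \o f.
  by apply/funext => x; rewrite /g /psi /= !subrK -surjective_pairing.
have := @integral_pushforward _ _ _ _ R psi mpsi (lebesgue2 R) setT g mg.
rewrite gpsi => /(_ intf measurableT) <-.
apply: eq_measure_integral => A mA _ /=.
apply/esym; exact: (lebesgue2_shift (- h.1, - h.2)).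
Qed.

Lemma ge0_integral_shift (h : R * R) (f : T2 -> \bar R) : measurable_fun setT f ->
  (forall x, 0 <= f x)%E ->
  (\int[lebesgue2 R]_x f (shift2 h x) = \int[lebesgue2 R]_x f x)%E.
Proof.
move=> mf f0.
have := @ge0_integral_pushforward _ _ _ _ R (shift2 h) (measurable_shift2 h)
  (lebesgue2 R) setT f measurableT mf.
rewrite preimage_setT => <-; last by move=> x _; exact: f0.
by apply: eq_measure_integral => A mA _ /=; exact: lebesgue2_shift.
Qed.

End Translation.

(** * Functions with zero integral over rectangles *)

Section Determination.
Context {R : realType}.
Local Notation mu2 := (lebesgue2 R).
Local Notation T2 := (measurableTypeR R * measurableTypeR R)%type.

(** Pi-lambda argument for the sets pulled back along [p]. It is used for each
    of the two coordinates and then for the identity of the plane. *)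
Lemma density_pi_lambda d (T : measurableType d) (p : T2 -> T) (G : set (set T))
    (K : set T2) (f g : T2 -> \bar R) :
  measurable_fun setT p -> measurable = <<s G >> -> setI_closed G -> measurable K ->
  measurable_fun setT f -> measurable_fun setT g ->
  (forall x, 0 <= f x)%E -> (forall x, 0 <= g x)%E ->
  (\int[mu2]_(x in K) f x < +oo)%E ->
  (\int[mu2]_(x in K) f x = \int[mu2]_(x in K) g x)%E ->
  (forall A, G A ->
    \int[mu2]_(x in K `&` p @^-1` A) f x = \int[mu2]_(x in K `&` p @^-1` A) g x)%E ->
  forall A, measurable A ->
    (\int[mu2]_(x in K `&` p @^-1` A) f x = \int[mu2]_(x in K `&` p @^-1` A) g x)%E.
Proof.
move=> mp mG GI mK mf mg f0 g0 fK fgK fgG.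
have mE A : measurable A -> measurable (K `&` p @^-1` A).
  by move=> mA; apply: measurableI => //; rewrite -[X in measurable X]setTI; exact: mp.
pose H := [set A : set T | measurable A /\
  (\int[mu2]_(x in K `&` p @^-1` A) f x = \int[mu2]_(x in K `&` p @^-1` A) g x)%E].
suff sub : <<s G >> `<=` H by move=> A; rewrite mG => /sub [].
apply: (lambda_system_subset GI) => //; last first.
  by move=> A GA; split; [rewrite mG; exact: sub_sigma_algebra|exact: fgG].
split=> //.
- by split=> //; rewrite preimage_setT setIT.
- move=> A B BA [mA eA] [mB eB]; split; first exact: measurableD.
  have AE : K `&` p @^-1` A = (K `&` p @^-1` (A `\` B)) `|` (K `&` p @^-1` B).
    rewrite -setIUr -preimage_setU; congr (_ `&` _ @^-1` _).
    by rewrite setDE setUIl setUCl setIT; apply/esym/setUidl.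
  have dAB : [disjoint K `&` p @^-1` (A `\` B) & K `&` p @^-1` B].
    by apply/disj_setPS => x /= [[_ [_ nB]] [_ Bx]]; exact: nB.
  have mAB : measurable (K `&` p @^-1` (A `\` B)) by apply: mE; exact: measurableD.
  have spl (h : T2 -> \bar R) : measurable_fun setT h -> (forall x, 0 <= h x)%E ->
    (\int[mu2]_(x in K `&` p @^-1` A) h x = \int[mu2]_(x in K `&` p @^-1` (A `\` B)) h x
      + \int[mu2]_(x in K `&` p @^-1` B) h x)%E.
    move=> mh h0; rewrite AE ge0_integral_setU//; first exact: mE.
    exact: measurable_funTS.
  have fB : (\int[mu2]_(x in K `&` p @^-1` B) g x)%E \is a fin_num.
    rewrite -eB ge0_fin_numE ?integral_ge0//; apply: le_lt_trans fK.
    by apply: ge0_subset_integral => //; [exact: mE|exact: measurable_funTS].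
  by move: eA; rewrite !spl// eB => eA; rewrite -[LHS](addeK _ fB) eA addeK.
- move=> F ndF HF; split; first by apply: bigcup_measurable => n _; have [] := HF n.
  have cv (h : T2 -> \bar R) : measurable_fun setT h -> (forall x, 0 <= h x)%E ->
    (\int[mu2]_(x in K `&` p @^-1` F n) h x)%E @[n --> \oo] -->
    (\int[mu2]_(x in K `&` p @^-1` \bigcup_n F n) h x)%E.
    move=> mh h0; rewrite preimage_bigcup setI_bigcupr.
    apply: ge0_nondecreasing_set_cvg_integral => //.
    + by move=> m n mn; apply/subsetPset; apply: setIS; apply: preimage_subset; apply/subsetPset/ndF.
    + by move=> n; apply: mE; have [] := HF n.
    + by move=> n; exact: measurable_funTS.
  have cf := cv f mf f0; have cg := cv g mg g0.
  have e : (fun n => \int[mu2]_(x in K `&` p @^-1` F n) f x)%E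
         = (fun n => \int[mu2]_(x in K `&` p @^-1` F n) g x)%E.
    by apply/funext => n; have [] := HF n.
  by move: cf; rewrite e => cf; exact: (cvg_unique _ cf cg).
Qed.

Definition rect (a b c d : R) : set T2 := [set` `]a, b[] `*` [set` `]c, d[].

Lemma measurable_rect a b c d : measurable (rect a b c d).
Proof. by apply: measurableX; exact: measurable_itv. Qed.

Lemma ray_setI_closed : setI_closed (@RGenOInfty.G R).
Proof.
move=> A B [x ->] [y ->]; exists (Num.max x y); apply/seteqP.
by split => z /=; rewrite !in_itv/= !andbT gt_max => /andP.
Qed.

Lemma rectE (n : R) (x y : R) :
  rect (- n) n (- n) n `&` (fst @^-1` [set` `]x, +oo[]) `&` (snd @^-1` [set` `]y, +oo[])
  = rect (Num.max (- n) x) n (Num.max (- n) y) n.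
Proof.
apply/seteqP; split => z /=; rewrite /rect /= !in_itv/= !andbT !gt_max.
  by move=> [[[/andP[-> ->] /andP[-> ->]] ->] ->].
by move=> [/andP[/andP[-> ->] ->] /andP[/andP[-> ->] ->]].
Qed.

Lemma rectE1 (n : R) (x : R) :
  rect (- n) n (- n) n `&` (fst @^-1` [set` `]x, +oo[]) = rect (Num.max (- n) x) n (- n) n.
Proof.
apply/seteqP; split => z /=; rewrite /rect /= !in_itv/= !andbT !gt_max.
  by move=> [[/andP[-> ->] /andP[-> ->]] ->].
by move=> [/andP[/andP[-> ->] ->] /andP[-> ->]].
Qed.

Lemma rectE2 (n : R) (y : R) :
  rect (- n) n (- n) n `&` (snd @^-1` [set` `]y, +oo[]) = rect (- n) n (Num.max (- n) y) n.
Proof.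
apply/seteqP; split => z /=; rewrite /rect /= !in_itv/= !andbT !gt_max.
  by move=> [[/andP[-> ->] /andP[-> ->]] ->].
by move=> [/andP[-> ->] /andP[/andP[-> ->] ->]].
Qed.

(** Positive and negative part have equal integrals over all rectangles, hence
    over all measurable subsets of a bounded rectangle. *)
Lemma zero_on_rectangles (f : T2 -> R) : measurable_fun setT f ->
  (forall a b c d, mu2.-integrable (rect a b c d) (EFin \o f)) ->
  (forall a b c d, \int[mu2]_(x in rect a b c d) (f x)%:E = 0)%E ->
  {ae mu2, forall x, f x = 0}.
Proof.
move=> mf fint f0.
have mEf : measurable_fun setT (EFin \o f : T2 -> \bar R) by exact/measurable_EFinP.
pose p : T2 -> \bar R := ((EFin \o f)^\+)%E; pose q : T2 -> \bar R := ((EFin \o f)^\-)%E.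
have mp : measurable_fun setT p by exact: measurable_funepos.
have mq : measurable_fun setT q by exact: measurable_funeneg.
have p0 x : (0 <= p x)%E by exact: funepos_ge0.
have q0 x : (0 <= q x)%E by exact: funeneg_ge0.
have fin a b c d : ((\int[mu2]_(x in rect a b c d) p x)%E \is a fin_num) *
    ((\int[mu2]_(x in rect a b c d) q x)%E \is a fin_num).
  split; apply: integrable_fin_num => //; try exact: measurable_rect.
    by apply: integrable_funepos => //; exact: measurable_rect.
  by apply: integrable_funeneg => //; exact: measurable_rect.
have pq a b c d : (\int[mu2]_(x in rect a b c d) p x = \int[mu2]_(x in rect a b c d) q x)%E.
  have := f0 a b c d; rewrite integralE -/p -/q => /eqP.
  by rewrite sube_eq ?fin// ?fin_num_adde_defl ?fin// add0e => /eqP.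
have pqfin a b c d : (\int[mu2]_(x in rect a b c d) p x < +oo)%E.
  by rewrite ltey_eq fin.
have mfst : measurable_fun setT (fst : T2 -> measurableTypeR R) by exact: measurable_fst.
have msnd : measurable_fun setT (snd : T2 -> measurableTypeR R) by exact: measurable_snd.
have mR : @measurable _ (measurableTypeR R) = <<s @RGenOInfty.G R >>.
  exact: RGenOInfty.measurableE.
have mI A (B : set (measurableTypeR R)) (h : T2 -> measurableTypeR R) :
    measurable_fun setT h -> measurable A -> measurable B -> measurable (A `&` h @^-1` B).
  move=> mh mA mB; apply: measurableI => //.
  by rewrite -[X in measurable X]setTI; exact: mh.
have lt1 n A : measurable A ->
    (\int[mu2]_(x in rect (- n) n (- n) n `&` A) p x < +oo)%E.
  move=> mA; apply: le_lt_trans (pqfin (- n) n (- n) n).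
  apply: ge0_subset_integral => //; try exact: measurable_rect.
    by apply: measurableI => //; exact: measurable_rect.
  exact: measurable_funTS.
have mpre (h : T2 -> measurableTypeR R) B : measurable_fun setT h -> measurable B ->
    measurable (h @^-1` B).
  by move=> mh mB; rewrite -[X in measurable X]setTI; exact: mh.
have mray (y : R) : measurable ([set` `]y, +oo[] : set (measurableTypeR R)).
  exact: measurable_itv.
(* A ray in the second coordinate and an arbitrary set in the first. *)
have step1 n (y : R) (A : set (measurableTypeR R)) : measurable A ->
    (\int[mu2]_(x in rect (- n) n (- n) n `&` (snd @^-1` [set` `]y, +oo[]) `&` (fst @^-1` A)) p x
   = \int[mu2]_(x in rect (- n) n (- n) n `&` (snd @^-1` [set` `]y, +oo[]) `&` (fst @^-1` A)) q x)%E.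
  move: A; apply: (density_pi_lambda mfst mR ray_setI_closed) => //.
  - exact: mI msnd (measurable_rect _ _ _ _) (mray y).
  - by apply: lt1; exact: mpre.
  - by rewrite rectE2.
  - by move=> _ [x ->]; rewrite setIAC rectE.
have step2 n (A B : set (measurableTypeR R)) : measurable A -> measurable B ->
    (\int[mu2]_(x in rect (- n) n (- n) n `&` (fst @^-1` A) `&` (snd @^-1` B)) p x
   = \int[mu2]_(x in rect (- n) n (- n) n `&` (fst @^-1` A) `&` (snd @^-1` B)) q x)%E.
  move=> mA; move: B; apply: (density_pi_lambda msnd mR ray_setI_closed) => //.
  - exact: mI mfst (measurable_rect _ _ _ _) mA.
  - by apply: lt1; exact: mpre.
  - apply: (density_pi_lambda mfst mR ray_setI_closed) => //.
    + exact: measurable_rect.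
    + by move=> _ [x ->]; rewrite rectE1.
  - by move=> _ [y ->]; rewrite setIAC; exact: step1.
have step3 n (E : set T2) : measurable E ->
    (\int[mu2]_(x in rect (- n) n (- n) n `&` id @^-1` E) p x
   = \int[mu2]_(x in rect (- n) n (- n) n `&` id @^-1` E) q x)%E.
  move: E; apply: (density_pi_lambda (G := [set A `*` B | A in measurable & B in measurable])) => //.
  - exact: measurable_prod_measurableType.
  - move=> _ _ [A mA [B mB <-]] [A' mA' [B' mB' <-]]; rewrite -setXI.
    by exists (A `&` A'); [exact: measurableI|exists (B `&` B') => //; exact: measurableI].
  - exact: measurable_rect.
  - by move=> _ [A mA [B mB <-]]; have := step2 n A B mA mB; rewrite -setIA.
have ae_n (n : nat) : mu2.-negligible (rect (- n%:R) n%:R (- n%:R) n%:R `&` [set x | f x <> 0]).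
  have : ae_eq mu2 (rect (- n%:R) n%:R (- n%:R) n%:R) (EFin \o f) (cst 0%E).
    apply: integral_ae_eq => //; first exact: measurable_rect.
    move=> E En mE; rewrite integral_cst// mul0e integralE -/p -/q.
    have := step3 n%:R E mE; rewrite preimage_id (setIidr En) => ->.
    rewrite subee//; apply: integrable_fin_num => //.
    apply: integrable_funeneg => //.
    by apply: (integrableS _ _ En (fint _ _ _ _)) => //; exact: measurable_rect.
  by apply: negligibleS => x [xn fx] /= h; apply: fx; have [] := h xn.
apply: negligibleS (negligible_bigcup ae_n) => x /= fx.
pose N := (Num.bound (`|x.1| + `|x.2|)).
have hN : `|x.1| + `|x.2| < N%:R by rewrite archi_boundP// addr_ge0.
exists N => //; split=> //; rewrite /rect /= !in_itv/= -!ltr_norml.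
by split; apply: le_lt_trans hN; rewrite ?lerDl ?lerDr.
Qed.

End Determination.

(** * Smooth functions *)

Section SmoothOneVariable.
Context {R : realType}.

(** The functions [x^-n e^(-1/x)] for [x > 0], extended by zero; their span is
    stable under differentiation. *)
Definition flat (n : nat) (x : R) : R := if 0 < x then (x ^+ n)^-1 * expR (- x^-1) else 0.

(** The class contains the functions required here and is stable under
    derivation ([smooth_is_derive]), which makes its members infinitely
    differentiable without counting derivatives. *)
Inductive smooth : (R -> R) -> Prop :=
| smooth_cst c : smooth (fun=> c)
| smooth_cos : smooth cos
| smooth_sin : smooth sin
| smooth_flat n : smooth (flat n)
| smooth_add f g : smooth f -> smooth g -> smooth (fun x => f x + g x)
| smooth_mul f g : smooth f -> smooth g -> smooth (fun x => f x * g x)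
| smooth_aff a b f : smooth f -> smooth (fun x => f (a * x + b))
| smooth_primitive_of F f : (forall x, is_derive (x : R) (1 : R) F (f x)) -> smooth f -> smooth F.

Lemma flat_bound n x : `|flat n x| <= n.+2`!%:R * x ^+ 2.
Proof.
rewrite /flat; case: ifPn => [x0|_]; last by rewrite normr0 mulr_ge0// sqr_ge0.
rewrite ger0_norm; last by rewrite mulr_ge0 ?invr_ge0 ?exprn_ge0 ?expR_ge0// ltW.
rewrite expRN -invfM -[leRHS]invrK lef_pV2 ?posrE; last 2 first.
- by rewrite mulr_gt0 ?exprn_gt0 ?expR_gt0.
- by rewrite invr_gt0 mulr_gt0 ?exprn_gt0// ltr0n fact_gt0.
have := @expR_ge1Dxn R x^-1 n.+1; rewrite invr_ge0 => /(_ (ltW x0)) h.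
have : (x^-1 ^+ n.+2 / n.+2`!%:R) <= expR x^-1 by lra.
move=> h2; have xn := exprn_gt0 n x0; rewrite -(ler_pM2l xn) in h2.
apply: le_trans h2; rewrite exprVn (_ : x ^+ n.+2 = x ^+ 2 * x ^+ n); last by rewrite -exprD.
rewrite le_eqVlt; apply/orP; left; apply/eqP.
have : (n.+2`!%:R : R) != 0 by rewrite pnatr_eq0 -lt0n fact_gt0.
have xn0 : x != 0 by rewrite gt_eqF.
by move: (n.+2`!%:R : R) => N N0; field; rewrite ?N0 ?xn0 ?expf_neq0.
Qed.

(** At the origin the quadratic bound [flat_bound] makes the difference
    quotient Lipschitz. *)
Lemma flat_deriv n (x : R) :
  is_derive x (1 : R) (flat n) (flat n.+2 x - n%:R * flat n.+1 x).
Proof.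
have [x0|x0|<-] := ltgtP 0 x.
- have : is_derive x (1 : R) (fun y : R => (y^-1) ^+ n * expR (- y^-1))
     (flat n.+2 x - n%:R * flat n.+1 x).
    have dV : is_derive x (1 : R) (fun y : R => y^-1) (- x ^- 2).
      have xn0 : (id x : R) != 0 by rewrite gt_eqF.
      have did : derivable (id : R -> R) x 1 by exact: derivable_id.
      apply: DeriveDef; first exact: (derivableV xn0 did).
      by rewrite (deriveV xn0 did) derive_id /GRing.scale /= mulr1.
    have dE : is_derive x (1 : R) (fun y : R => expR (- y^-1)) (expR (- x^-1) * x ^- 2).
      have dN : is_derive x (1 : R) (fun y : R => - y^-1) (x ^- 2).
        by apply: is_derive_eq (is_deriveN dV) _; rewrite opprK.
      exact: (is_derive1_comp (is_derive_expR _) dN).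
    have dX : is_derive x (1 : R) (fun y : R => y^-1 ^+ n) ((n%:R * x^-1 ^+ n.-1) * - x ^- 2).
      rewrite (_ : (fun y : R => y^-1 ^+ n) = (fun y : R => y^-1) ^+ n).
        exact: is_deriveX.
      by rewrite exprfctE.
    apply: is_derive_eq (is_deriveM dX dE) _.
    have xn0 : x != 0 by rewrite gt_eqF.
    rewrite /flat x0 /GRing.scale /= !exprVn; move: (expR _) => e.
    case: n {dX} => [|n]; rewrite /= !exprS ?expr0; first by field.
    by field; rewrite xn0 expf_neq0.
  apply: near_eq_is_derive; near=> y; rewrite /flat ifT ?exprVn//.
  by near: y; exact: lt_nbhsr.
- have e : flat n.+2 x - n%:R * flat n.+1 x = 0 by rewrite /flat ltNge ltW//= mulr0 subr0.
  have z : is_derive x (1 : R) (cst (0 : R)) 0 by exact: is_derive_cst.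
  rewrite e; apply: near_eq_is_derive z.
  near=> y; rewrite /flat ifF//; apply/negbTE; rewrite -leNgt ltW//.
  by near: y; exact: lt_nbhsl.
- have e m : flat m 0 = 0 by rewrite /flat ltxx.
  rewrite !e mulr0 subr0.
  have := @deriv_quot R (flat n) (fun t => t^-1 * flat n t) 0 1 n.+2`!%:R ltr01.
  rewrite invr0 mul0r; apply=> t ts; rewrite ?e ?subr0.
    have [->|t0] := eqVneq t 0; first by rewrite e mul0r.
    by rewrite mulrA divff// mul1r.
  have [->|t0] := eqVneq t 0; first by rewrite invr0 mul0r !normr0 mulr0.
  rewrite normrM normfV ler_pdivrMl ?normr_gt0//.
  by apply: le_trans (flat_bound n t) _; rewrite [leRHS]mulrCA -normrM -expr2 ger0_norm ?sqr_ge0.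
Unshelve. all: by end_near.
Qed.

Lemma smooth_is_derive f : smooth f ->
  exists2 g, smooth g & forall x, is_derive (x : R) (1 : R) f (g x).
Proof.
elim=> {f} [c|||n|f g Sf [f' Sf' df] Sg [g' Sg' dg]|f g Sf [f' Sf' df] Sg [g' Sg' dg]|a b f Sf [f' Sf' df]|F f dF Sf _].
- by exists (fun=> 0); [exact: smooth_cst|move=> x; exact: is_derive_cst].
- exists (fun x => -1 * sin x); first by apply: smooth_mul; [exact: smooth_cst|exact: smooth_sin].
  by move=> x; apply: is_derive_eq (is_derive_cos x) _; rewrite mulN1r.
- by exists cos; [exact: smooth_cos|move=> x; exact: is_derive_sin].
- exists (fun x => flat n.+2 x + - n%:R * flat n.+1 x).
    by apply: smooth_add; [|apply: smooth_mul; [exact: smooth_cst|]]; exact: smooth_flat.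
  by move=> x; apply: is_derive_eq (flat_deriv n x) _; rewrite mulNr.
- exists (fun x => f' x + g' x); first exact: smooth_add.
  by move=> x; exact: is_deriveD.
- exists (fun x => f x * g' x + g x * f' x); first by apply: smooth_add; exact: smooth_mul.
  by move=> x; exact: is_deriveM.
- exists (fun x => a * f' (a * x + b)); first by apply: smooth_mul;
  [exact: smooth_cst|exact: smooth_aff].
  move=> x; have dA : is_derive x (1 : R) (fun y : R => a * y + b) a.
    apply: is_derive_eq (is_deriveD (is_deriveZ a (is_derive_id x (1 : R))) (is_derive_cst b x
      (1 : R))) _.
    by rewrite addr0 /GRing.scale /= mulr1.
  by rewrite mulrC; exact: (@is_derive1_comp R f (fun y => a * y + b) x _ _ (df (a * x + b)) dA).
- by exists f.
Qed.

Lemma smooth_continuous f : smooth f -> continuous f.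
Proof.
move=> Sf; have [g _ df] := smooth_is_derive Sf; move=> x; have [d _] := df x.
by apply: differentiable_continuous; apply/derivable1_diffP.
Qed.

Lemma smooth_scale c f : smooth f -> smooth (fun x => c * f x).
Proof. by apply: smooth_mul; exact: smooth_cst. Qed.

(** The integral from minus infinity converges because of the compact support. *)
Lemma smooth_primitive f (r : R) : smooth f -> (forall x, r < `|x| -> f x = 0) ->
  exists2 F, smooth F & forall x, is_derive (x : R) (1 : R) F (f x).
Proof.
move=> Sf f0; pose F x := \int[@lebesgue_measure R]_(t in [set` `]-oo, x]]) f t.
have fc := smooth_continuous Sf.
have dF x : is_derive (x : R) (1 : R) F (f x).
  have xu : x < x + 1 by rewrite ltrDl.
  have intf : (@lebesgue_measure R).-integrable [set` `]-oo, x + 1]] (EFin \o f).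
    pose K : set R := [set` `[- r, r]].
    have intK : (@lebesgue_measure R).-integrable K (EFin \o f).
      apply: continuous_compact_integrable; first exact: segment_compact.
      exact: continuous_subspaceT.
    have intT : (@lebesgue_measure R).-integrable setT (EFin \o f).
      have mK : measurable (K : set (measurableTypeR R)) by exact: measurable_itv.
      have := (@integrable_mkcond _ (measurableTypeR R) R lebesgue_measure K (EFin \o f) mK).1 intK.
      rewrite (_ : _ \_ _ = EFin \o f)//; apply/funext => y; rewrite patchE.
      case: ifPn => // yK; rewrite /= f0// ltNge; apply: contra yK => yr.
      by rewrite inE /K /= in_itv/= -ler_norml.
    apply: (integrableS _ _ _ intT) => //; exact: measurable_itv.
  have FTC := @continuous_FTC1 R f -oo%O x (x + 1) xu intf.
  have [|d e] := FTC _ (fc x); first exact: ltNyr.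
  by apply: DeriveDef; [exact: d|rewrite -derive1E; exact: e].
exists F => //; exact: smooth_primitive_of dF Sf.
Qed.

Let coord_lin (i : bool) : linear (fun x : R * R => if i then x.2 else x.1).
Proof. by case: i. Qed.

Lemma coord_is_derive f f' (i : bool) (x v : R * R) :
  (forall y, is_derive (y : R) (1 : R) f (f' y)) ->
  let p (i : bool) (x : R * R) : R := if i then x.2 else x.1 in
  differentiable (fun x => f (p i x)) x /\
  is_derive x v (fun x => f (p i x)) (p i v * f' (p i x)).
Proof.
move=> df p.
pose l := GRing.isLinear.Build R (R * R)%type R _ (p i : R * R -> R) (coord_lin i).
pose P : {linear (R * R)%type -> R} := HB.pack (p i : R * R -> R) l.
have cP : continuous P by rewrite /P /= /p; case: i {l P} => y; [exact: cvg_snd|exact: cvg_fst].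
have dP := linear_differentiable x cP.
have [d e] := df (p i x).
have dfx : differentiable f (P x) by apply/derivable1_diffP.
have dfP : differentiable (f \o P) x by exact: differentiable_comp.
split; first exact: dfP.
apply: DeriveDef; first exact: diff_derivable.
have dPE : 'd P x v = P v by rewrite (diff_lin x cP).
by rewrite (deriveE _ dfP) (diff_comp dP dfx) [LHS]/= dPE (diff1E dfx) derive1E /= e.
Qed.

(** A class of functions of two variables that contains the directional
    derivatives of its members, so that all their iterated derivatives are
    differentiable. *)
Inductive tensor_sum : (R * R -> R) -> Prop :=
| tensor_mul f q : smooth f -> smooth q -> tensor_sum (fun x => f x.1 * q x.2)
| tensor_add F G : tensor_sum F -> tensor_sum G -> tensor_sum (fun x => F x + G x).

Lemma tensor_deriv F : tensor_sum F -> (forall x, differentiable F x) /\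
  forall v, exists2 G, tensor_sum G & forall x, is_derive x v F (G x).
Proof.
elim=> {F} [f q Sf Sq|F G _ [dF DF] _ [dG DG]].
  have [f' Sf' df] := smooth_is_derive Sf; have [q' Sq' dq] := smooth_is_derive Sq.
  split=> [x|v].
    have [a _] := coord_is_derive false x 0 df.
    have [b _] := coord_is_derive true x 0 dq.
    exact: (differentiableM a b).
  exists (fun x => f x.1 * (v.2 * q' x.2) + (v.1 * f' x.1) * q x.2).
    apply: tensor_add; first exact: (tensor_mul Sf (smooth_scale v.2 Sq')).
    exact: (tensor_mul (smooth_scale v.1 Sf') Sq).
  move=> x; have [_ a] := coord_is_derive false x v df.
  have [_ b] := coord_is_derive true x v dq.
  apply: is_derive_eq (is_deriveM a b) _.
  by rewrite /GRing.scale /= (mulrC (v.1 * _)).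
split=> [x|v]; first exact: differentiableD (dF x) (dG x).
have [F' tF' dF'] := DF v; have [G' tG' dG'] := DG v.
by exists (fun x => F' x + G' x); [exact: tensor_add|move=> x; exact: is_deriveD].
Qed.

Lemma tensor_test F r : tensor_sum F -> (forall x, r < `|x| -> F x = 0) -> test_fun F.
Proof.
move=> tF F0; split.
  move=> s; suff : tensor_sum (foldr (fun v f => 'D_v f) F s) by move=> /tensor_deriv[].
  elim: s => //= v s /tensor_deriv[_ /(_ v)[G tG dG]].
  rewrite (_ : 'D_v _ = G)//; apply/funext => x; by have [_ ->] := dG x.
pose K : set (R * R) := [set` `[- r, r]] `*` [set` `[- r, r]].
have cK : compact K by apply: compact_setX; exact: segment_compact.
apply: (subclosed_compact _ cK); first exact: closed_closure.
have clK : closed K by apply: compact_closed cK; exact: norm_hausdorff.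
rewrite [X in _ `<=` X](closure_id K).1//; apply: closureS => x /= /eqP Fx.
have : `|x| <= r by rewrite leNgt; apply/negP => /F0.
by rewrite prod_normE ge_max /K/= !in_itv/= -!ler_norml => /andP[].
Qed.

End SmoothOneVariable.

(** * Bump functions *)

Section Bumps.
Context {R : realType}.
Local Notation mu2 := (lebesgue2 R).
Local Notation T2 := (measurableTypeR R * measurableTypeR R)%type.

Definition bump (f : R -> R) := smooth f /\ exists r, forall x, r < `|x| -> f x = 0.

(** Products of functions of one variable suffice as test functions, and
    integrals against them can be handled one coordinate at a time. *)
Inductive bumps : (R * R -> R) -> Prop :=
| bumps_mul f q : bump f -> bump q -> bumps (fun x => f x.1 * q x.2)
| bumps_add F G : bumps F -> bumps G -> bumps (fun x => F x + G x).

Lemma bump_mul f g : bump f -> smooth g -> bump (fun x => f x * g x).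
Proof.
by move=> [Sf [r f0]] Sg; split; [exact: smooth_mul|exists r => x /f0 ->; rewrite mul0r].
Qed.

Lemma bump_scale c f : bump f -> bump (fun x => c * f x).
Proof.
by move=> [Sf [r f0]]; split; [exact: smooth_scale|exists r => x /f0 ->; rewrite mulr0].
Qed.

Lemma bump_shift h f : bump f -> bump (fun x => f (x + h)).
Proof.
move=> [Sf [r f0]]; split.
  rewrite (_ : (fun x => _) = (fun x => f (1 * x + h))); first exact: smooth_aff.
  by apply/funext => x; rewrite mul1r.
exists (r + `|h|) => x xr; apply: f0.
by have := ler_normB (x + h) h; rewrite addrK; lra.
Qed.

Lemma bump_deriv f : bump f ->
  exists2 g, bump g & forall x, is_derive (x : R) (1 : R) f (g x).
Proof.
move=> [Sf [r f0]]; have [g Sg df] := smooth_is_derive Sf; exists g => //.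
split=> //; exists r => x rx.
have z : is_derive x (1 : R) f 0.
  have zc : is_derive x (1 : R) (cst (0 : R)) 0 by exact: is_derive_cst.
  apply: near_eq_is_derive zc; apply/nbhs_ballP; exists (`|x| - r); first by rewrite /= subr_gt0.
  move=> y; rewrite -ball_normE /ball_/= => xy; rewrite f0//.
  by have := lerB_dist x y; lra.
by have [_ <-] := df x; have [_] := z.
Qed.

Lemma bump_bounded f : bump f -> exists C, forall x, `|f x| <= C.
Proof.
move=> [Sf [r f0]]; have fc := smooth_continuous Sf.
have [r0|r0] := leP 0 r; last first.
  by exists 0 => x; rewrite f0 ?normr0// (lt_le_trans r0).
have rr : - r <= r by lra.
have ncf : {within `[- r, r], continuous (fun x => `|f x|)}.
  apply: continuous_subspaceT => x; apply: continuous_comp; first exact: fc.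
  exact: norm_continuous.
have [c _ cmax] := EVT_max rr ncf.
exists `|f c| => x; have [xr|xr] := leP `|x| r.
  by apply: cmax; rewrite in_itv/= -ler_norml.
by rewrite f0// normr0.
Qed.

Lemma smooth_measurable f : smooth f -> measurable_fun setT (f : measurableTypeR R ->
  measurableTypeR R).
Proof. by move=> Sf; apply: continuous_measurable_fun; exact: smooth_continuous. Qed.

Lemma bumps_measurable F : bumps F -> measurable_fun setT (F : T2 -> R).
Proof.
elim=> {F} [f q [Sf _] [Sq _]|F G _ mF _ mG]; last exact: measurable_funD.
apply: measurable_funM.
  exact: (measurableT_comp (smooth_measurable Sf) measurable_fst).
exact: (measurableT_comp (smooth_measurable Sq) measurable_snd).
Qed.

Lemma bumps_tensor F : bumps F -> tensor_sum F.
Proof. by elim=> {F} [f q [Sf _] [Sq _]|F G _ tF _ tG]; [exact: tensor_mul|exact: tensor_add]. Qed.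

Lemma bumps_bounded F : bumps F -> exists C r, [/\ forall x, `|F x| <= C & forall x, r < `|x| ->
  F x = 0].
Proof.
elim=> {F} [f q bf bq|F G _ [C [r [FC F0]]] _ [C' [r' [GC G0]]]].
  have [C fC] := bump_bounded bf; have [C' qC] := bump_bounded bq.
  have [_ [r f0]] := bf; have [_ [r' q0]] := bq.
  exists (C * C'), (Num.max r r'); split=> x; first by rewrite normrM ler_pM.
  rewrite prod_normE lt_max !gt_max => /orP[]/andP[h1 h2].
    by rewrite f0 ?mul0r.
  by rewrite q0 ?mulr0.
exists (C + C'), (Num.max r r'); split=> x.
  by rewrite (le_trans (ler_normD _ _))// lerD.
by rewrite gt_max => /andP[/F0 -> /G0 ->]; rewrite addr0.
Qed.

Lemma bumps_test F : bumps F -> test_fun F.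
Proof. by move=> bF; have [C [r [_ F0]]] := bumps_bounded bF;
  exact: tensor_test (bumps_tensor bF) F0. Qed.

Definition sup_ball (r : R) : set T2 := [set x : R * R | `|x| <= r].

Definition locint (g : R * R -> R) := measurable_fun setT (g : T2 ->
  R) /\ forall r, mu2.-integrable (sup_ball r) (EFin \o g).

Lemma sup_ballE r : sup_ball r = ([set` `[- r, r]] `*` [set` `[- r, r]] : set T2).
Proof.
apply/seteqP; split => x; rewrite /sup_ball /= prod_normE ge_max !in_itv/= -!ler_norml => /andP//.
Qed.

Lemma measurable_sup_ball r : measurable (sup_ball r).
Proof. by rewrite sup_ballE; apply: measurableX; exact: measurable_itv. Qed.

Lemma locint_mul_integrable g F : locint g -> measurable_fun setT (F : T2 -> R) ->
  (exists C r, [/\ forall x, `|F x| <= C & forall x, r < `|x| -> F x = 0]) ->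
  mu2.-integrable setT (EFin \o (fun x => g x * F x)).
Proof.
move=> [mg gint] mF [C [r [FC F0]]].
have C0 : 0 <= C by apply: le_trans (FC 0).
have int1 : mu2.-integrable (sup_ball r) (EFin \o (fun x => g x * F x)).
  apply: (@le_integrable _ _ _ _ _ (measurable_sup_ball r) _ (fun x => (C * g x)%:E)).
  - by apply/measurable_EFinP; apply: measurable_funTS; exact: measurable_funM.
  - move=> x _; rewrite /= lee_fin !normrM mulrC (ger0_norm C0).
    by rewrite ler_wpM2r.
  - by have := integrableZl (measurable_sup_ball r) C (gint r); under eq_fun do rewrite /= -EFinM.
have := (@integrable_mkcond _ T2 R mu2 (sup_ball r) _ (measurable_sup_ball r)).1 int1.
rewrite (_ : _ \_ _ = (EFin \o (fun x => g x * F x)))//; apply/funext => x; rewrite patchE.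
case: ifPn => // xr; rewrite /= F0 ?mulr0// ltNge; apply: contra xr => xr.
by rewrite inE.
Qed.

Lemma bumps_integrable g F : locint g -> bumps F ->
  mu2.-integrable setT (EFin \o (fun x => g x * F x)).
Proof.
move=> gl bF; apply: locint_mul_integrable => //; [exact: bumps_measurable|exact: bumps_bounded].
Qed.

Lemma flat0_bound (x : R) : 0 <= flat 0 x <= 1.
Proof.
rewrite /flat; case: ifPn => [x0|_]; last by rewrite lexx ler01.
by rewrite expr0 invr1 mul1r expR_ge0/= -expR0 ler_expR oppr_le0 invr_ge0 ltW.
Qed.

(** As [n] grows, these bumps supported in [[a, b]] increase to the indicator
    function of the open interval. *)
Definition plateau (n : nat) (a b x : R) : R :=
  flat 0 (n.+1%:R * x + - (n.+1%:R * a)) * flat 0 (- n.+1%:R * x + n.+1%:R * b).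

Lemma plateau_out n a b x : ~~ (a < x < b) -> plateau n a b x = 0.
Proof.
rewrite negb_and -!leNgt => /orP[xa|bx]; rewrite /plateau.
  rewrite [X in X * _](_ : _ = 0) ?mul0r// /flat ifF//; apply/negbTE; rewrite -leNgt.
  by rewrite -mulrBr mulr_ge0_le0// subr_le0.
rewrite [X in _ * X](_ : _ = 0) ?mulr0// /flat ifF//; apply/negbTE; rewrite -leNgt.
by rewrite mulNr addrC -mulrBr mulr_ge0_le0// subr_le0.
Qed.

Lemma plateau_bump n a b : bump (plateau n a b).
Proof.
split; first by apply: smooth_mul; apply: smooth_aff; exact: smooth_flat.
exists (Num.max `|a| `|b|) => x; rewrite gt_max => /andP[xa xb].
apply: plateau_out; rewrite negb_and -!leNgt; have [x0|x0] := leP 0 x; apply/orP; [right|left].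
  by have := ler_norm b; rewrite (ger0_norm x0) in xb; lra.
by have := ler_norm (- a); rewrite normrN; rewrite (ltr0_norm x0) in xa; lra.
Qed.

Lemma plateau_bound n a b x : 0 <= plateau n a b x <= 1.
Proof.
have /andP[h1 h2] := flat0_bound (n.+1%:R * x + - (n.+1%:R * a)).
have /andP[h3 h4] := flat0_bound (- n.+1%:R * x + n.+1%:R * b).
by rewrite /plateau mulr_ge0//= mulr_ile1.
Qed.

Lemma flat0_cvg (c : R) : 0 < c -> flat 0 (n.+1%:R * c) @[n --> \oo] --> (1 : R).
Proof.
move=> c0.
rewrite (_ : (fun n : nat => _) = (fun n => expR (- (c^-1 * harmonic n)))); last first.
  apply/funext => n; rewrite /flat pmulr_rgt0// c0 expr0 invr1 mul1r.
  by rewrite invfM mulrC.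
rewrite -(expR0 R) -oppr0 -[in X in _ --> X](mulr0 c^-1).
apply: continuous_cvg; first exact: continuous_expR.
apply: cvgN; apply: cvgMr; exact: cvg_harmonic.
Qed.

Lemma plateau_cvg a b x : a < x < b -> plateau n a b x @[n --> \oo] --> (1 : R).
Proof.
move=> /andP[ax xb]; rewrite -[in X in _ --> X](mulr1 1).
rewrite (_ : (fun n : nat => _) = (fun n => flat 0 (n.+1%:R * (x - a)) * flat 0 (n.+1%:R * (b - x)))).
  by apply: cvgM; apply: flat0_cvg; rewrite subr_gt0.
by apply/funext => n; rewrite /plateau mulNr (addrC (- _)) -!mulrBr.
Qed.

(** By dominated convergence along plateau functions, the integrals of [g]
    over all rectangles vanish. *)
Lemma fundamental_lemma g : locint g ->
  (forall f q, bump f -> bump q -> \int[mu2]_x (g x * (f x.1 * q x.2)) = 0) ->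
  {ae mu2, forall x, g x = 0}.
Proof.
move=> gl g0; have [mg gint] := gl.
have rsub a b c d : rect a b c d `<=` sup_ball (`|a| + `|b| + `|c| + `|d|).
  move=> x; rewrite /rect /sup_ball /= !in_itv/= => -[/andP[x1 x2] /andP[x3 x4]].
  have := ler_norm (- a); have := ler_norm b; have := ler_norm (- c); have := ler_norm d.
  rewrite !normrN => h1 h2 h3 h4.
  have := normr_ge0 a; have := normr_ge0 b; have := normr_ge0 c; have := normr_ge0 d.
  move=> p1 p2 p3 p4.
  by rewrite prod_normE ge_max; apply/andP; split; rewrite ler_norml; apply/andP; split; lra.
have rint a b c d : mu2.-integrable (rect a b c d) (EFin \o g).
  by apply: (integrableS _ _ (@rsub a b c d) (gint _));
    [exact: measurable_sup_ball|exact: measurable_rect].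
apply: zero_on_rectangles => // a b c d.
pose phi n (x : R * R) := plateau n a b x.1 * plateau n c d x.2.
have bphi n : bumps (phi n) by apply: bumps_mul; exact: plateau_bump.
have phi1 n x : `|phi n x| <= 1.
  have /andP[h1 h2] := plateau_bound n a b x.1; have /andP[h3 h4] := plateau_bound n c d x.2.
  by rewrite /phi normrM !ger0_norm// mulr_ile1.
have int0 n : (\int[mu2]_(x in rect a b c d) (g x * phi n x)%:E = 0)%E.
  rewrite integral_mkcond.
  rewrite (_ : _ \_ _ = (fun x => (g x * phi n x)%:E)); last first.
    apply/funext => x; rewrite patchE; case: ifPn => // xr; apply/esym.
    suff -> : phi n x = 0 by rewrite mulr0.
    move: xr; rewrite notin_setE /rect /= !in_itv/= /phi => /not_andP[] /negP h.
      by rewrite plateau_out// mul0r.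
    by rewrite (plateau_out n h) mulr0.
  rewrite -[LHS]fineK; first by rewrite -[fine _]/(\int[mu2]_x (g x * phi n x)) g0//;
    exact: plateau_bump.
  by apply: integrable_fin_num => //; exact: bumps_integrable gl (bphi n).
have cv : (\int[mu2]_(x in rect a b c d) (g x * phi n x)%:E)%E @[n --> \oo] -->
    (\int[mu2]_(x in rect a b c d) (g x)%:E)%E.
  apply: (@dominated_cvg _ _ _ _ _ (measurable_rect a b c d) _ _ (fun x => `|g x|%:E)).
  - move=> n; apply/measurable_EFinP; apply: measurable_funTS; apply: measurable_funM => //.
    exact: bumps_measurable.
  - move=> x; rewrite /rect /= !in_itv/= => -[x1 x2].
    apply: cvg_EFin; first by near=> n.
    rewrite -[X in _ --> X]mulr1 -[in X in _ --> X](mulr1 1); apply: cvgM; first exact: cvg_cst.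
    by apply: cvgM; exact: plateau_cvg.
  - by [].
  - have := integrable_abse (rint a b c d); by [].
  - move=> n x _; rewrite lee_fin normrM ler_piMr//.
rewrite -(cvg_lim _ cv)//.
rewrite (_ : (fun n => _) = cst 0%E) ?lim_cst//; apply/funext => n; exact: int0.
Unshelve. all: by end_near.
Qed.

End Bumps.

(** * Weak derivatives *)

Section WeakDerivatives.
Context {R : realType}.
Local Notation mu2 := (lebesgue2 R).
Local Notation T2 := (measurableTypeR R * measurableTypeR R)%type.

Implicit Types (g U G b : R * R -> R) (h e : R * R).

Lemma eq_RintegralT (f g : R * R -> R) : f =1 g -> \int[mu2]_x f x = \int[mu2]_x g x.
Proof. by move=> /funext ->. Qed.

Lemma locint_shift g h : locint g -> locint (fun x => g (x.1 + h.1, x.2 + h.2)).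
Proof.
move=> [mg gint]; have mgh : measurable_fun setT ((fun x => g (x.1 + h.1, x.2 + h.2)) : T2 -> R).
  exact: (measurableT_comp mg (measurable_shift2 h)).
split=> // r; apply/integrableP; split.
  by apply/measurable_EFinP; exact: measurable_funTS.
pose F (x : T2) : \bar R := ((fun y : T2 => `|g y|%:E) \_ (sup_ball (r + `|h|))) x.
have mF : measurable_fun setT F.
  apply/(measurable_restrictT _ (measurable_sup_ball _)); apply: measurable_funTS.
  by apply/measurable_EFinP; exact: measurableT_comp.
have F0 x : (0 <= F x)%E by rewrite /F patchE; case: ifPn.
have intF : (\int[mu2]_x F x < +oo)%E.
  by rewrite -integral_mkcond; have /integrableP[_] := gint (r + `|h|).
apply: le_lt_trans intF; rewrite -(ge0_integral_shift h mF F0) integral_mkcond.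
apply: ge0_le_integral => //.
- by move=> x _; rewrite patchE; case: ifPn.
- apply/(measurable_restrictT _ (measurable_sup_ball _)); apply: measurable_funTS.
  by apply/measurable_EFinP; exact: measurableT_comp.
- exact: (measurableT_comp mF (measurable_shift2 h)).
- move=> x _; rewrite patchE; case: ifPn => [xr|_]; last exact: F0.
  rewrite /F patchE ifT//; move: xr; rewrite !inE /sup_ball /= => xr.
  have -> : shift2 h x = (x : R * R) + h by [].
  by rewrite (le_trans (ler_normD _ _))// lerD2r.
Qed.

Lemma locintD g g' : locint g -> locint g' -> locint (fun x => g x + g' x).
Proof.
move=> [mg ig] [mg' ig']; split; first exact: measurable_funD.
by move=> r; exact: (integrableD (measurable_sup_ball r) (ig r) (ig' r)).
Qed.

Lemma locint_bounded_mul g b : locint g -> measurable_fun setT (b : T2 -> R) ->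
  (forall x, `|b x| <= 1) -> locint (fun x => b x * g x).
Proof.
move=> [mg ig] mb b1; split; first exact: measurable_funM.
move=> r; apply: (@le_integrable _ _ _ _ _ (measurable_sup_ball r) _ (EFin \o g)) => //.
  by apply/measurable_EFinP; apply: measurable_funTS; exact: measurable_funM.
by move=> x _; rewrite /= lee_fin normrM ler_piMl.
Qed.

Lemma locintZ g c : locint g -> locint (fun x => c * g x).
Proof.
move=> [mg ig]; split; first exact: measurable_funM.
by move=> r; have := integrableZl (measurable_sup_ball r) c (ig r).
Qed.

Lemma is_derive_shift1 (f f' : R -> R) (h : R) :
  (forall x, is_derive (x : R) (1 : R) f (f' x)) ->
  forall x, is_derive (x : R) (1 : R) (fun y => f (y + h)) (f' (x + h)).
Proof.
move=> df x; have d1 : is_derive x (1 : R) (fun y : R => y + h) 1.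
  apply: is_derive_eq (is_deriveD (is_derive_id x (1 : R)) (is_derive_cst h x (1 : R))) _.
  by rewrite addr0.
rewrite -(mulr1 (f' _)).
exact: (@is_derive1_comp R f (fun y => y + h) x _ _ (df (x + h)) d1).
Qed.

Lemma bumps_is_derive (f f' q q' : R -> R) (x v : R * R) :
  (forall x, is_derive (x : R) (1 : R) f (f' x)) ->
  (forall x, is_derive (x : R) (1 : R) q (q' x)) ->
  is_derive x v (fun x => f x.1 * q x.2) (f x.1 * (v.2 * q' x.2) + (v.1 * f' x.1) * q x.2).
Proof.
move=> df dq; have [_ a] := coord_is_derive false x v df.
have [_ b] := coord_is_derive true x v dq.
apply: is_derive_eq (is_deriveM a b) _.
by rewrite /GRing.scale /= (mulrC (v.1 * _)).
Qed.

Lemma bumps_mul_deriv (f f' q q' : R -> R) (v : R * R) :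
  bump f -> bump f' -> bump q -> bump q' ->
  bumps (fun x => f x.1 * (v.2 * q' x.2) + (v.1 * f' x.1) * q x.2).
Proof.
move=> bf bf' bq bq'; apply: bumps_add; first exact: (bumps_mul bf (bump_scale v.2 bq')).
exact: (bumps_mul (bump_scale v.1 bf') bq).
Qed.

(** Derivatives [F'] of test functions are given as data, so that explicit
    formulas for them can be used. *)
Definition weak_deriv (e : R * R) (U G : R * R -> R) := forall F F', bumps F -> bumps F' ->
  (forall x, is_derive x e F (F' x)) ->
  \int[mu2]_x (U x * F' x) = - \int[mu2]_x (G x * F x).

Lemma shift_pairing g F h : locint g -> bumps (fun x => F (x.1 - h.1, x.2 - h.2)) ->
  \int[mu2]_x (g x * F (x.1 - h.1, x.2 - h.2)) =
  \int[mu2]_x (g (x.1 + h.1, x.2 + h.2) * F x).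
Proof.
move=> gl bF; rewrite -(Rintegral_shift h (bumps_integrable gl bF)).
by apply: eq_Rintegral => x _; rewrite /= !addrK -surjective_pairing.
Qed.

(** Moving the translation to the test function shows that [G] and its
    translate have the same pairing with all bumps. *)
Lemma weak_deriv_periodic e U G h : locint U -> locint G ->
  (forall x, U (x.1 + h.1, x.2 + h.2) = U x) -> weak_deriv e U G ->
  {ae mu2, forall x, G (x.1 + h.1, x.2 + h.2) = G x}.
Proof.
move=> lU lG Uh wU.
have lGh := locint_shift h lG.
have : {ae mu2, forall x, G (x.1 + h.1, x.2 + h.2) + -1 * G x = 0}.
  apply: fundamental_lemma; first by apply: locintD => //; exact: locintZ.
  move=> f q bf bq; have bF := bumps_mul bf bq.
  rewrite (eq_RintegralT (g := fun x => G (x.1 + h.1, x.2 + h.2) * (f x.1 * q x.2) + -1 * (G x *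
    (f x.1 * q x.2)))); last first.
    by move=> x /=; ring.
  have iG := bumps_integrable lG bF; have iGh := bumps_integrable lGh bF.
  rewrite RintegralD//; last by have := integrableZl measurableT (-1) iG.
  rewrite RintegralZl// mulN1r.
  have [f' bf' df] := bump_deriv bf; have [q' bq' dq] := bump_deriv bq.
  have bfh := bump_shift (- h.1) bf; have bqh := bump_shift (- h.2) bq.
  have bfh' := bump_shift (- h.1) bf'; have bqh' := bump_shift (- h.2) bq'.
  pose F (x : R * R) := f x.1 * q x.2.
  pose F' (x : R * R) := f x.1 * (e.2 * q' x.2) + (e.1 * f' x.1) * q x.2.
  have bF' : bumps F' by exact: bumps_mul_deriv.
  have dF x : is_derive x e F (F' x) by exact: bumps_is_derive.
  have bFh : bumps (fun x => F (x.1 - h.1, x.2 - h.2)) by exact: (bumps_mul bfh bqh).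
  have bFh' : bumps (fun x => F' (x.1 - h.1, x.2 - h.2))
    by exact: (bumps_mul_deriv e bfh bfh' bqh bqh').
  have dFh x : is_derive x e (fun x => F (x.1 - h.1, x.2 - h.2)) (F' (x.1 - h.1, x.2 - h.2)).
    exact: (bumps_is_derive x e (is_derive_shift1 (- h.1) df) (is_derive_shift1 (- h.2) dq)).
  have w1 := wU _ _ bF bF' dF; have w2 := wU _ _ bFh bFh' dFh.
  rewrite !shift_pairing// in w2.
  have e1 : \int[mu2]_x (U (x.1 + h.1, x.2 + h.2) * F' x) = \int[mu2]_x (U x * F' x).
    by apply: eq_RintegralT => x; rewrite Uh.
  by move: w2; rewrite e1 w1 => /oppr_inj ->; rewrite subrr.
apply: negligibleS => x /= h1 h2; apply: h1; apply/eqP.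
by rewrite -subr_eq0 -mulN1r; apply/eqP.
Qed.

End WeakDerivatives.

(** * Plane waves *)

Section Rotation.
Context {R : realType}.
Local Notation mu2 := (lebesgue2 R).
Local Notation T2 := (measurableTypeR R * measurableTypeR R)%type.
Implicit Types (g U V W F G b : R * R -> R) (h e k : R * R).

Lemma RintegralD_bumps g F G (c : R) : locint g -> bumps F -> bumps G ->
  \int[mu2]_x (g x * (F x + c * G x)) =
  \int[mu2]_x (g x * F x) + c * \int[mu2]_x (g x * G x).
Proof.
move=> lg bF bG; have iF := bumps_integrable lg bF; have iG := bumps_integrable lg bG.
rewrite (eq_RintegralT (g := fun x => g x * F x + c * (g x * G x))); last by move=> x /=; ring.
rewrite RintegralD//; last by have := integrableZl measurableT c iG.
by rewrite RintegralZl.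
Qed.

Lemma RintegralD_locint g g' F (c : R) : locint g -> locint g' -> bumps F ->
  \int[mu2]_x ((g x + c * g' x) * F x) =
  \int[mu2]_x (g x * F x) + c * \int[mu2]_x (g' x * F x).
Proof.
move=> lg lg' bF; have iF := bumps_integrable lg bF; have iG := bumps_integrable lg' bF.
rewrite (eq_RintegralT (g := fun x => g x * F x + c * (g' x * F x))); last by move=> x /=; ring.
rewrite RintegralD//; last by have := integrableZl measurableT c iG.
by rewrite RintegralZl.
Qed.

Lemma outer_is_derive (f : R -> R) (p : R * R -> R) (d dv : R) (x v : R * R) :
  differentiable p x -> is_derive x v p dv -> is_derive (p x) (1 : R) f d ->
  is_derive x v (fun y => f (p y)) (dv * d).
Proof.
move=> dp [_ pv] [df fd]; have dfx : differentiable f (p x) by apply/derivable1_diffP.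
have dfp : differentiable (f \o p) x by exact: differentiable_comp.
apply: DeriveDef; first exact: diff_derivable.
by rewrite (deriveE _ dfp) (diff_comp dp dfx) [LHS]/= -(deriveE _ dp) pv (diff1E dfx) derive1E fd.
Qed.

Lemma dot_is_derive k (x v : R * R) : differentiable (dot k) x /\ is_derive x v (dot k) (dot k v).
Proof.
have d1 (c y : R) : is_derive (y : R) (1 : R) (fun z : R => c * z) c.
  by apply: is_derive_eq (is_deriveZ c (is_derive_id y (1 : R))) _; rewrite /GRing.scale /= mulr1.
have [a1 a2] := coord_is_derive false x v (d1 k.1).
have [b1 b2] := coord_is_derive true x v (d1 k.2).
split; first exact: (differentiableD a1 b1).
apply: is_derive_eq (is_deriveD a2 b2) _.
by rewrite /dot mulrC (mulrC v.2).
Qed.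

Lemma cos_dot_is_derive k (x v : R * R) :
  is_derive x v (fun y => cos (dot k y)) (- (dot k v * sin (dot k x))).
Proof.
have [a b] := dot_is_derive k x v.
by apply: is_derive_eq (outer_is_derive a b (is_derive_cos _)) _; rewrite mulrN.
Qed.

Lemma sin_dot_is_derive k (x v : R * R) :
  is_derive x v (fun y => sin (dot k y)) (dot k v * cos (dot k x)).
Proof. by have [a b] := dot_is_derive k x v; exact: (outer_is_derive a b (is_derive_sin _)). Qed.

Lemma smooth_cos_mul (c : R) : smooth (fun x => cos (c * x)).
Proof.
rewrite (_ : (fun x => _) = (fun x => cos (c * x + 0))); first exact: (smooth_aff _ _ (smooth_cos)).
by apply/funext => x; rewrite addr0.
Qed.

Lemma smooth_sin_mul (c : R) : smooth (fun x => sin (c * x)).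
Proof.
rewrite (_ : (fun x => _) = (fun x => sin (c * x + 0))); first exact: (smooth_aff _ _ (smooth_sin)).
by apply/funext => x; rewrite addr0.
Qed.

Lemma bumps_cos k F : bumps F -> bumps (fun x => cos (dot k x) * F x).
Proof.
elim=> {F} [f q bf bq|F G _ bF _ bG]; last first.
  rewrite (_ : (fun x => _) = (fun x => cos (dot k x) * F x + cos (dot k x) * G x)).
    exact: bumps_add.
  by apply/funext => x; rewrite mulrDr.
have h1 := bumps_mul (bump_mul bf (smooth_cos_mul k.1)) (bump_mul bq (smooth_cos_mul k.2)).
have h2 := bumps_mul (bump_scale (-1) (bump_mul bf (smooth_sin_mul k.1))) (bump_mul bq
  (smooth_sin_mul k.2)).
have := bumps_add h1 h2; congr bumps; apply/funext => x.
by rewrite /dot cosD /=; ring.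
Qed.

Lemma bumps_sin k F : bumps F -> bumps (fun x => sin (dot k x) * F x).
Proof.
elim=> {F} [f q bf bq|F G _ bF _ bG]; last first.
  rewrite (_ : (fun x => _) = (fun x => sin (dot k x) * F x + sin (dot k x) * G x)).
    exact: bumps_add.
  by apply/funext => x; rewrite mulrDr.
have h1 := bumps_mul (bump_mul bf (smooth_sin_mul k.1)) (bump_mul bq (smooth_cos_mul k.2)).
have h2 := bumps_mul (bump_mul bf (smooth_cos_mul k.1)) (bump_mul bq (smooth_sin_mul k.2)).
have := bumps_add h1 h2; congr bumps; apply/funext => x.
by rewrite /dot sinD /=; ring.
Qed.

Lemma bumps_scale (c : R) F : bumps F -> bumps (fun x => c * F x).
Proof.
elim=> {F} [f q bf bq|F G _ bF _ bG].
  have := bumps_mul (bump_scale c bf) bq; congr bumps; apply/funext => x; by rewrite mulrA.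
have := bumps_add bF bG; congr bumps; apply/funext => x; by rewrite mulrDr.
Qed.

(** Weak form of [W' = - i kap W] in the direction [e], for [W = U + i V]. *)
Definition wave_equation e (kap : R) U V := forall F F', bumps F -> bumps F' ->
  (forall x, is_derive x e F (F' x)) ->
  \int[mu2]_x (U x * F' x) = - kap * \int[mu2]_x (V x * F x) /\
  \int[mu2]_x (V x * F' x) = kap * \int[mu2]_x (U x * F x).

Definition null_derivative e W := forall F F', bumps F -> bumps F' ->
  (forall x, is_derive x e F (F' x)) -> \int[mu2]_x (W x * F' x) = 0.

(** Real part of [e^(i k.x) (U + i V)]; [rotIm] is the imaginary part. *)
Definition rotRe k U V (x : R * R) : R := cos (dot k x) * U x + -1 * (sin (dot k x) * V x).
Definition rotIm k U V (x : R * R) : R := sin (dot k x) * U x + 1 * (cos (dot k x) * V x).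

Lemma measurable_dot_comp k (f : R -> R) : smooth f ->
  measurable_fun setT ((fun x => f (dot k x)) : T2 -> R).
Proof.
move=> Sf; apply: (measurableT_comp (smooth_measurable Sf)).
by apply: measurable_funD; apply: measurable_funM => //.
Qed.

Lemma locint_cos k g : locint g -> locint (fun x => cos (dot k x) * g x).
Proof.
move=> lg; apply: locint_bounded_mul => //; first exact: (measurable_dot_comp k smooth_cos).
by move=> x; rewrite ler_norml cos_geN1 cos_le1.
Qed.

Lemma locint_sin k g : locint g -> locint (fun x => sin (dot k x) * g x).
Proof.
move=> lg; apply: locint_bounded_mul => //; first exact: (measurable_dot_comp k smooth_sin).
by move=> x; rewrite ler_norml sin_geN1 sin_le1.
Qed.

(** Use [cos (k.x) F] and [sin (k.x) F] as test functions in the wave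
    equation: the derivative of the phase cancels its right-hand side. *)
Lemma rot_null_derivative k e U V : locint U -> locint V -> wave_equation e (dot k e) U V ->
  null_derivative e (rotRe k U V) /\ null_derivative e (rotIm k U V).
Proof.
move=> lU lV eqUV; set kap := dot k e in eqUV.
have lcU := locint_cos k lU; have lsU := locint_sin k lU.
have lcV := locint_cos k lV; have lsV := locint_sin k lV.
have key F F' : bumps F -> bumps F' -> (forall x, is_derive x e F (F' x)) ->
  [/\ \int[mu2]_x (U x * (cos (dot k x) * F' x)) + - kap * \int[mu2]_x (U x * (sin (dot k x) * F x))
        = - kap * \int[mu2]_x (V x * (cos (dot k x) * F x)),
      \int[mu2]_x (V x * (cos (dot k x) * F' x)) + - kap * \int[mu2]_x (V x * (sin (dot k x) * F x))
        = kap * \int[mu2]_x (U x * (cos (dot k x) * F x)),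
      \int[mu2]_x (U x * (sin (dot k x) * F' x)) + kap * \int[mu2]_x (U x * (cos (dot k x) * F x))
        = - kap * \int[mu2]_x (V x * (sin (dot k x) * F x)) &
      \int[mu2]_x (V x * (sin (dot k x) * F' x)) + kap * \int[mu2]_x (V x * (cos (dot k x) * F x))
        = kap * \int[mu2]_x (U x * (sin (dot k x) * F x))].
  move=> bF bF' dF.
  have bc := bumps_cos k bF; have bs := bumps_sin k bF.
  have bc' := bumps_cos k bF'; have bs' := bumps_sin k bF'.
  have b1 := bumps_add bc' (bumps_scale (- kap) bs).
  have b2 := bumps_add bs' (bumps_scale kap bc).
  have [|h1 h2] := eqUV _ _ bc b1.
    move=> x; apply: is_derive_eq (is_deriveM (cos_dot_is_derive k x e) (dF x)) _.
    by rewrite /GRing.scale /= -/kap; ring.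
  have [|h3 h4] := eqUV _ _ bs b2.
    move=> x; apply: is_derive_eq (is_deriveM (sin_dot_is_derive k x e) (dF x)) _.
    by rewrite /GRing.scale /= -/kap; ring.
  by split; [rewrite -h1|rewrite -h2|rewrite -h3|rewrite -h4]; rewrite RintegralD_bumps.
split=> F F' bF bF' dF; have [h1 h2 h3 h4] := key F F' bF bF' dF; rewrite RintegralD_locint//.
  rewrite (eq_RintegralT (g := fun x => U x * (cos (dot k x) * F' x))); last by move=> x /=; ring.
  rewrite [X in _ + _ * X](eq_RintegralT (g := fun x => V x * (sin (dot k x) * F' x)));
    last by move=> x /=; ring.
  lra.
rewrite (eq_RintegralT (g := fun x => U x * (sin (dot k x) * F' x))); last by move=> x /=; ring.
rewrite [X in _ + _ * X](eq_RintegralT (g := fun x => V x * (cos (dot k x) * F' x)));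
  last by move=> x /=; ring.
lra.
Qed.

(** The integral of a difference of two translates is zero, so its primitive
    vanishes outside a compact set. *)
Lemma bump_primitive_diff (f : R -> R) (h : R) : bump f ->
  exists2 P, bump P & forall x, is_derive (x : R) (1 : R) P (f (x + h) + -1 * f x).
Proof.
move=> [Sf [r f0]]; have [P SP dP] := smooth_primitive Sf f0.
exists (fun x => P (x + h) + -1 * P x); last first.
  move=> x; apply: is_derive_eq (is_deriveD (is_derive_shift1 h dP x) (is_deriveZ (-1) (dP x))) _.
  by [].
split.
  (* A translate is an affine substitution with slope one. *)
  apply: smooth_add; last exact: smooth_scale.
  rewrite (_ : (fun x => _) = (fun x => P (1 * x + h))); first exact: smooth_aff.
  by apply/funext => x; rewrite mul1r.
exists (r + `|h|) => x xr; rewrite mulN1r; apply/eqP; rewrite subr_eq0; apply/eqP.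
have Pc : continuous P := smooth_continuous SP.
have cst (a b : R) : a <= b -> (forall y, a <= y <= b -> f y = 0) -> P b = P a.
  move=> ab fz; have [|c cI] := @MVT_segment R P f a b ab (fun y _ => dP y).
    exact: continuous_subspaceT.
  by move: cI; rewrite in_itv/= => /fz ->; rewrite mul0r => /eqP; rewrite subr_eq0 => /eqP.
have fz y : `|y - x| <= `|h| -> f y = 0.
  by move=> yx; apply: f0; have := lerB_dist x y; rewrite distrC; lra.
have [h0|h0] := leP 0 h.
  apply: cst; first by rewrite lerDl.
  by move=> y /andP[? ?]; apply: fz; rewrite !ger0_norm; lra.
apply/esym; apply: cst; first by rewrite gerDl ltW.
by move=> y /andP[? ?]; apply: fz; rewrite (ltr0_norm h0) ler0_norm; lra.
Qed.

(** The difference of the two test functions is the derivative of a test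
    function. *)
Lemma null_derivative_invariant1 W (f q : R -> R) (h : R) : locint W ->
  null_derivative (1, 0) W -> bump f -> bump q ->
  \int[mu2]_x (W x * (f (x.1 + h) * q x.2)) = \int[mu2]_x (W x * (f x.1 * q x.2)).
Proof.
move=> lW nW bf bq; have [P bP dP] := bump_primitive_diff h bf.
have [q' bq' dq] := bump_deriv bq.
have b1 := bumps_mul (bump_shift h bf) bq; have b2 := bumps_mul bf bq.
have := nW _ _ (bumps_mul bP bq) (bumps_add b1 (bumps_scale (-1) b2)).
rewrite RintegralD_bumps// => e; apply/eqP; rewrite -subr_eq0 -mulN1r; apply/eqP; apply: e => x.
apply: is_derive_eq (bumps_is_derive x (1, 0) dP dq) _.
by rewrite /=; ring.
Qed.

Lemma null_derivative_invariant2 W (f q : R -> R) (h : R) : locint W ->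
  null_derivative (0, 1) W -> bump f -> bump q ->
  \int[mu2]_x (W x * (f x.1 * q (x.2 + h))) = \int[mu2]_x (W x * (f x.1 * q x.2)).
Proof.
move=> lW nW bf bq; have [P bP dP] := bump_primitive_diff h bq.
have [f' bf' df] := bump_deriv bf.
have b1 := bumps_mul bf (bump_shift h bq); have b2 := bumps_mul bf bq.
have := nW _ _ (bumps_mul bf bP) (bumps_add b1 (bumps_scale (-1) b2)).
rewrite RintegralD_bumps// => e; apply/eqP; rewrite -subr_eq0 -mulN1r; apply/eqP; apply: e => x.
apply: is_derive_eq (bumps_is_derive x (0, 1) df dP) _.
by rewrite /=; ring.
Qed.

Lemma null_gradient_invariant W (f q : R -> R) h : locint W ->
  null_derivative (1, 0) W -> null_derivative (0, 1) W -> bump f -> bump q ->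
  \int[mu2]_x (W (x.1 + h.1, x.2 + h.2) * (f x.1 * q x.2)) = \int[mu2]_x (W x * (f x.1 * q x.2)).
Proof.
move=> lW n1 n2 bf bq.
have bfh := bump_shift (- h.1) bf; have bqh := bump_shift (- h.2) bq.
have := @shift_pairing R W (fun x => f x.1 * q x.2) h lW (bumps_mul bfh bqh) => <- /=.
rewrite (null_derivative_invariant1 (f := f) (q := fun y => q (y - h.2)) (- h.1) lW n1 bf bqh).
exact: null_derivative_invariant2.
Qed.

(** The function [W = e^(i k.x) (U + i V)] has zero gradient, so its pairings
    with bumps are invariant under translation; but a translation by [h]
    multiplies [W] by [e^(i k.h)]. Unless this factor is 1, all the pairings
    vanish and [W] is zero. *)
Lemma wave_lattice k h U V : locint U -> locint V ->
  (forall x, U (x.1 + h.1, x.2 + h.2) = U x) -> (forall x, V (x.1 + h.1, x.2 + h.2) = V x) ->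
  wave_equation (1, 0) k.1 U V -> wave_equation (0, 1) k.2 U V ->
  ~ {ae mu2, forall x, U x = 0 /\ V x = 0} -> cos (dot k h) = 1.
Proof.
move=> lU lV Uh Vh w1 w2 n0; apply: contrapT => cn1; apply: n0.
have k1 : dot k (1, 0) = k.1 by rewrite /dot /= mulr1 mulr0 addr0.
have k2 : dot k (0, 1) = k.2 by rewrite /dot /= mulr1 mulr0 add0r.
rewrite -k1 in w1; rewrite -k2 in w2.
have [r1 i1] := rot_null_derivative lU lV w1; have [r2 i2] := rot_null_derivative lU lV w2.
set W1 := rotRe k U V in r1 r2; set W2 := rotIm k U V in i1 i2.
have lW1 : locint W1.
  by apply: locintD; [exact: locint_cos|apply: locintZ; exact: locint_sin].
have lW2 : locint W2.
  by apply: locintD; [exact: locint_sin|apply: locintZ; exact: locint_cos].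
set c := cos (dot k h) in cn1; pose s := sin (dot k h).
have dotD x : dot k (x.1 + h.1, x.2 + h.2) = dot k x + dot k h by rewrite /dot /=; ring.
have W1h x : W1 (x.1 + h.1, x.2 + h.2) = c * W1 x + - s * W2 x.
  by rewrite /W1 /W2 /rotRe /rotIm dotD Uh Vh cosD sinD -/c -/s; ring.
have W2h x : W2 (x.1 + h.1, x.2 + h.2) = s * W1 x + c * W2 x.
  by rewrite /W1 /W2 /rotRe /rotIm dotD Uh Vh cosD sinD -/c -/s; ring.
have AB f q : bump f -> bump q -> \int[mu2]_x (W1 x * (f x.1 * q x.2)) = 0 /\
    \int[mu2]_x (W2 x * (f x.1 * q x.2)) = 0.
  move=> bf bq; have bF := bumps_mul bf bq.
  have e1 := null_gradient_invariant h lW1 r1 r2 bf bq.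
  have e2 := null_gradient_invariant h lW2 i1 i2 bf bq.
  have Z (g : R * R -> R) (z : R) : locint g -> \int[mu2]_x (z * g x * (f x.1 * q x.2)) =
      z * \int[mu2]_x (g x * (f x.1 * q x.2)).
    move=> lg; rewrite -RintegralZl//; last exact: bumps_integrable lg bF.
    by apply: eq_RintegralT => x /=; ring.
  rewrite (eq_RintegralT (g := fun x => (c * W1 x + - s * W2 x) * (f x.1 * q x.2))) in e1; last first.
    by move=> x; rewrite W1h.
  rewrite (eq_RintegralT (g := fun x => (s * W1 x + c * W2 x) * (f x.1 * q x.2))) in e2; last first.
    by move=> x; rewrite W2h.
  rewrite RintegralD_locint// ?Z// in e1; last exact: locintZ.
  rewrite RintegralD_locint// ?Z// in e2; last exact: locintZ.
  move: e1 e2; set A := Rintegral _ _ _; set B := Rintegral _ _ _ => e1 e2.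
  (* The determinant of the system for the two pairings is [|e^(i k.h) -
     1|^2]. *)
  have d0 : (c - 1) ^+ 2 + s ^+ 2 != 0.
    rewrite paddr_eq0 ?sqr_ge0// !sqrf_eq0 subr_eq0 negb_and; apply/orP; left.
    exact/eqP.
  have h1 : (c - 1) * A = s * B by lra.
  have h2 : (c - 1) * B = - s * A by lra.
  have eA : ((c - 1) ^+ 2 + s ^+ 2) * A = 0.
    rewrite mulrDl (expr2 (c - 1)) -mulrA h1 mulrCA h2; ring.
  have eB : ((c - 1) ^+ 2 + s ^+ 2) * B = 0.
    rewrite mulrDl (expr2 (c - 1)) -mulrA h2 mulrCA h1; ring.
  split; first by move/eqP: eA; rewrite mulf_eq0 (negbTE d0)/= => /eqP.
  by move/eqP: eB; rewrite mulf_eq0 (negbTE d0)/= => /eqP.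
have a1 : {ae mu2, forall x, W1 x = 0} by apply: fundamental_lemma => // f q bf bq;
  have [] := AB f q bf bq.
have a2 : {ae mu2, forall x, W2 x = 0} by apply: fundamental_lemma => // f q bf bq;
  have [] := AB f q bf bq.
apply: negligibleS (negligibleU a1 a2) => x /= nx;
  apply: contrapT => /not_orP[/contrapT z1 /contrapT z2].
apply: nx; have cs := cos2Dsin2 (dot k x).
have uE : U x = cos (dot k x) * W1 x + sin (dot k x) * W2 x.
  transitivity ((cos (dot k x) ^+ 2 + sin (dot k x) ^+ 2) * U x); first by rewrite cs mul1r.
  by rewrite /W1 /W2 /rotRe /rotIm; ring.
have vE : V x = - sin (dot k x) * W1 x + cos (dot k x) * W2 x.
  transitivity ((cos (dot k x) ^+ 2 + sin (dot k x) ^+ 2) * V x); first by rewrite cs mul1r.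
  by rewrite /W1 /W2 /rotRe /rotIm; ring.
by rewrite uE vE z1 z2 !mulr0 addr0.
Qed.

End Rotation.

(** * Real and imaginary parts of weak derivatives *)

Section ZeroEnergy.
Context {R : realType}.
Local Notation mu2 := (lebesgue2 R).
Local Notation T2 := (measurableTypeR R * measurableTypeR R)%type.
Implicit Types (g U V W F G b : R * R -> R) (h e k : R * R).
Local Notation Re := complex.Re.
Local Notation Im := complex.Im.

Lemma cos_eq1_int (t : R) : cos t = 1 -> exists m : int, t = 2 * pi * m%:~R.
Proof.
have pi0 := @pi_gt0 R; have p2 : 0 < 2 * pi :> R by rewrite mulr_gt0.
have per (m : int) (x : R) : cos (x + 2 * pi * m%:~R) = cos x.
  have pern (n : nat) (y : R) : cos (y + 2 * pi * n%:R) = cos y.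
    elim: n y => [|n ih] y; first by rewrite mulr0 addr0.
    have -> : y + 2 * pi * n.+1%:R = (y + 2 * pi * n%:R) + pi *+ 2.
      by rewrite -natr1 -(mulr_natl pi); ring.
    by rewrite cosD2pi.
  case: m => n; first exact: pern.
  by rewrite NegzE mulrNz mulrN -(pern n.+1 (x - _)) subrK.
move=> ct; pose m := Num.floor (t / (2 * pi)); exists m.
pose r := t - 2 * pi * m%:~R.
have cr : cos r = 1 by rewrite /r -mulrN -mulrNz per.
have /andP[m1 m2] := floor_itv (t / (2 * pi)).
have r0 : 0 <= r by rewrite subr_ge0 mulrC -ler_pdivlMr.
have r1 : r < 2 * pi.
  by rewrite ltrBlDr -{1}(mulr1 (2 * pi)) -mulrDr mulrC -ltr_pdivrMr// addrC; move: m2; rewrite intrD.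
suff : r = 0 by move/eqP; rewrite subr_eq0 => /eqP.
have cos1 (z : R) : 0 <= z <= pi -> cos z = 1 -> z = 0.
  move=> zI; rewrite -cos0 => /cos_inj; apply; rewrite in_itv//= lexx /=; exact: ltW.
have [rpi|rpi] := leP r pi; first by apply: cos1; rewrite ?r0.
exfalso; have : 2 * pi - r = 0.
  apply: cos1; first by apply/andP; split; lra.
  by have := per 1 (- r); rewrite mulr1 cosN cr addrC.
by lra.
Qed.

Lemma negligible_countable_bigcup (I : countType) (F : I -> set (R * R)) :
  (forall i, mu2.-negligible (F i)) -> mu2.-negligible [set x | exists i, F i x].
Proof.
move=> nF.
have nG : mu2.-negligible (\bigcup_n (if unpickle n is Some i then F i else set0)).
  apply: negligible_bigcup => n; case: unpickle => [i|]; first exact: nF.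
  exact: negligible_set0.
by apply: negligibleS nG => x [i Fx]; exists (pickle i); rewrite ?pickleK.
Qed.

Lemma L2loc_locint (f : R * R -> R[i]) : L2loc f ->
  locint (fun x => Re (f x)) /\ locint (fun x => Im (f x)).
Proof.
move=> [mR mI f2].
have bnd r : mu2.-integrable (sup_ball r) (fun x => (1 + (Re (f x) ^+ 2 + Im (f x) ^+ 2))%:E).
  have fin1 : (mu2 (sup_ball r) < +oo)%E.
    have I : (@lebesgue_measure R [set` `[(- r)%R, r%R]] < +oo)%E.
      by rewrite lebesgue_measure_itv; case: ifP => _ /=; rewrite -?EFinD ltry.
    rewrite sup_ballE /lebesgue2 /= product_measure1E; [|exact: measurable_itv|exact: measurable_itv].
    apply: lte_mul_pinfty; [exact: measure_ge0| |exact: I].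
    by rewrite ge0_fin_numE; [exact: I|exact: measure_ge0].
  have i1 : mu2.-integrable (sup_ball r) (cst 1%:E).
    apply/integrableP; split; first exact: measurable_cst.
    by rewrite /= integral_cst ?normr1 ?mul1e//; exact: measurable_sup_ball.
  by have := integrableD (measurable_sup_ball r) i1 (f2 r).
split; split=> // r; apply: (@le_integrable _ _ _ _ _ (measurable_sup_ball r) _ _ _ _ (bnd r)).
- by apply/measurable_EFinP; exact: measurable_funTS.
- move=> x _; rewrite /= lee_fin [leRHS]ger0_norm; last by rewrite addr_ge0// addr_ge0// sqr_ge0.
  have := sqr_ge0 (`|Re (f x)| - 1); have := sqr_ge0 (Im (f x)).
  rewrite -(real_normK (num_real (Re (f x)))); nra.
- by apply/measurable_EFinP; exact: measurable_funTS.
- move=> x _; rewrite /= lee_fin [leRHS]ger0_norm; last by rewrite addr_ge0// addr_ge0// sqr_ge0.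
  have := sqr_ge0 (`|Im (f x)| - 1); have := sqr_ge0 (Re (f x)).
  rewrite -(real_normK (num_real (Im (f x)))); nra.
Qed.

Lemma Re_mul_real (z : R[i]) (r : R) : Re (z * r%:C%C) = Re z * r.
Proof. by case: z => a b /=; rewrite mulr0 subr0. Qed.

Lemma Im_mul_real (z : R[i]) (r : R) : Im (z * r%:C%C) = Im z * r.
Proof. by case: z => a b /=; rewrite mulr0 add0r. Qed.

Lemma weak_partial_parts e (u g : R * R -> R[i]) : weak_partial e u g ->
  weak_deriv e (fun x => Re (u x)) (fun x => Re (g x)) /\
  weak_deriv e (fun x => Im (u x)) (fun x => Im (g x)).
Proof.
move=> wp; have key F F' : bumps F -> (forall x, is_derive x e F (F' x)) ->
    \int[mu2]_x (Re (u x) * F' x) = - (\int[mu2]_x (Re (g x) * F x)) /\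
    \int[mu2]_x (Im (u x) * F' x) = - (\int[mu2]_x (Im (g x) * F x)).
  move=> bF dF; have := wp F (bumps_test bF).
  move=> h; have h1 := congr1 (@complex.Re R) h; have h2 := congr1 (@complex.Im R) h.
  have dE x : 'D_e F x = F' x by have [_] := dF x.
  split.
    transitivity (\int[mu2]_x Re (u x * ('D_e F x)%:C%C)); first by apply: eq_RintegralT => x;
      rewrite Re_mul_real dE.
    by apply: etrans h1 _; congr (- _); apply: eq_RintegralT => x; rewrite Re_mul_real.
  transitivity (\int[mu2]_x Im (u x * ('D_e F x)%:C%C)); first by apply: eq_RintegralT => x;
    rewrite Im_mul_real dE.
  by apply: etrans h2 _; congr (- _); apply: eq_RintegralT => x; rewrite Im_mul_real.
by split=> F F' bF bF' dF; have [] := key F F' bF dF.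
Qed.

Lemma ae_eq_RintegralT F g g' : locint g -> locint g' -> bumps F ->
  {ae mu2, forall x, g x = g' x} ->
  \int[mu2]_x (g x * F x) = \int[mu2]_x (g' x * F x).
Proof.
move=> lg lg' bF gg'; rewrite /Rintegral; congr fine; apply: ae_eq_integral => //.
- by apply/measurable_EFinP; apply: measurable_funM; [case: lg|exact: bumps_measurable].
- by apply/measurable_EFinP; apply: measurable_funM; [case: lg'|exact: bumps_measurable].
- by apply: ae_imp gg' => x -> _.
Qed.

End ZeroEnergy.

(** * The lattice and its dual *)

Section DualLattice.
Context {R : realType}.
Local Notation T2 := (measurableTypeR R * measurableTypeR R)%type.
Variables (a1 a2 b1 b2 : R * R).
Hypothesis b_dual : dual_basis a1 a2 b1 b2.

Let det : R := a1.1 * a2.2 - a1.2 * a2.1.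

Let p2 : 2 * pi != 0 :> R.
Proof. by rewrite mulf_neq0// gt_eqF// pi_gt0. Qed.

Let det0 : det != 0.
Proof.
have [h1 h2 h3 h4] := b_dual; apply/eqP => d0.
have : det * (b1.1 * b2.2 - b1.2 * b2.1) = dot b1 a1 * dot b2 a2 - dot b1 a2 * dot b2 a1.
  by rewrite /det /dot; ring.
rewrite d0 h1 h2 h3 h4 mul0r mulr0 subr0 => /esym/eqP; rewrite mulf_eq0 orbb.
by rewrite (negbTE p2).
Qed.

Let bE : [/\ b1.1 = 2 * pi * a2.2 / det, b1.2 = - (2 * pi * a2.1) / det,
             b2.1 = - (2 * pi * a1.2) / det & b2.2 = 2 * pi * a1.1 / det].
Proof.
have [h1 h2 h3 h4] := b_dual; rewrite /dot in h1 h2 h3 h4.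
split; apply: (mulIf det0); rewrite mulfVK// /det.
- transitivity (a2.2 * (b1.1 * a1.1 + b1.2 * a1.2) - a1.2 * (b1.1 * a2.1 + b1.2 * a2.2)); first by ring.
  by rewrite h1 h2; ring.
- transitivity (a1.1 * (b1.1 * a2.1 + b1.2 * a2.2) - a2.1 * (b1.1 * a1.1 + b1.2 * a1.2)); first by ring.
  by rewrite h1 h2; ring.
- transitivity (a2.2 * (b2.1 * a1.1 + b2.2 * a1.2) - a1.2 * (b2.1 * a2.1 + b2.2 * a2.2)); first by ring.
  by rewrite h3 h4; ring.
transitivity (a1.1 * (b2.1 * a2.1 + b2.2 * a2.2) - a2.1 * (b2.1 * a1.1 + b2.2 * a1.2)); first by ring.
by rewrite h3 h4; ring.
Qed.

Lemma lattice_coords x :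
  x = (dot b1 x / (2 * pi)) *: a1 + (dot b2 x / (2 * pi)) *: a2.
Proof.
have [e1 e2 e3 e4] := bE; rewrite /dot e1 e2 e3 e4.
by have := det0; rewrite /det; move: (2 * pi) p2 => p p0 d0; case: x => x y; congr (_, _);
  rewrite /= /GRing.scale /=; field; rewrite p0.
Qed.

Lemma dual_coords x :
  x = (dot x a1 / (2 * pi)) *: b1 + (dot x a2 / (2 * pi)) *: b2.
Proof.
have [e1 e2 e3 e4] := bE; rewrite [b1]surjective_pairing [b2]surjective_pairing /dot e1 e2 e3 e4.
by have := det0; rewrite /det; move: (2 * pi) p2 => p p0 d0; case: x => x y; congr (_, _);
  rewrite /= /GRing.scale /=; field; rewrite p0 andbC.
Qed.

Lemma dot_lattice (s t : R) :
  dot b1 (s *: a1 + t *: a2) = 2 * pi * s /\ dot b2 (s *: a1 + t *: a2) = 2 * pi * t.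
Proof.
have [h1 h2 h3 h4] := b_dual; rewrite /dot in h1 h2 h3 h4.
split; rewrite /dot /= /GRing.scale /=.
  transitivity (s * (b1.1 * a1.1 + b1.2 * a1.2) + t * (b1.1 * a2.1 + b1.2 * a2.2)); first by ring.
  by rewrite h1 h2; ring.
transitivity (s * (b2.1 * a1.1 + b2.2 * a1.2) + t * (b2.1 * a2.1 + b2.2 * a2.2)); first by ring.
by rewrite h3 h4; ring.
Qed.

Lemma cellE (x : R * R) : cell a1 a2 x <-> 0 <= dot b1 x / (2 * pi) < 1 /\ 0 <= dot b2 x / (2 * pi) < 1.
Proof.
split=> [[s [t [hs ht ->]]]|[h1 h2]].
  by have [-> ->] := dot_lattice s t; rewrite ![2 * pi * _]mulrC !mulfK.
by do 2!eexists; split; [exact: h1|exact: h2|exact: lattice_coords].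
Qed.

Lemma measurable_cell : measurable (cell a1 a2 : set T2).
Proof.
have md b : measurable_fun setT ((fun x => dot b x / (2 * pi)) : T2 -> measurableTypeR R).
  apply: measurable_funM => //; apply: measurable_funD; apply: measurable_funM => //.
rewrite (_ : cell a1 a2 = (setT `&` (fun x : T2 => dot b1 x / (2 * pi)) @^-1` [set` `[0%R, 1%R[]) `&`
   (setT `&` (fun x : T2 => dot b2 x / (2 * pi)) @^-1` [set` `[0%R, 1%R[])).
  by apply: measurableI; apply: md => //; exact: measurable_itv.
by apply/seteqP; split=> x /=; rewrite !in_itv/= ; [move=> /cellE[? ?]|move=> [[_ ?] [_ ?]];
  apply/cellE].
Qed.

Lemma cell_sup_ball : cell a1 a2 `<=` sup_ball (`|a1| + `|a2|).
Proof.
move=> x [s [t [/andP[s0 s1] /andP[t0 t1] ->]]]; rewrite /sup_ball /=.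
apply: le_trans (ler_normD _ _) _; apply: lerD; rewrite normrZ ger0_norm// ler_piMl//; exact: ltW.
Qed.

Lemma cell_translate (x : R * R) : exists c : int * int, cell a1 a2 (x + a1 *~ c.1 + a2 *~ c.2).
Proof.
pose s := dot b1 x / (2 * pi); pose t := dot b2 x / (2 * pi).
exists (- Num.floor s, - Num.floor t) => /=.
have fl (z : R) : 0 <= z - (Num.floor z)%:~R < 1.
  by have /andP[h1 h2] := floor_itv z; rewrite subr_ge0 h1 /= ltrBlDr addrC; move: h2; rewrite intrD.
exists (s - (Num.floor s)%:~R), (t - (Num.floor t)%:~R); split; [exact: fl|exact: fl|].
have zs (v : R * R) (m : int) : v *~ - m = - (m%:~R *: v) by rewrite mulrNz scaler_int.
rewrite !zs !scalerBl; have := lattice_coords x; rewrite -/s -/t => xE; rewrite {1}xE.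
by rewrite -addrA addrACA.
Qed.

(** Countably many translates of the cell cover the plane. *)
Lemma ae_from_cell (P : R * R -> Prop) :
  {ae lebesgue2 R, forall x, cell a1 a2 x -> P x} ->
  (forall c1 c2 : int, {ae lebesgue2 R, forall x, P (x + a1 *~ c1 + a2 *~ c2) -> P x}) ->
  {ae lebesgue2 R, forall x, P x}.
Proof.
move=> cP trP.
have n1 : (lebesgue2 R).-negligible [set x | exists c : int * int,
    (~` [set x | cell a1 a2 x -> P x]) (x + a1 *~ c.1 + a2 *~ c.2)].
  apply: negligible_countable_bigcup => -[c1 c2] /=.
  have := negligible_shift (a1 *~ c1 + a2 *~ c2) cP.
  by apply: negligibleS => x; rewrite -addrA.
have n2 : (lebesgue2 R).-negligible [set x | exists c : int * int,
    ~ (P (x + a1 *~ c.1 + a2 *~ c.2) -> P x)].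
  by apply: negligible_countable_bigcup => -[c1 c2] /=; exact: trP.
apply: negligibleS (negligibleU n1 n2) => x /= nP.
have [c cx] := cell_translate x.
have [Pc|nPc] := pselect (P (x + a1 *~ c.1 + a2 *~ c.2)).
  by right; exists c => h; apply: nP; exact: h.
by left; exists c => h; apply: nPc; exact: h.
Qed.

Lemma reciprocal_of_cos (k : R * R) : cos (dot k a1) = 1 -> cos (dot k a2) = 1 ->
  exists m1 m2 : int, k = b1 *~ m1 + b2 *~ m2.
Proof.
move=> /cos_eq1_int[m1 e1] /cos_eq1_int[m2 e2]; exists m1; exists m2.
have zs (v : R * R) (m : int) : v *~ m = m%:~R *: v by rewrite scaler_int.
have := dual_coords k; rewrite e1 e2 ![2 * pi * _]mulrC !mulfK// => kE.
by rewrite !zs.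
Qed.

Lemma brillouin_reciprocal (k : R * R) : brillouin b1 b2 k ->
  (exists m1 m2 : int, k = b1 *~ m1 + b2 *~ m2) -> k = (0, 0).
Proof.
move=> Bk kL; apply/eqP/negP => /negP k0.
by have := Bk k kL k0;
  rewrite subrr /enorm [X in _ < Num.sqrt X]/dot /= mul0r addr0 sqrtr0 ltNge sqrtr_ge0.
Qed.

End DualLattice.

(** * Solutions for the eigenvalue zero *)

Section ZeroMode.
Context {R : realType}.
Local Notation mu2 := (lebesgue2 R).
Local Notation T2 := (measurableTypeR R * measurableTypeR R)%type.
Implicit Types (k : R * R) (u g : R * R -> R[i]).
Local Notation Re := complex.Re.
Local Notation Im := complex.Im.

Lemma measurable_inv :
  measurable_fun setT (GRing.inv : measurableTypeR R -> measurableTypeR R).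
Proof.
have m0 : measurable ([set 0] : set (measurableTypeR R)) by exact: measurable_set1.
rewrite -(setUv ([set 0] : set (measurableTypeR R))).
apply/(measurable_funU _ m0 (measurableC m0)); split; first exact: measurable_fun_set1.
apply: open_continuous_measurable_fun.
  by apply: closed_openC; exact: closed_eq.
by move=> x; rewrite inE => /eqP x0; exact: inv_continuous.
Qed.

Lemma measurable_alpha (a1 a2 : R * R) md eps : permittivity a1 a2 eps ->
  measurable_fun setT (alpha md eps : T2 -> measurableTypeR R).
Proof.
move=> [me _ _]; case: md; last exact: measurable_cst.
exact: (measurableT_comp measurable_inv me).
Qed.

Lemma alpha_bounds (a1 a2 : R * R) md eps : permittivity a1 a2 eps ->
  exists2 C, 0 < C & {ae mu2, forall x, 0 < alpha md eps x <= C}.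
Proof.
move=> [_ [lo [hi [lo0 bnd]]] _]; case: md.
  exists lo^-1; first by rewrite invr_gt0.
  apply: ae_imp bnd => x /andP[h1 _]; rewrite /alpha invr_gt0.
  have e0 : 0 < eps x by exact: lt_le_trans lo0 h1.
  by rewrite e0 lef_pV2.
by exists 1 => //; apply: ae_imp bnd => x _; rewrite ltr01 lexx.
Qed.

(** Clipping the weight [al] to the interval [[0, C]] changes it on a null set
    only and makes the product with [E] integrable. *)
Lemma weighted_integral_eq0 (A : set T2) (al E : R * R -> R) (C : R) : 0 < C ->
  measurable A -> measurable_fun setT (al : T2 -> measurableTypeR R) ->
  (forall x, 0 <= E x) -> mu2.-integrable A (EFin \o E) ->
  {ae mu2, forall x, 0 < al x <= C} ->
  \int[mu2]_(x in A) (al x * E x) = 0 ->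
  {ae mu2, forall x, A x -> E x = 0}.
Proof.
move=> C0 mA mal E0 iE bal int0.
have mE : measurable_fun A (E : T2 -> measurableTypeR R).
  by apply/measurable_EFinP; have [] := integrableP _ _ _ iE.
pose be x := Num.max 0 (Num.min C (al x)).
have mbe : measurable_fun setT (be : T2 -> measurableTypeR R).
  by apply: measurable_maxr; [exact: measurable_cst|apply: measurable_minr; [exact: measurable_cst|]].
have beE : {ae mu2, forall x, 0 < al x /\ be x = al x}.
  apply: ae_imp bal => x /andP[h1 h2]; split=> //.
  by rewrite /be (min_r h2) max_r// ltW.
have be0 x : 0 <= be x by rewrite le_max lexx.
have beC x : be x <= C by rewrite ge_max ltW//= ge_min lexx.
have ibe : mu2.-integrable A (EFin \o (fun x => be x * E x)).
  apply: (@le_integrable _ _ _ mu2 A mA _ (fun x => C%:E * (E x)%:E)%E).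
  - by apply/measurable_EFinP; apply: measurable_funM => //; exact: measurable_funTS.
  - move=> x _; rewrite /= lee_fin [leLHS]ger0_norm ?mulr_ge0// [leRHS]ger0_norm.
      by rewrite ler_wpM2r.
    by rewrite mulr_ge0// ltW.
  - exact: integrableZl.
have eqint : (\int[mu2]_(x in A) (al x * E x)%:E = \int[mu2]_(x in A) (be x * E x)%:E)%E.
  apply: ae_eq_integral => //.
  - by apply/measurable_EFinP; apply: measurable_funM => //; exact: measurable_funTS.
  - by have [] := integrableP _ _ _ ibe.
  - by apply: ae_imp beE => x [_ ->].
have z : (\int[mu2]_(x in A) `|(be x * E x)%:E| = 0)%E.
  under eq_integral => x _ do rewrite gee0_abs ?lee_fin ?mulr_ge0//.
  rewrite -[LHS]fineK; last by apply: (integrable_fin_num mA); exact: ibe.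
  by congr EFin; rewrite -eqint.
have mbeE : measurable_fun A (fun x => (be x * E x)%:E) by have [] := integrableP _ _ _ ibe.
have /(ae_eq_integral_abs _ mA mbeE) az := z.
apply: negligibleS (negligibleU beE az) => x /= nx.
apply: contrapT => /not_orP[/contrapT[al0 be1] /contrapT h]; apply: nx => Ax.
have := h Ax; rewrite be1 => -[] /eqP; rewrite mulf_eq0 gt_eqF//= => /eqP.
by [].
Qed.

(** The squared modulus of [cov]. *)
Definition cov_sq (kj : R) u g (x : R * R) : R :=
  (Re (g x) - kj * Im (u x)) ^+ 2 + (Im (g x) + kj * Re (u x)) ^+ 2.

Lemma energy_density (al : R) k u g1 g2 x :
  Re (al%:C%C * (cov k.1 u g1 x * ((cov k.1 u g1 x)^*)%C + cov k.2 u g2 x * ((cov k.2 u g2 x)^*)%C)) =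
  al * (cov_sq k.1 u g1 x + cov_sq k.2 u g2 x).
Proof.
rewrite /cov_sq /cov; case: (u x) => p q; case: (g1 x) => a b; case: (g2 x) => c d /=.
ring.
Qed.

Lemma cov_sq_ge0 (kj : R) u g x : 0 <= cov_sq kj u g x.
Proof. by rewrite addr_ge0// sqr_ge0. Qed.

Lemma cov_sq_integrable (kj : R) u g r : L2loc u -> L2loc g ->
  mu2.-integrable (sup_ball r) (EFin \o cov_sq kj u g).
Proof.
move=> [uR uI u2] [gR gI g2].
have b1 : mu2.-integrable (sup_ball r) (fun x => (2%:E * (Re (g x) ^+ 2 + Im (g x) ^+ 2)%:E)%E).
  by apply: integrableZl; [exact: measurable_sup_ball|exact: g2].
have b2 : mu2.-integrable (sup_ball r) (fun x => ((2 * kj ^+ 2)%:E * (Re (u x) ^+ 2 + Im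
  (u x) ^+ 2)%:E)%E).
  by apply: integrableZl; [exact: measurable_sup_ball|exact: u2].
apply: (le_integrable (measurable_sup_ball r) _ _ (integrableD (measurable_sup_ball r) b1 b2)).
  apply/measurable_EFinP; apply: (@measurable_funTS _ _ T2 (measurableTypeR R)).
  apply: measurable_funD; apply: measurable_funX.
    by apply: measurable_funB => //; apply: measurable_funM.
  by apply: measurable_funD => //; apply: measurable_funM.
move=> x _; rewrite /= lee_fin [leLHS]ger0_norm ?cov_sq_ge0// [leRHS]ger0_norm; last first.
  by rewrite addr_ge0// mulr_ge0// ?addr_ge0// ?sqr_ge0// mulr_ge0// sqr_ge0.
rewrite /cov_sq; have := sqr_ge0 (Re (g x) + kj * Im (u x)); have := sqr_ge0 (Im (g x) - kj * Re (u x)).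
nra.
Qed.

(** Test the eigenvalue equation with the solution itself: the right-hand side
    is zero, and the left-hand side is a weighted integral of squares. *)
Lemma zero_energy_cell (a1 a2 b1 b2 : R * R) md eps k u : dual_basis a1 a2 b1 b2 ->
  permittivity a1 a2 eps -> solution a1 a2 md eps k 0 u ->
  exists2 gu, H1per a1 a2 u gu &
    {ae mu2, forall x, cell a1 a2 x -> cov_sq k.1 u gu.1 x + cov_sq k.2 u gu.2 x = 0}.
Proof.
move=> bd eok [gu Hu sol]; exists gu => //.
have [C C0 bal] := alpha_bounds md eok.
have [_ uL [gL1 gL2 _ _]] := Hu.
apply: (weighted_integral_eq0 C0 (measurable_cell bd) (measurable_alpha md eok) _ _ bal).
- by move=> x; rewrite addr_ge0// cov_sq_ge0.
- apply: (integrableS (measurable_sup_ball (`|a1| + `|a2|)) (measurable_cell bd)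
  (@cell_sup_ball _ a1 a2)).
  exact: (integrableD (measurable_sup_ball _) (cov_sq_integrable k.1 _ uL gL1)
    (cov_sq_integrable k.2 _ uL gL2)).
have := sol u gu Hu; rewrite mul0r => /(congr1 (@complex.Re R)) /=.
move=> <-; apply: eq_Rintegral => x _; exact/esym/energy_density.
Qed.

Lemma periodic_translate (T : Type) (a1 a2 : R * R) (f : R * R -> T) (c1 c2 : int) x :
  lattice_periodic a1 a2 f ->
  f (x.1 + (a1 *~ c1 + a2 *~ c2).1, x.2 + (a1 *~ c1 + a2 *~ c2).2) = f x.
Proof. by move=> fp; rewrite -[RHS](fp x c1 c2) -addrA. Qed.

Lemma gradient_translate (a1 a2 e : R * R) u g (c1 c2 : int) :
  lattice_periodic a1 a2 u -> L2loc u -> L2loc g -> weak_partial e u g ->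
  {ae mu2, forall x, g (x + a1 *~ c1 + a2 *~ c2) = g x}.
Proof.
move=> up /L2loc_locint[lU lV] /L2loc_locint[lG lH] /weak_partial_parts[wG wH].
pose h := a1 *~ c1 + a2 *~ c2.
have aG : {ae mu2, forall x, Re (g (x.1 + h.1, x.2 + h.2)) = Re (g x)}.
  by apply: (weak_deriv_periodic lU lG _ wG) => x; rewrite periodic_translate.
have aH : {ae mu2, forall x, Im (g (x.1 + h.1, x.2 + h.2)) = Im (g x)}.
  by apply: (weak_deriv_periodic lV lH _ wH) => x; rewrite periodic_translate.
apply: negligibleS (negligibleU aG aH) => x /= nx; apply: contrapT.
move=> /not_orP[/contrapT h1 /contrapT h2]; apply: nx; rewrite -addrA.
by apply/eqP; rewrite eq_complex; apply/andP; split; apply/eqP.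
Qed.

(** The weak gradient of a periodic function is periodic almost everywhere,
    which carries the equality from the cell to the plane. *)
Lemma zero_energy_everywhere (a1 a2 b1 b2 : R * R) md eps k u : dual_basis a1 a2 b1 b2 ->
  permittivity a1 a2 eps -> solution a1 a2 md eps k 0 u ->
  exists2 gu, H1per a1 a2 u gu &
    {ae mu2, forall x, cov_sq k.1 u gu.1 x = 0 /\ cov_sq k.2 u gu.2 x = 0}.
Proof.
move=> bd eok /(zero_energy_cell bd eok)[gu Hu cell0]; exists gu => //.
have [up uL [gL1 gL2 w1 w2]] := Hu.
pose P x := cov_sq k.1 u gu.1 x + cov_sq k.2 u gu.2 x = 0.
have : {ae mu2, forall x, P x}.
  apply: (ae_from_cell bd cell0) => c1 c2.
  have t1 := gradient_translate c1 c2 up uL gL1 w1.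
  have t2 := gradient_translate c1 c2 up uL gL2 w2.
  apply: negligibleS (negligibleU t1 t2) => x /= nx; apply: contrapT.
  move=> /not_orP[/contrapT h1 /contrapT h2]; apply: nx.
  by rewrite /P /cov_sq h1 h2 up.
apply: ae_imp => x /eqP; rewrite paddr_eq0 ?cov_sq_ge0// => /andP[/eqP h1 /eqP h2].
by split.
Qed.

Lemma cov_sq_eq0 (kj : R) u g x : cov_sq kj u g x = 0 ->
  Re (g x) = kj * Im (u x) /\ Im (g x) = - kj * Re (u x).
Proof.
move/eqP; rewrite paddr_eq0 ?sqr_ge0// !sqrf_eq0 => /andP[/eqP h1 /eqP h2].
by split; lra.
Qed.

Lemma wave_of_gradient e (kj : R) u g : L2loc u -> L2loc g -> weak_partial e u g ->
  {ae mu2, forall x, cov_sq kj u g x = 0} ->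
  wave_equation e kj (fun x => Re (u x)) (fun x => Im (u x)).
Proof.
move=> /L2loc_locint[lU lV] /L2loc_locint[lG lH] /weak_partial_parts[wG wH] z.
have zG : {ae mu2, forall x, Re (g x) = kj * Im (u x)}.
  by apply: ae_imp z => x /cov_sq_eq0[].
have zH : {ae mu2, forall x, Im (g x) = - kj * Re (u x)}.
  by apply: ae_imp z => x /cov_sq_eq0[].
have Z (f F : R * R -> R) (c : R) : locint f -> bumps F ->
    \int[mu2]_x (c * f x * F x) = c * \int[mu2]_x (f x * F x).
  move=> lf bF; rewrite -RintegralZl//; last exact: bumps_integrable lf bF.
  by apply: eq_RintegralT => x /=; rewrite mulrA.
move=> F F' bF bF' dF; rewrite (wG _ _ bF bF' dF) (wH _ _ bF bF' dF).
rewrite (ae_eq_RintegralT lG (locintZ kj lV) bF zG) (ae_eq_RintegralT lH (locintZ (- kj) lU) bF zH).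
by rewrite !Z// mulNr; split=> //; rewrite mulNr opprK.
Qed.

(** Since its energy vanishes, the solution satisfies the wave equation with
    wave vector [k] in both directions, and it is periodic with periods [a1]
    and [a2]. *)
Lemma zero_mode_reciprocal (a1 a2 b1 b2 : R * R) md eps k : dual_basis a1 a2 b1 b2 ->
  permittivity a1 a2 eps -> bloch_variety a1 a2 md eps (k, 0) ->
  exists m1 m2 : int, k = b1 *~ m1 + b2 *~ m2.
Proof.
move=> bd eok [u us un0]; rewrite /= in us.
have [gu [up uL [gL1 gL2 w1 w2]] z] := zero_energy_everywhere bd eok us.
have v1 : wave_equation (1, 0) k.1 (fun x => Re (u x)) (fun x => Im (u x)).
  by apply: (wave_of_gradient uL gL1 w1); apply: ae_imp z => x [].
have v2 : wave_equation (0, 1) k.2 (fun x => Re (u x)) (fun x => Im (u x)).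
  by apply: (wave_of_gradient uL gL2 w2); apply: ae_imp z => x [].
have [lU lV] := L2loc_locint uL.
have n0 : ~ {ae mu2, forall x, Re (u x) = 0 /\ Im (u x) = 0}.
  move=> h; apply: un0; apply: ae_imp h => x [h1 h2].
  by apply/eqP; rewrite eq_complex h1 h2 !eqxx.
have key h : (forall x, u (x.1 + h.1, x.2 + h.2) = u x) -> cos (dot k h) = 1.
  by move=> hp; apply: (wave_lattice lU lV _ _ v1 v2 n0) => x; rewrite hp.
apply: (reciprocal_of_cos bd); apply: key => x.
  by rewrite -[RHS](periodic_translate 1 0 x up) mulr1z mulr0z addr0.
by rewrite -[RHS](periodic_translate 0 1 x up) mulr1z mulr0z add0r.
Qed.

End ZeroMode.

(** * The band functions *)

Section Bands.
Context {R : realType}.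
Variables (a1 a2 b1 b2 : R * R) (md : mode) (eps : R * R -> R) (lam : nat -> R * R -> R).
Hypothesis lam_enum : eigenvalue_enumeration a1 a2 md eps lam.

Lemma lam_ge0 n k : (0 < n)%N -> 0 <= lam n k.
Proof.
have [l1 lS _ _] := lam_enum k.
by elim: n => [//|[//|n] ih _]; apply: le_trans (lS n.+1 isT); exact: ih.
Qed.

(** The eigenvalue zero occurs only at reciprocal lattice points, and the
    origin is the only one in the Brillouin zone. *)
Lemma lam_gt0 n k : dual_basis a1 a2 b1 b2 -> permittivity a1 a2 eps -> (0 < n)%N ->
  brillouin b1 b2 k -> k != (0, 0) -> 0 < lam n k.
Proof.
move=> bd eok n0 Bk k0; rewrite lt_def lam_ge0// andbT; apply: contra k0 => /eqP l0.
apply/eqP; apply: (brillouin_reciprocal Bk).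
by apply: (zero_mode_reciprocal bd eok (md := md)); rewrite -l0; exact: (eigenvalue_in_bloch lam_enum).
Qed.

End Bands.

Lemma negligible_point (R : realType) (p : R * R) : (lebesgue2 R).-negligible [set p].
Proof.
have pE : [set p] = [set p.1] `*` [set p.2].
  by apply/seteqP; split=> -[x y] /=; case: p => a b /= [-> ->].
exists [set p]; split=> //; rewrite pE; first by apply: measurableX; exact: measurable_set1.
rewrite /lebesgue2 /= product_measure1E; [|exact: measurable_set1|exact: measurable_set1].
exact: etrans (f_equal2 mule (lebesgue_measure_set1 p.1) (lebesgue_measure_set1 p.2)) (mul0e _).
Qed.

Theorem theorem3p2 (R : realType) (a1 a2 b1 b2 : R * R) (eps : R * R -> R)
    (md : mode) (c : R) (lam : nat -> R * R -> R) (D : (R * R) * R -> R)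
    (a_free : lin_indep2 a1 a2)
    (b_dual : dual_basis a1 a2 b1 b2)
    (eps_ok : permittivity a1 a2 eps)
    (c_gt0 : 0 < c)
    (lam_enum : eigenvalue_enumeration a1 a2 md eps lam)
    (lam_cont : forall n : nat, (0 < n)%N -> continuous (lam n))
    (D_disp : dispersion_function a1 a2 md eps D) :
  forall n : nat, (0 < n)%N ->
    let X := branch_points b1 b2 (bloch_variety a1 a2 md eps) D lam n
             `|` [set (0, 0)] in
    [/\ X `<=` brillouin b1 b2,
        (lebesgue2 R).-negligible X
      & forall k : R * R, (brillouin b1 b2 `\` X) k ->
          analytic2_at (band c lam n) k].
Proof.
move=> n n0 X; have [D_an _ DB] := D_disp; split.
- by move=> k [[]//|->]; exact: brillouin0.
- apply: negligibleS (negligibleU (singular_projections_null D_an _) (negligible_point (0, 0))).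
    by move=> k [[_ [l [_ s]]]|k0]; [left; exists l; rewrite DB|right].
  by move=> p; exact: (dispersion_finite_order lam_enum p D_disp).
move=> k [Bk nX]; have k0 : k != (0, 0) by apply/eqP => k0; apply: nX; right.
have in_bloch x := eigenvalue_in_bloch lam_enum x n0.
have reg : regular_part (bloch_variety a1 a2 md eps) D (k, lam n k).
  apply: contrapT => nreg; apply: nX; left; split=> //; exists (lam n k); split.
    by exists n; rewrite n0 leqnn.
  by split.
have lam_an := regular_analytic (D_an _) (lam_cont n n0 k) in_bloch reg.
have lam_pos := lam_gt0 lam_enum b_dual eps_ok n0 Bk k0.
apply: (germ_analytic2 ltr01 _ (germ_mul (germ_cst _ c) (germ_sqrt lam_an _))) => //.
by rewrite /= !addr0 -surjective_pairing.
Qed.
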